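(* Let $f=(f_1,\dots,f_n)$ be an $n$-tuple of formal power series with the model property and let $J\ne H^\infty(\mathbb B_f)$ be a WOT-closed two-sided ideal of $H^\infty(\mathbb B_f)$. If $\mathcal H,\mathcal H'$ are Hilbert spaces, $T=(T_1,\dots,T_n)\in\mathcal V_{f,J}^{cnc}(\mathcal H)$ and $T'=(T_1',\dots,T_n')\in\mathcal V_{f,J}^{cnc}(\mathcal H')$, then $T$ and $T'$ are unitarily equivalent if and only if their constrained characteristic functions $\Theta_{f,T,J}$ and $\Theta_{f,T',J}$ coincide.
   Context: Words and series. $\mathbb F_n^+$ is the free semigroup of words in the letters $1,\dots,n$, with empty word $\varnothing$; $|\alpha|$ is the length of $\alpha$. For an $n$-tuple $Y=(Y_1,\dots,Y_n)$ of elements of a unital algebra, $Y_\alpha:=Y_{i_1}\cdots Y_{i_k}$ if $\alpha=i_1\cdots i_k$, and $Y_\varnothing:=1$. Power series are formal power series $\psi=\sum_\alpha a_\alpha Z_\alpha$ with complex coefficients in noncommuting indeterminates $Z_1,\dots,Z_n$. For $Y\in B(\mathcal H)^n$ put $\psi(Y):=\sum_{k\ge0}\sum_{|\alpha|=k}a_\alpha Y_\alpha$ (series over $k$); $\mathcal C_\psi(\mathcal H)$ (resp. $\mathcal C_\psi^{SOT}(\mathcal H)$) is the set of $Y$ for which this converges in norm (resp. in the strong operator topology, SOT). $\mathcal C_\psi^{rad}(\mathcal H)$ is the set of $Y$ for which there is $\delta\in(0,1)$ with $rY\in\mathcal C_\psi(\mathcal H)$ for $r\in(\delta,1)$ and $\text{SOT-}\lim_{r\to1}\psi(rY)$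 exists; then $\psi(Y)$ denotes this limit. For an $n$-tuple $f=(f_1,\dots,f_n)$ of power series these conditions are required for every $f_i$; $f(Y)=(f_1(Y),\dots,f_n(Y))$ is also regarded as a row operator $\mathcal H^{(n)}\to\mathcal H$, where $\mathcal H^{(n)}$ is the direct sum of $n$ copies of $\mathcal H$. $[B(\mathcal H)^n]_r:=\{X\in B(\mathcal H)^n:\|\sum_iX_iX_i^*\|^{1/2}<r\}$. A free holomorphic function on $[B(\mathcal H)^n]_\gamma$ is (the evaluation map of) a power series with $\limsup_k(\sum_{|\alpha|=k}|a_\alpha|^2)^{1/2k}\le1/\gamma$. Model property. $\mathbb H^2(f)$ denotes the Hilbert space with orthonormal basis $\{f_\alpha\}_{\alpha\in\mathbb F_n^+}$ ($f_\varnothing=1$), whose elements are the series $\sum_\alpha c_\alpha f_\alpha$, $\sum|c_\alpha|^2<\infty$. $f$ has the model property ($f\in\mathcal M$) if one of the following holds. ($\mathcal A$) $f$ is an $n$-tuple of noncommutative polynomials and there is an $n$-tuple $q$ of polynomials with $f\circ q=q\circ f=\mathrm{id}$. ($\mathcal S$) $f(0)=0$, each $f_i$ has nonzero radius of convergence, the matrix of linear coefficients of $f$ is invertible ($\det J_f(0)\ne0$; then elements of $\mathbb H^2(f)$ are formal power series), $Z_1,\dots,Z_n\in\mathbb H^2(f)$, each $M_{Z_i}\psi:=Z_i\psi$ is a bounded operator on $\mathbb H^2(f)$, and $M_{f_j}=f_j(M_{Z_1},\dots,M_{Z_n})$, where $M_{f_j}\psi:=f_j\psi$ and $(M_{Z_1},\dots,M_{Z_n})$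 is in $\mathcal C_f^{SOT}(\mathbb H^2(f))$ or $\mathcal C_f^{rad}(\mathbb H^2(f))$. ($\mathcal F$) for some $\gamma>0$, $f$ is an $n$-tuple of free holomorphic functions on $[B(\mathcal H)^n]_\gamma$ ($\mathcal H$ infinite dimensional) with range in $[B(\mathcal H)^n]_1$, there is no nonzero free holomorphic $G$ on $[B(\mathcal H)^n]_1$ with $G\circ f=0$ (then $\mathbb H^2(f)=\{G\circ f: G=\sum c_\alpha Z_\alpha,\ \sum|c_\alpha|^2<\infty\}$), the coordinate functions lie in $\mathbb H^2(f)$, and the boundedness of $M_{Z_i}$ and $M_{f_j}=f_j(M_{Z_1},\dots,M_{Z_n})$ hold as in ($\mathcal S$). The universal model of $\mathbb B_f$ is $M_Z=(M_{Z_1},\dots,M_{Z_n})$. Writing $Z_i=\sum_\alpha a_\alpha^{(i)}f_\alpha$ in $\mathbb H^2(f)$, the inverse of $f$ under composition is $g=(g_1,\dots,g_n)$, $g_i:=\sum_\alpha a^{(i)}_\alpha Z_\alpha$ (so $g\circ f=\mathrm{id}$). Domain. $\mathbb B_f(\mathcal H)$ is the set of $X\in B(\mathcal H)^n$ with $X\in\mathcal C_f^{SOT}(\mathcal H)$ or $X\in\mathcal C_f^{rad}(\mathcal H)$, $\|f(X)\|\le1$ and $g(f(X))=X$, meaning that either $X_i=\sum_k\sum_{|\alpha|=k}a_\alpha^{(i)}[f(X)]_\alpha$ (SOT convergence) for all $i$, or $X_i=\text{SOT-}\lim_{r\to1}\sum_k\sum_{|\alpha|=k}a_\alpha^{(i)}r^{|\alpha|}[f(X)]_\alpha$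 for all $i$. $T\in\mathbb B_f(\mathcal H)$ is completely non-coisometric (c.n.c.) if no nonzero $h\in\mathcal H$ satisfies $\langle\Phi_{f,T}^m(I)h,h\rangle=\|h\|^2$ for all $m\ge1$, where $\Phi_{f,T}(Y):=\sum_if_i(T)Yf_i(T)^*$. $\mathbb B_f^{cnc}(\mathcal H)$ is the set of c.n.c. elements of $\mathbb B_f(\mathcal H)$. Varieties. $H^\infty(\mathbb B_f)$ is the WOT-closure (weak operator topology) in $B(\mathbb H^2(f))$ of all polynomials in $M_{Z_1},\dots,M_{Z_n}$ and the identity. $F_n^\infty$ is the weakly closed algebra generated by the identity and the left creation operators $S_ie_\alpha=e_{i\alpha}$ on the full Fock space with orthonormal basis $\{e_\alpha\}_{\alpha\in\mathbb F_n^+}$; $\varphi\in F_n^\infty$ has Fourier representation $\sum c_\alpha S_\alpha$ where $\varphi e_\varnothing=\sum c_\alpha e_\alpha$. One has $H^\infty(\mathbb B_f)=\{\varphi(f(M_Z)):\varphi\in F_n^\infty\}$, with $\varphi(f(M_Z)):=\text{SOT-}\lim_{r\to1}\sum_k\sum_{|\alpha|=k}c_\alpha r^{|\alpha|}[f(M_Z)]_\alpha$. For $\psi=\varphi(f(M_Z))$ and $T\in\mathbb B_f^{cnc}(\mathcal H)$, $\psi(T_1,\dots,T_n):=\text{SOT-}\lim_{r\to1}\sum_k\sum_{|\alpha|=k}c_\alpha r^{|\alpha|}[f(T)]_\alpha$ (the limit exists). For a WOT-closed two-sided ideal $J$ of $H^\infty(\mathbb B_f)$: $\mathcal V_{f,J}^{cnc}(\mathcal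 H):=\{T\in\mathbb B_f^{cnc}(\mathcal H):\psi(T)=0\ \text{for all}\ \psi\in J\}$, $\mathcal M_{f,J}:=\overline{J\mathbb H^2(f)}$, $\mathcal N_{f,J}:=\mathbb H^2(f)\ominus\mathcal M_{f,J}$, and $B_i:=P_{\mathcal N_{f,J}}M_{Z_i}|_{\mathcal N_{f,J}}$. Constrained characteristic function. For $T\in\mathcal V_{f,J}^{cnc}(\mathcal H)$: $\Delta_{f,T}:=(I_{\mathcal H}-\sum_if_i(T)f_i(T)^* )^{1/2}$, $\Delta_{f,T^*}:=(I_{\mathcal H^{(n)}}-f(T)^*f(T))^{1/2}$, $\mathcal D_{f,T}:=\overline{\Delta_{f,T}\mathcal H}$, $\mathcal D_{f,T^*}:=\overline{\Delta_{f,T^*}\mathcal H^{(n)}}$. $\Lambda_i$ is right multiplication by $f_i$ on $\mathbb H^2(f)$ ($\Lambda_if_\alpha=f_\alpha f_i$) and $W_i:=P_{\mathcal N_{f,J}}\Lambda_i|_{\mathcal N_{f,J}}$. $\Theta_{f,T,J}:\mathcal N_{f,J}\otimes\mathcal D_{f,T^*}\to\mathcal N_{f,J}\otimes\mathcal D_{f,T}$ is the contraction with formal Fourier representation $$-I\otimes f(T)+(I\otimes\Delta_{f,T})\Big(I-\sum_iW_i\otimes f_i(T)^*\Big)^{-1}[W_1\otimes I_{\mathcal H},\dots,W_n\otimes I_{\mathcal H}](I\otimes\Delta_{f,T^*}),$$ i.e. the SOT-limit as $r\uparrow1$ of the operators obtained by replacing each $W_i$ by $rW_i$. It is multi-analytic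 with respect to $B_1,\dots,B_n$, i.e. $\Theta_{f,T,J}(B_i\otimes I)=(B_i\otimes I)\Theta_{f,T,J}$. Coincidence. Two operators $\Phi:\mathcal N_{f,J}\otimes\mathcal K_1\to\mathcal N_{f,J}\otimes\mathcal K_2$ and $\Phi':\mathcal N_{f,J}\otimes\mathcal K_1'\to\mathcal N_{f,J}\otimes\mathcal K_2'$ that are multi-analytic with respect to $B_1,\dots,B_n$ coincide if there are unitary operators $\tau_j:\mathcal K_j\to\mathcal K_j'$, $j=1,2$, with $\Phi'(I\otimes\tau_1)=(I\otimes\tau_2)\Phi$. *)

(* Defs.v *)
From HB Require Import structures.
From mathcomp Require Import all_boot all_order all_algebra.
From mathcomp Require Import finmap complex.
From mathcomp Require Import all_classical all_reals.
From mathcomp Require Import interval_inference ereal topology normedtype.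
From mathcomp Require Import sequences exp.
From mathcomp Require Import ring lra.
From mathcomp Require summability.

Set Implicit Arguments.
Unset Strict Implicit.
Unset Printing Implicit Defensive.

Import Order.TTheory GRing.Theory Num.Theory.
Import numFieldNormedType.Exports.

Local Open Scope classical_set_scope.
Local Open Scope complex_scope.
Local Open Scope ring_scope.

HB.mixin Record CompleteNormedModule_isHilbert (R : realType) H
    & CompleteNormedModule R[i] H := {
  inner : H -> H -> R[i];
  innerDl : forall x y z, inner (x + y) z = inner x z + inner y z;
  innerZl : forall a x y, inner (a *: x) y = a * inner x y;
  innerC : forall x y, inner y x = (inner x y)^*%C;
  inner_normr : forall x, inner x x = `|x| ^+ 2
}.

#[short(type="hilbertType")]
HB.structure Definition Hilbert (R : realType) :=
  {H of CompleteNormedModule R[i] H & CompleteNormedModule_isHilbert R H}.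

Definition nrm (R : realType) (V : normedModType R[i]) (x : V) : R :=
  complex.Re `|x|.

(* MathComp-Analysis puts a topology on K^o for every numFieldType K; here it is
   transferred to the concrete type R[i]. *)
HB.instance Definition _ (R : realType) :=
  NormedModule.copy R[i] (R[i]^o).

Section NrmTheory.
Variables (R : realType) (V : normedModType R[i]).
Implicit Types x y : V.

Lemma nrmE x : `|x| = (nrm x)%:C.
Proof. by rewrite /nrm RRe_real // normr_real. Qed.

Lemma nrm_ge0 x : 0 <= nrm x.
Proof. by have := normr_ge0 x; rewrite nrmE lecR. Qed.

Lemma nrmZ a x : nrm (a *: x) = nrm a * nrm x.
Proof. by apply: complexI; rewrite rmorphM /= -!nrmE normrZ. Qed.

Lemma ler_nrmD x y : nrm (x + y) <= nrm x + nrm y.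
Proof. by rewrite -lecR rmorphD /= -!nrmE ler_normD. Qed.

Lemma nrm0 : nrm (0 : V) = 0.
Proof. by apply: complexI; rewrite -nrmE normr0. Qed.

Lemma nrmN x : nrm (- x) = nrm x.
Proof. by rewrite /nrm normrN. Qed.

Lemma nrm_distC x y : nrm (x - y) = nrm (y - x).
Proof. by rewrite /nrm distrC. Qed.

Lemma cvg_nrmP T (F : set_system T) (FF : Filter F) (f : T -> V) (y : V) :
  f @ F --> y <-> forall e : R, 0 < e -> \forall t \near F, nrm (y - f t) <= e.
Proof.
split => [/cvgrPdist_le fy e e0|h].
  have := fy e%:C; rewrite ltcR => /(_ e0); apply: filterS => t.
  by rewrite nrmE lecR.
apply/cvgrPdist_le => e e0; have eE : e = (complex.Re e)%:C.
  by rewrite RRe_real // gtr0_real.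
have := h (complex.Re e); rewrite -ltcR -eE => /(_ e0).
by apply: filterS => t; rewrite nrmE eE lecR.
Qed.

End NrmTheory.

Section ScalarHilbert.
Variable R : realType.
Local Notation C := R[i].

Lemma Re_nrm (z : C) : `|complex.Re z| <= nrm z.
Proof. by rewrite -lecR -nrmE normc_ge_Re. Qed.

Lemma nrm_sqrE (z : C) : nrm z ^+ 2 = complex.Re z ^+ 2 + complex.Im z ^+ 2.
Proof. by apply: complexI; rewrite rmorphXn /= -nrmE -add_Re2_Im2. Qed.

Lemma Im_nrm (z : C) : `|complex.Im z| <= nrm z.
Proof.
rewrite -(@ler_pXn2r _ 2) ?nnegrE ?nrm_ge0 // nrm_sqrE real_normK ?num_real //.
by rewrite lerDr sqr_ge0.
Qed.

Lemma nrm_ReIm (z : C) : nrm z <= `|complex.Re z| + `|complex.Im z|.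
Proof.
rewrite -(@ler_pXn2r _ 2) ?nnegrE ?nrm_ge0 ?addr_ge0 // nrm_sqrE sqrrD.
by rewrite !real_normK ?num_real // addrAC lerDl mulrn_wge0 // mulr_ge0.
Qed.

Lemma cvg_ReIm T (F : set_system T) (FF : Filter F) (f : T -> C) (a b : R) :
  (fun t => complex.Re (f t)) @ F --> a ->
  (fun t => complex.Im (f t)) @ F --> b -> f @ F --> (a +i* b : C).
Proof.
move=> fa fb; apply/cvg_nrmP => e e0.
have e20 : 0 < e / 2 by rewrite divr_gt0.
move/cvgrPdist_le : fa => /(_ _ e20) fa.
move/cvgrPdist_le : fb => /(_ _ e20) fb.
near=> t; apply: (le_trans (nrm_ReIm _)).
rewrite [leRHS]splitr lerD //.
  rewrite (_ : complex.Re _ = a - complex.Re (f t)); first by near: t.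
  by case: (f t).
rewrite (_ : complex.Im _ = b - complex.Im (f t)); first by near: t.
by case: (f t).
Unshelve. all: by end_near. Qed.

Lemma cauchy_ReIm (F : set_system C) (FF : ProperFilter F) (p : C -> R) :
  (forall z w, `|p z - p w| <= nrm (z - w)) -> cauchy F -> cauchy (p @ F).
Proof.
move=> pL /cauchy_ballP Fc; apply/cauchy_ballP => e e0.
have := Fc e%:C; rewrite ltcR => /(_ e0).
case=> -[A B] /= [FA FB] AB.
exists (p @` A, p @` B).
  by split; [apply: filterS FA | apply: filterS FB]; exact: preimage_image.
move=> [_ _] /= [[z Az <-] [w Bw <-]].
have := AB (z, w) (conj Az Bw).
rewrite /= -!ball_normE /ball_ /= nrmE ltcR; exact: le_lt_trans.
Qed.

Lemma scalar_complete (F : set_system C) : ProperFilter F -> cauchy F -> cvg F.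
Proof.
move=> FF Fc.
have /R_complete/cvg_ex[a Fa] : cauchy ((@complex.Re R : C -> R) @ F).
  apply: cauchy_ReIm => // z w; have := Re_nrm (z - w).
  by case: z w => [? ?] [].
have /R_complete/cvg_ex[b Fb] : cauchy ((@complex.Im R : C -> R) @ F).
  apply: cauchy_ReIm => // z w; have := Im_nrm (z - w).
  by case: z w => [? ?] [].
apply/cvg_ex; exists (a +i* b).
exact: (@cvg_ReIm _ F _ id).
Qed.

HB.instance Definition _ := Uniform_isComplete.Build C scalar_complete.

Definition scalar_inner (z w : C) : R[i] := z * w^*%C.

Lemma scalar_innerDl x y z :
  scalar_inner (x + y) z = scalar_inner x z + scalar_inner y z.
Proof. exact: mulrDl. Qed.

Lemma scalar_innerZl a x y : scalar_inner (a *: x) y = a * scalar_inner x y.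
Proof. by rewrite /scalar_inner -mulrA. Qed.

Lemma scalar_innerC x y : scalar_inner y x = (scalar_inner x y)^*%C.
Proof. by rewrite /scalar_inner rmorphM /= conjcK mulrC. Qed.

Lemma scalar_inner_normr x : scalar_inner x x = `|x| ^+ 2.
Proof. by rewrite /scalar_inner -sqr_normc. Qed.

HB.instance Definition _ := CompleteNormedModule_isHilbert.Build R C
  scalar_innerDl scalar_innerZl scalar_innerC scalar_inner_normr.

End ScalarHilbert.

Section InnerTheory.
Variables (R : realType) (H : hilbertType R).
Implicit Types x y z : H.

Lemma innerDr x y z : inner x (y + z) = inner x y + inner x z.
Proof. by rewrite innerC innerDl rmorphD /= -!innerC. Qed.

Lemma innerZr a x y : inner x (a *: y) = a^*%C * inner x y.
Proof. by rewrite innerC innerZl rmorphM /= -innerC. Qed.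

Lemma innerE x : inner x x = (nrm x ^+ 2)%:C.
Proof. by rewrite inner_normr nrmE rmorphXn. Qed.

Lemma nrmD_sqr x y :
  nrm (x + y) ^+ 2 = nrm x ^+ 2 + nrm y ^+ 2 + complex.Re (inner x y) *+ 2.
Proof.
have := innerE (x + y).
rewrite innerDl !innerDr !innerE (innerC x y).
move/(congr1 (@complex.Re R)); case: (inner x y) => a b /= <-.
by rewrite mulr2n; ring.
Qed.

Lemma innerNr x y : inner x (- y) = - inner x y.
Proof. by rewrite -scaleN1r innerZr rmorphN1 mulN1r. Qed.

Lemma nrmD_le x y : nrm (x + y) ^+ 2 <= (nrm x ^+ 2 + nrm y ^+ 2) *+ 2.
Proof.
have := sqr_ge0 (nrm (x - y)); rewrite !nrmD_sqr nrmN innerNr.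
case: (inner x y) => a b /=; lra.
Qed.

Lemma Im_inner x y : complex.Im (inner x y) = complex.Re (inner x ('i%C *: y)).
Proof. by rewrite innerZr; case: (inner x y) => a b /=; ring. Qed.

End InnerTheory.

#[local] Existing Instance summability.totally_filter.

Section SquareSummable.
Variables (R : realType) (W : choiceType) (K : hilbertType R).
Implicit Types (x y : W -> K) (A B : {fset W}).
Local Notation totally := (@summability.totally W).

Definition sqsum x A : R := \sum_(w <- A) nrm (x w) ^+ 2.

Definition square_summable : {pred W -> K} :=
  fun x => `[< exists M : R, forall A, sqsum x A <= M >].

Definition l2_inner x y : R[i] := summability.sum (fun w => inner (x w) (y w)).

Lemma sqsum_ge0 x A : 0 <= sqsum x A.
Proof. by apply: sumr_ge0 => w _; apply: sqr_ge0. Qed.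

Lemma le_sqsum x A B : (A `<=` B)%fset -> sqsum x A <= sqsum x B.
Proof.
move=> AB; have AE : perm_eq [seq w <- B | w \in A] A.
  apply: uniq_perm; [exact/filter_uniq/fset_uniq|exact: fset_uniq|move=> w].
  by rewrite mem_filter; apply: andb_idr => /(fsubsetP AB).
rewrite /sqsum [leRHS](bigID (mem A)) /= -[X in _ <= X + _]big_filter.
rewrite [X in _ <= X + _](perm_big _ AE) /=.
by rewrite lerDl sumr_ge0 // => w _; apply: sqr_ge0.
Qed.

Lemma sqsum_ub x : x \in square_summable -> has_ubound (range (sqsum x)).
Proof. by move=> /asboolP[M xM]; exists M => _ [A _ <-]. Qed.

Lemma sqsum_le_sup x A : x \in square_summable ->
  sqsum x A <= sup (range (sqsum x)).
Proof. by move=> /sqsum_ub xub; apply: ub_le_sup => //; exists A. Qed.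

Lemma sqsum_cvg x : x \in square_summable ->
  sqsum x @ totally --> sup (range (sqsum x)).
Proof.
move=> xs; apply/cvgrPdist_le => e e0.
have [|_ [A _ <-] xA] := sup_adherent e0 (E := range (sqsum x)).
  by split; [exists (sqsum x fset0); exists fset0|apply: sqsum_ub].
exists A => // B /= /(@le_sqsum x) AB.
by rewrite ger0_norm ?subr_ge0 ?sqsum_le_sup //; lra.
Qed.

Lemma sqsumD x y A : sqsum (x + y) A <= (sqsum x A + sqsum y A) *+ 2.
Proof.
rewrite /sqsum -big_split -sumrMnl; apply: ler_sum => w _; exact: nrmD_le.
Qed.

Lemma sqsumZ a x A : sqsum (a *: x) A = nrm a ^+ 2 * sqsum x A.
Proof. by rewrite /sqsum mulr_sumr; apply: eq_bigr => w _; rewrite -exprMn -nrmZ. Qed.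

Lemma square_summable_submod : submod_closed square_summable.
Proof.
split=> [|a x y /asboolP[M xM] /asboolP[N yN]]; apply/asboolP.
  by exists 0 => A; rewrite /sqsum big1 // => w _; rewrite nrm0 expr0n.
exists ((nrm a ^+ 2 * M + N) *+ 2) => A; apply: (le_trans (sqsumD _ _ _)).
by rewrite lerMn2r /= lerD // sqsumZ ler_wpM2l ?sqr_ge0.
Qed.

HB.instance Definition _ := GRing.isSubmodClosed.Build R[i] (W -> K)
  square_summable square_summable_submod.

Lemma partial_innerE x y A :
  summability.partial_sum (fun w => inner (x w) (y w)) A =
  \sum_(w <- A) inner (x w) (y w).
Proof. by rewrite /summability.partial_sum big_seq_fsetE. Qed.

Lemma partial_inner_fun x y :
  summability.partial_sum (fun w => inner (x w) (y w)) =
  fun A => \sum_(w <- A) inner (x w) (y w).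
Proof. by apply/funext => A; apply: partial_innerE. Qed.

Lemma Re_partial_inner x y A :
  complex.Re (\sum_(w <- A) inner (x w) (y w)) =
  (sqsum (x + y) A - sqsum x A - sqsum y A) / 2.
Proof.
apply: (@mulIf _ 2) => //; rewrite divfK // /sqsum -!sumrB.
rewrite (big_morph (@complex.Re R) (id1 := 0) (op1 := +%R)) //; last by case=> ? ? [].
by rewrite mulr_suml; apply: eq_bigr => w _; rewrite nrmD_sqr; ring.
Qed.

Lemma Im_partial_inner x y A :
  complex.Im (\sum_(w <- A) inner (x w) (y w)) =
  complex.Re (\sum_(w <- A) inner (x w) (('i%C *: y) w)).
Proof.
rewrite (big_morph (@complex.Re R) (id1 := 0) (op1 := +%R)) //; last by case=> ? ? [].
rewrite (big_morph (@complex.Im R) (id1 := 0) (op1 := +%R)) //; last by case=> ? ? [].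
by apply: eq_bigr => w _; apply: Im_inner.
Qed.

Lemma l2_inner_cvg x y : x \in square_summable -> y \in square_summable ->
  summability.partial_sum (fun w => inner (x w) (y w)) @ totally
    --> l2_inner x y.
Proof.
move=> xs ys; apply/cvg_ex.
have aux z : z \in square_summable ->
    (fun A => complex.Re (\sum_(w <- A) inner (x w) (z w))) @ totally -->
    (sup (range (sqsum (x + z))) - sup (range (sqsum x))
      - sup (range (sqsum z))) / 2.
  move=> zs; under eq_fun do rewrite Re_partial_inner.
  by apply: cvgMl; do ?apply: cvgB; apply: sqsum_cvg; rewrite ?rpredD.
have iys : 'i%C *: y \in square_summable by rewrite rpredZ.
eexists; rewrite partial_inner_fun.
apply: (cvg_ReIm _ (aux _ ys)); under eq_fun do rewrite Im_partial_inner.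
exact: aux iys.
Qed.

Lemma l2_innerDl x y z : x \in square_summable -> y \in square_summable ->
  z \in square_summable -> l2_inner (x + y) z = l2_inner x z + l2_inner y z.
Proof.
move=> xs ys zs; apply: norm_cvg_lim.
rewrite (_ : summability.partial_sum _ =
    summability.partial_sum (fun w => inner (x w) (z w)) \+
    summability.partial_sum (fun w => inner (y w) (z w))); last first.
  apply/funext => A /=; rewrite !partial_innerE -big_split.
  by apply: eq_bigr => w _; apply: innerDl.
exact: cvgD (l2_inner_cvg xs zs) (l2_inner_cvg ys zs).
Qed.

Lemma l2_innerZl a x y : x \in square_summable -> y \in square_summable ->
  l2_inner (a *: x) y = a * l2_inner x y.
Proof.
move=> xs ys; apply: norm_cvg_lim.
rewrite (_ : summability.partial_sum _ =
    a \*: summability.partial_sum (fun w => inner (x w) (y w))); last first.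
  apply/funext => A /=; rewrite !partial_innerE scaler_sumr.
  by apply: eq_bigr => w _; apply: innerZl.
exact: cvgZr (l2_inner_cvg xs ys).
Qed.

Lemma l2_innerC x y : x \in square_summable -> y \in square_summable ->
  l2_inner y x = (l2_inner x y)^*%C.
Proof.
move=> xs ys; apply: norm_cvg_lim.
have /cvg_nrmP xy := l2_inner_cvg xs ys.
apply/cvg_nrmP => e /xy; apply: filterS => A.
rewrite !partial_innerE (_ : \sum_(w <- A) inner (y w) (x w) =
  (\sum_(w <- A) inner (x w) (y w))^*%C).
  by rewrite -rmorphB /nrm normcJ.
by rewrite rmorph_sum; apply: eq_bigr => w _; apply: innerC.
Qed.

Lemma l2_innerE x : x \in square_summable ->
  l2_inner x x = (sup (range (sqsum x)))%:C.
Proof.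
move=> xs; apply: norm_cvg_lim; rewrite partial_inner_fun.
have e A : \sum_(w <- A) inner (x w) (x w) = (sqsum x A)%:C.
  by rewrite rmorph_sum; apply: eq_bigr => w _; apply: innerE.
apply: cvg_ReIm; under eq_fun do rewrite e; first exact: sqsum_cvg.
exact: cvg_cst.
Qed.

End SquareSummable.

(* The Hilbert space of square-summable families indexed by [W]. It yields
   H^2(f) and Fock space ([W] the words, [K] the scalars), the direct sum of [n]
   copies of [K] ([W := 'I_n]), and the tensor product of H^2(f) with [K]. *)
Record l2 (R : realType) (W : choiceType) (K : hilbertType R) := L2 {
  l2fun :> W -> K;
  l2P : l2fun \in square_summable (K := K)
}.

Section L2.
Variables (R : realType) (W : choiceType) (K : hilbertType R).
Local Notation E := (l2 W K).
Implicit Types (x y : E) (A : {fset W}).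

HB.instance Definition _ := [isSub of E for @l2fun R W K].
HB.instance Definition _ := [Choice of E by <:].
HB.instance Definition _ := [SubChoice_isSubLmodule of E by <:].

Lemma l2funD x y : l2fun (x + y) = (x : W -> K) + y. Proof. by []. Qed.
Lemma l2funZ a x : l2fun (a *: x) = a *: (x : W -> K). Proof. by []. Qed.
Lemma l2funB x y : l2fun (x - y) = (x : W -> K) - y. Proof. by []. Qed.

Let nsq x : R := sup (range (sqsum x)).

Let nsqE x : l2_inner x x = (nsq x)%:C.
Proof. by rewrite l2_innerE // l2P. Qed.

Let sqsum_le_nsq x A : sqsum x A <= nsq x.
Proof. by rewrite sqsum_le_sup // l2P. Qed.

Let nsq_ge0 x : 0 <= nsq x.
Proof. exact: le_trans (sqsum_ge0 x fset0) (sqsum_le_nsq x fset0). Qed.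

Let nsq_le x M : (forall A, sqsum x A <= M) -> nsq x <= M.
Proof.
move=> xM; apply: ge_sup => [|_ [A _ <-]//].
by exists (sqsum x fset0); exists fset0.
Qed.

Let le_nsq x w : nrm (x w) ^+ 2 <= nsq x.
Proof. by have := sqsum_le_nsq x [fset w]%fset; rewrite /sqsum big_seq_fset1. Qed.

Let nsqD x y : nsq (x + y) = nsq x + nsq y + complex.Re (l2_inner x y) *+ 2.
Proof.
have := nsqE (x + y); rewrite l2funD l2_innerDl ?rpredD ?l2P //.
rewrite (l2_innerC _ (x := (x : W -> K) + y)) ?rpredD ?l2P //.
rewrite (l2_innerC _ (x := (x : W -> K) + y)) ?rpredD ?l2P //.
rewrite !l2_innerDl ?l2P // !nsqE (l2_innerC (l2P x) (l2P y)).
move/(congr1 (@complex.Re R)); case: (l2_inner x y) => a b /= <-.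
by rewrite mulr2n; ring.
Qed.

Let nsqZ a x : nsq (a *: x) = nrm a ^+ 2 * nsq x.
Proof.
apply: complexI; rewrite -nsqE l2funZ l2_innerZl ?rpredZ ?l2P //.
rewrite l2_innerC ?rpredZ ?l2P // l2_innerZl ?l2P // rmorphM /= nsqE conjc_real.
by rewrite mulrA -sqr_normc rmorphM rmorphXn /= -nrmE.
Qed.

Let nsq_eq0 x : nsq x = 0 -> x = 0.
Proof.
move=> x0; apply/val_inj/funext => w /=.
have := le_nsq x w; rewrite x0 => /(conj (sqr_ge0 _))/andP/le_anti/esym/eqP.
rewrite sqrf_eq0 => /eqP w0; apply/eqP; rewrite -normr_eq0 nrmE w0.
by [].
Qed.

Let CauchySchwarz x y :
  complex.Re (l2_inner x y) ^+ 2 <= nsq x * nsq y.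
Proof.
have [y0|y0] := eqVneq (nsq y) 0.
  have -> : y = 0 by apply: nsq_eq0.
  rewrite l2_innerC ?l2P // -[l2fun 0](scale0r (l2fun x)) l2_innerZl ?l2P //.
  by rewrite mul0r conjc0 expr0n /= mulr_ge0.
set r := complex.Re _; pose t := - (r / nsq y).
have := nsq_ge0 (x + t%:C *: y).
rewrite nsqD nsqZ l2_innerC ?l2P // l2funZ l2_innerZl ?l2P //.
rewrite nrm_sqrE /= (l2_innerC (l2P x) (l2P y)).
rewrite (_ : complex.Re _ = t * r); last first.
  by rewrite /r; case: (l2_inner x y) => a b /=; ring.
have yp : 0 < nsq y by rewrite lt_neqAle eq_sym y0 nsq_ge0.
rewrite -(pmulr_lge0 _ yp).
rewrite [X in 0 <= X](_ : _ = nsq x * nsq y - r ^+ 2) ?subr_ge0 //.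
by rewrite /t; field.
Qed.

Definition l2_norm x : R[i] := (Num.sqrt (complex.Re (l2_inner x x)))%:C.

Let l2_normE x : l2_norm x = (Num.sqrt (nsq x))%:C.
Proof. by rewrite /l2_norm nsqE. Qed.

Let l2_normD x y : l2_norm (x + y) <= l2_norm x + l2_norm y.
Proof.
rewrite !l2_normE -rmorphD lecR /=.
rewrite -(@ler_pXn2r _ 2) ?nnegrE ?addr_ge0 ?sqrtr_ge0 // sqrrD.
rewrite !sqr_sqrtr ?nsq_ge0 // nsqD addrAC lerD2r lerD2l lerMn2r /=.
apply: le_trans (ler_norm _) _.
by rewrite -sqrtr_sqr -sqrtrM // ler_sqrt ?mulr_ge0 // CauchySchwarz.
Qed.

Let l2_normZ a x : l2_norm (a *: x) = `|a| * l2_norm x.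
Proof.
rewrite !l2_normE nsqZ sqrtrM ?sqr_ge0 // sqrtr_sqr ger0_norm ?nrm_ge0 //.
by rewrite rmorphM /= -nrmE.
Qed.

Let l2_norm_eq0 x : l2_norm x = 0 -> x = 0.
Proof.
rewrite l2_normE => /complexI/eqP; rewrite sqrtr_eq0 => x0.
by apply: nsq_eq0; apply/le_anti; rewrite x0 nsq_ge0.
Qed.

HB.instance Definition _ :=
  Lmodule_isNormed.Build R[i] E l2_normD l2_normZ l2_norm_eq0.

Let nrm_nsq x : nrm x ^+ 2 = nsq x.
Proof.
apply: complexI; rewrite rmorphXn /= -nrmE -[LHS]/(l2_norm x ^+ 2) l2_normE.
by rewrite -rmorphXn /= sqr_sqrtr.
Qed.

Let nrm_coord x w : nrm (x w) <= nrm x.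
Proof. by rewrite -(@ler_pXn2r _ 2) ?nnegrE ?nrm_ge0 // nrm_nsq le_nsq. Qed.

Let l2_complete (F : set_system E) : ProperFilter F -> cauchy F -> cvg F.
Proof.
move=> FF /cauchy_ballP Fc.
have FcE (e : R) : 0 < e ->
    exists2 A : set E, F A & forall x y, A x -> A y -> nrm (x - y) <= e.
  move=> e0; have := Fc e%:C; rewrite ltcR => /(_ e0) [[A B] /= [FA FB]] AB.
  exists (A `&` B); first exact: filterI.
  move=> x y [Ax _] [_ By]; have := AB (x, y) (conj Ax By).
  by rewrite /= -!ball_normE /ball_ /= nrmE ltcR => /ltW.
have cw w : cvg ((fun x : E => x w) @ F).
  apply: cauchy_cvg; apply/cauchy_ballP => e e0.
  have eE : e = (complex.Re e)%:C by rewrite RRe_real // gtr0_real.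
  have e20 : 0 < complex.Re e / 2 by rewrite divr_gt0 // -ltcR -eE.
  have [A FA AA] := FcE _ e20.
  have FA' : ((fun x : E => x w) @ F) ((fun x : E => x w) @` A).
    by apply: (@filterS _ F _ A) => // x Ax; exists x.
  exists ((fun x : E => x w) @` A, (fun x : E => x w) @` A) => //.
  move=> [_ _] /= [[x Ax <-] [y Ay <-]]; rewrite -ball_normE /ball_ /= nrmE eE.
  rewrite ltcR (le_lt_trans (nrm_coord (x - y) w)) //.
  by rewrite (le_lt_trans (AA _ _ Ax Ay)) //; lra.
pose l w := lim ((fun x : E => x w) @ F).
have key (e : R) : 0 < e ->
    exists2 A : set E, F A &
      forall x, A x -> forall S, sqsum ((x : W -> K) - l) S <= e ^+ 2.
  move=> e0; have [A FA AA] := FcE _ e0; exists A => // x Ax S.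
  apply: (@closed_cvg _ _ F _
    (fun y : E => sqsum ((x : W -> K) - y) S) [set r | r <= e ^+ 2]).
  - exact: closed_le.
  - apply: filterS FA => y Ay /=; apply: (le_trans (sqsum_le_nsq (x - y) S)).
    by rewrite -nrm_nsq ler_pXn2r ?nnegrE ?nrm_ge0 ?(ltW e0) // AA.
  - apply: cvg_big => [|w _]; first exact: add_continuous.
    rewrite expr2; under eq_fun do rewrite expr2.
    suff : (fun y : E => nrm (x w - y w)) @ F --> nrm (x w - l w).
      by move=> cwl; apply: cvgM.
    apply/cvgrPdist_le => d d0.
    have /cvg_nrmP/(_ d d0) := cw w.
    apply: filterS => y; apply: le_trans.
    have := ler_nrmD (x w - y w) (y w - l w).
    have := ler_nrmD (x w - l w) (l w - y w).
    rewrite !addrA !subrK (nrm_distC (y w)) ler_norml => h1 h2.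
    by apply/andP; split; lra.
have [A FA Al] := key 1 ltr01.
have [x0 Ax0] := filter_ex FA.
have ls : l \in square_summable (K := K).
  rewrite -[l](subKr (x0 : W -> K)) rpredB ?l2P //.
  by apply/asboolP; exists (1 ^+ 2) => S; apply: Al.
apply/cvg_ex; exists (L2 ls); apply/(@cvg_nrmP _ _ _ F _ id) => e e0.
have [B FB Bl] := key e e0; apply: filterS FB => x Bx.
rewrite nrm_distC -(@ler_pXn2r _ 2) ?nnegrE ?nrm_ge0 ?(ltW e0) // nrm_nsq.
by apply: nsq_le => S; apply: Bl.
Qed.

HB.instance Definition _ := Uniform_isComplete.Build E l2_complete.

Let l2D x y (z : E) : l2_inner (x + y) z = l2_inner x z + l2_inner y z.
Proof. exact: l2_innerDl (l2P x) (l2P y) (l2P z). Qed.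

Let l2Z a x y : l2_inner (a *: x) y = a * l2_inner x y.
Proof. exact: l2_innerZl (l2P x) (l2P y). Qed.

Let l2C x y : l2_inner y x = (l2_inner x y)^*%C.
Proof. by rewrite l2_innerC ?l2P. Qed.

Let l2N x : l2_inner x x = `|x| ^+ 2.
Proof. by rewrite nsqE -nrm_nsq nrmE rmorphXn. Qed.

HB.instance Definition _ :=
  CompleteNormedModule_isHilbert.Build R E l2D l2Z l2C l2N.

End L2.

Section L2Elements.
Variables (R : realType) (W : choiceType) (K : hilbertType R).

Lemma inner_l2E (x y : l2 W K) : inner x y = l2_inner x y.
Proof. by []. Qed.

Lemma single_summable (w : W) (k : K) :
  (fun v => if v == w then k else 0) \in square_summable (K := K).
Proof.
apply/asboolP; exists (nrm k ^+ 2) => A; rewrite /sqsum.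
have [wA|wA] := boolP (w \in A); last first.
  rewrite big_seq big1 ?sqr_ge0 // => v vA.
  by rewrite ifN ?nrm0 ?expr0n //; apply: contraNneq wA => <-.
rewrite (bigD1_seq w) ?fset_uniq //= eqxx big1 ?addr0 // => v /negbTE->.
by rewrite nrm0 expr0n.
Qed.

Definition single (w : W) (k : K) : l2 W K := L2 (single_summable w k).

Lemma inner_single (w : W) (k : K) (x : l2 W K) :
  inner (single w k) x = inner k (x w).
Proof.
rewrite inner_l2E; apply: norm_cvg_lim; rewrite partial_inner_fun.
apply: cvg_near_cst; exists [fset w]%fset => // A /= /fsubsetP wA.
rewrite (bigD1_seq w) ?fset_uniq ?wA ?inE //= eqxx.
by rewrite big1 ?addr0 // => v /negbTE->; rewrite -(scale0r k) innerZl mul0r.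
Qed.

Lemma tens_summable (a : l2 W R[i]) (k : K) :
  (fun w => a w *: k) \in square_summable (K := K).
Proof.
have /asboolP[M aM] := l2P a; apply/asboolP; exists (M * nrm k ^+ 2) => A.
rewrite /sqsum; under eq_bigr do rewrite nrmZ exprMn.
by rewrite -mulr_suml; apply: ler_wpM2r; [exact: sqr_ge0|exact: aM].
Qed.

(* [l2 W K] serves as the Hilbert tensor product of [l2 W R[i]] and [K], with
   these elementary tensors: see [inner_tens] and [tens_total]. *)
Definition tens (a : l2 W R[i]) (k : K) : l2 W K := L2 (tens_summable a k).

Lemma inner_tens (a b : l2 W R[i]) (h k : K) :
  inner (tens a h) (tens b k) = inner a b * inner h k.
Proof.
rewrite inner_l2E; apply: norm_cvg_lim.
rewrite (_ : summability.partial_sum _ = inner h k \*: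
    summability.partial_sum (fun w => inner (a w) (b w))); last first.
  apply/funext => A; rewrite /= !partial_innerE scaler_sumr.
  apply: eq_bigr => w _; rewrite /= innerZl innerZr mulrA.
  by rewrite [RHS]mulrC.
by rewrite [X in _ --> X]mulrC; apply: cvgZr; apply: l2_inner_cvg; apply: l2P.
Qed.

End L2Elements.

Lemma tens_total (R : realType) (W : choiceType) (K : hilbertType R)
  (x : l2 W K) : (forall a k, inner (tens a k) x = 0) -> x = 0.
Proof.
move=> x0; apply/val_inj/funext => w /=.
have := x0 (single w (1 : R[i])) (x w).
rewrite (_ : tens _ _ = single w (x w)).
  rewrite inner_single innerE => /complexI/eqP; rewrite sqrf_eq0 => /eqP xw.
  by apply/eqP; rewrite -normr_eq0 nrmE xw.
by apply/val_inj/funext => v /=; case: eqP; rewrite ?scale1r ?scale0r.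
Qed.

Section Operators.
Variables (R : realType) (H K : hilbertType R).

Definition bounded_linear (A : H -> K) : Prop :=
  linear A /\ exists M : R, forall x, nrm (A x) <= M * nrm x.

(* Meaningful for bounded operators only: [sup] of an unbounded set is 0. *)
Definition opnorm (A : H -> K) : R :=
  sup [set nrm (A x) | x in [set x | nrm x <= 1]].

Definition adj (A : H -> K) : K -> H :=
  xget (cst 0) [set B | forall x y, inner (A x) y = inner x (B y)].

Definition norm_cvg T (F : set_system T) (A : T -> H -> K) (L : H -> K) :=
  bounded_linear L /\ opnorm (A t - L) @[t --> F] --> (0 : R).

Definition sot_cvg T (F : set_system T) (A : T -> H -> K) (L : H -> K) :=
  bounded_linear L /\ forall x, A t x @[t --> F] --> L x.

(* The unitary operators from a closed subspace [D] of [H] onto a closed subspace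
   [D'] of [K], each given by a bounded extension to all of [H]. *)
Definition unitary_on (D : set H) (D' : set K) (tau : H -> K) :=
  [/\ bounded_linear tau, forall x, D x -> nrm (tau x) = nrm x & tau @` D = D'].

End Operators.

Section Endomorphisms.
Variables (R : realType) (H : hilbertType R).

Definition positive_op (A : H -> H) := forall x, 0 <= inner (A x) x.

Definition sqrt_op (A : H -> H) : H -> H :=
  xget (cst 0)
    [set B | [/\ bounded_linear B, positive_op B & B \o B = A]].

Definition cspan (S : set H) : set H :=
  closure [set x | exists m (c : 'I_m -> R[i]) (s : 'I_m -> H),
    (forall i, S (s i)) /\ x = \sum_(i < m) c i *: s i].

Definition orth (S : set H) : set H :=
  [set y | forall x, S x -> inner x y = 0].

Definition proj (N : set H) (x : H) : H :=
  xget 0 [set y | N y /\ orth N (x - y)].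

Definition inv_on (N : set H) (A : H -> H) (x : H) : H :=
  xget 0 [set y | N y /\ A y = x].

Definition wot_closure (S : set (H -> H)) : set (H -> H) :=
  [set A | bounded_linear A /\
    forall m (x y : 'I_m -> H) (e : R), 0 < e ->
      exists2 B, S B & forall j, nrm (inner (A (x j) - B (x j)) (y j)) < e].

Definition infinite_dimensional := forall m (v : 'I_m -> H),
  exists x, forall c : 'I_m -> R[i], x <> \sum_(i < m) c i *: v i.

End Endomorphisms.

Definition unitarily_equivalent (R : realType) (H H' : hilbertType R) n
    (T : 'I_n -> H -> H) (T' : 'I_n -> H' -> H') :=
  exists2 U : H -> H', unitary_on setT setT U &
    forall i, U \o T i = T' i \o U.

(* A power series in noncommuting indeterminates, as its family of coefficients. *)
Notation fps R n := (seq 'I_n -> R[i]).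

Section FormalSeries.
Variables (R : realType) (n : nat).
Implicit Types (a b c : fps R n) (f : 'I_n -> fps R n).

Definition fone : fps R n := fun w => (w == [::])%:R.
Definition fZ (i : 'I_n) : fps R n := fun w => (w == [:: i])%:R.
Definition fmul a b : fps R n :=
  fun w => \sum_(k < (size w).+1) a (take k w) * b (drop k w).
Definition fword f (al : seq 'I_n) : fps R n :=
  foldr (fun i s => fmul (f i) s) fone al.

Definition deg_lt d a := forall w, (d <= size w)%N -> a w = 0.

(* The part of [sum_al c_al f_al] over the words [al] of length less than [d]. *)
Definition fcomp_lt d c f : fps R n := fun w =>
  \sum_(k < d) \sum_(al : k.-tuple 'I_n) c al * fword f al w.

(* [sum_al c_al f_al], assuming that the [f_i] have no constant term: then [f_al]
   contributes to the coefficient of [w] only if [size al <= size w]. *)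
Definition fcomp c f : fps R n := fun w => fcomp_lt (size w).+1 c f w.

(* The inverse of the radius of convergence. *)
Definition inv_radius a : \bar R :=
  limn_esup (fun k => ((\sum_(al : k.-tuple 'I_n) nrm (a al) ^+ 2)
                         `^ ((2 * k)%:R^-1))%:E).

End FormalSeries.

Section Evaluation.
Variables (R : realType) (n : nat) (H : hilbertType R).
Implicit Types (a : fps R n) (f g : 'I_n -> fps R n) (Y Z : 'I_n -> H -> H).

Definition word_op Y (al : seq 'I_n) : H -> H :=
  foldr (fun i A => Y i \o A) idfun al.

Definition psum a Y (m : nat) : H -> H :=
  \sum_(k < m) \sum_(al : k.-tuple 'I_n) a al *: word_op Y al.

(* [eval_norm a Y L], [eval_sot a Y L] and [eval_rad a Y L] say that the series
   with coefficients [a] can be evaluated at [Y] in the norm, strong, and radial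
   sense respectively, with value [L]. *)
Definition eval_norm a Y (L : H -> H) := norm_cvg \oo (psum a Y) L.

Definition eval_sot a Y (L : H -> H) := sot_cvg \oo (psum a Y) L.

Definition eval_rad a Y (L : H -> H) :=
  exists (delta : R) (P : R -> H -> H), [/\ 0 < delta < 1,
    forall r, delta < r < 1 -> eval_norm a (fun i => r%:C *: Y i) (P r) &
    sot_cvg 1^'- P L].

(* [Y] belongs to [C_f^SOT] or to [C_f^rad], with [f(Y) = Z]. *)
Definition eval_spec f Y Z :=
  (forall i, eval_sot (f i) Y (Z i)) \/ (forall i, eval_rad (f i) Y (Z i)).

Definition eval f Y : 'I_n -> H -> H := xget (cst (cst 0)) [set Z | eval_spec f Y Z].

(* The direct sum of [n] copies of [H] is [l2 'I_n H]. *)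
Definition row Z (u : l2 'I_n H) : H := \sum_i Z i (u i).

Definition row_sqr Z : H -> H := \sum_i (Z i \o adj (Z i)).

Definition open_ball (r : R) Y :=
  (forall i, bounded_linear (Y i)) /\ Num.sqrt (opnorm (row_sqr Y)) < r.

(* The domain B_f(H), where [g] is the inverse of [f]. *)
Definition domain f g : set ('I_n -> H -> H) :=
  [set X | [/\ forall i, bounded_linear (X i),
    exists Z, eval_spec f X Z,
    opnorm (row (eval f X)) <= 1 &
    eval_spec g (eval f X) X]].

Definition Phi f Y (A : H -> H) : H -> H :=
  \sum_i (eval f Y i \o A \o adj (eval f Y i)).

Definition cnc f Y := forall h : H,
  (forall m, (0 < m)%N -> inner (iter m (Phi f Y) idfun h) h = `|h| ^+ 2) ->
  h = 0.

Definition polys Y : set (H -> H) := [set A | exists a m, A = psum a Y m].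

Definition defect f Y : H -> H := sqrt_op (idfun - row_sqr (eval f Y)).

Definition defect_adj f Y : l2 'I_n H -> l2 'I_n H :=
  sqrt_op (idfun - (adj (row (eval f Y)) \o row (eval f Y))).

Definition defect_space f Y : set H := cspan (range (defect f Y)).

Definition defect_adj_space f Y : set (l2 'I_n H) :=
  cspan (range (defect_adj f Y)).

End Evaluation.

Section Model.
Variables (R : realType) (n : nat).

(* Coefficient sequences: the square-summable family [c] stands for the element
   [sum_al c_al f_al] of H^2(f), and also for [sum_al c_al e_al] in Fock space. *)
Notation H2 := (l2 (seq 'I_n) R[i]).

Implicit Types (f : 'I_n -> fps R n) (g : 'I_n -> H2) (M : 'I_n -> H2 -> H2).

Definition basis (al : seq 'I_n) : H2 := single al (1 : R[i]).

Definition basis_op (s : seq 'I_n -> seq 'I_n) : H2 -> H2 :=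
  xget (cst 0)
    [set L | bounded_linear L /\ forall al, L (basis al) = basis (s al)].

Definition left_creation (i : 'I_n) : H2 -> H2 := basis_op (cons i).
Definition right_creation (i : 'I_n) : H2 -> H2 := basis_op (rcons^~ i).

(* In the three cases below, [g i] is the family of coefficients of [Z_i] in the
   basis [f_al], and [M i] is the multiplication by [Z_i]. *)

(* Here [q o f = id] says that the coefficients of [Z_i] are those of [q_i]. The
   elements of H^2(f) need not be power series, so that [M i] is determined as the
   bounded operator which acts on each polynomial [f_al] as multiplication by
   [Z_i]. *)
Definition model_A f g M := exists d,
  [/\ forall i, deg_lt d (f i), forall i, deg_lt d (g i),
    forall i, fcomp_lt d (f i) (fun j => g j) = fZ R i,
    forall i, fcomp_lt d (g i) f = fZ R i &
    forall i, bounded_linear (M i) /\ forall al, exists2 d',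
      deg_lt d' (M i (basis al)) &
      fcomp_lt d' (M i (basis al)) f = fmul (fZ R i) (fword f al)].

(* [A] is the multiplication by the series [p] on H^2(f), here and in [mult_F]
   (where the elements of H^2(f) are functions on the ball of radius [gam]). *)
Definition mult_S f (p : fps R n) (A : H2 -> H2) :=
  bounded_linear A /\ forall c : H2, fcomp (A c) f = fmul p (fcomp c f).

Definition model_S f g M :=
  [/\ forall i, f i [::] = 0,
    forall i, (inv_radius (f i) < +oo)%E,
    \det (\matrix_(i, j) f i [:: j]) != 0,
    forall i, fcomp (g i) f = fZ R i &
    (forall i, mult_S f (fZ R i) (M i)) /\
    exists2 L, forall j, mult_S f (f j) (L j) & eval_spec f M L].

(* [b] composed with [f] takes the value [V] at [X]. *)
Definition comp_at (H : hilbertType R) (b : fps R n) f (X : 'I_n -> H -> H) V :=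
  exists2 Z, forall i, eval_norm (f i) X (Z i) & eval_norm b Z V.

Definition mult_F (H : hilbertType R) (gam : R) f (p : fps R n) (A : H2 -> H2) :=
  bounded_linear A /\ forall (c : H2) (X : 'I_n -> H -> H), open_ball gam X ->
    exists P V, [/\ eval_norm p X P, comp_at c f X V & comp_at (A c) f X (P \o V)].

Definition model_F f g M := exists (H : hilbertType R) (gam : R),
  [/\ infinite_dimensional H /\ 0 < gam,
    (forall i, (inv_radius (f i) <= (gam^-1)%:E)%E) /\
    (forall X : 'I_n -> H -> H, open_ball gam X ->
       exists2 Z, forall i, eval_norm (f i) X (Z i) & open_ball 1 Z),
    forall b : fps R n, (inv_radius b <= 1)%E ->
      (forall X : 'I_n -> H -> H, open_ball gam X -> comp_at b f X (cst 0)) ->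
      b = cst 0,
    forall i (X : 'I_n -> H -> H), open_ball gam X -> comp_at (g i) f X (X i) &
    (forall i, mult_F H gam f (fZ R i) (M i)) /\
    exists2 L, forall j, mult_F H gam f (f j) (L j) & eval_spec f M L].

(* [f] has the model property, its inverse is [g] and the universal model is
   [M]. *)
Definition model f g M := [\/ model_A f g M, model_S f g M | model_F f g M].

Definition Finfty : set (H2 -> H2) := wot_closure (polys left_creation).

Definition Hinfty M : set (H2 -> H2) := wot_closure (polys M).

Definition wot_closed_ideal M (J : set (H2 -> H2)) :=
  [/\ J `<=` Hinfty M, J (cst 0),
    forall A B, J A -> J B -> J (A + B),
    forall A B, J A -> Hinfty M B -> J (A \o B) /\ J (B \o A) &
    wot_closure J `<=` J].

(* The elements of [J] are the [psi = phi(f(M_Z))] with [phi] in the noncommutative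
   analytic Toeplitz algebra; [phi (basis [::])] is the family of Fourier
   coefficients of [phi], and the last condition says that [psi(T) = 0]. *)
Definition variety_cnc (H : hilbertType R) f g M (J : set (H2 -> H2)) :
    set ('I_n -> H -> H) :=
  [set T | [/\ domain f (fun i => g i) T, cnc f T &
    forall phi psi, Finfty phi -> J psi ->
      eval_rad (phi (basis [::])) (eval f M) psi ->
      eval_rad (phi (basis [::])) (eval f T) (cst 0)]].

Definition Mspace (J : set (H2 -> H2)) : set H2 :=
  cspan [set x | exists2 A, J A & range A x].

Definition Nspace (J : set (H2 -> H2)) : set H2 := orth (Mspace J).

End Model.

Section CharacteristicFunction.
Variables (R : realType) (n : nat).
Notation H2 := (l2 (seq 'I_n) R[i]).

(* The closed subspace [N (x) D] of [H2 (x) K]. *)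
Definition tensor_space (K : hilbertType R) (N : set H2) (D : set K) :
    set (l2 (seq 'I_n) K) :=
  cspan [set tens a d | a in N & d in D].

Definition tensor_op (K K' : hilbertType R) (B : H2 -> H2) (A : K -> K') :
    l2 (seq 'I_n) K -> l2 (seq 'I_n) K' :=
  xget (cst 0) [set V | bounded_linear V /\
    forall a k, V (tens a k) = tens (B a) (A k)].

Variables (H : hilbertType R) (f : 'I_n -> fps R n) (T : 'I_n -> H -> H).
Variable N : set H2.

Definition Wop (i : 'I_n) : H2 -> H2 := proj N \o right_creation i.

(* The row (rW_1 (x) I, ..., rW_n (x) I) : N (x) H^(n) -> N (x) H. *)
Definition Wrow (r : R) : l2 (seq 'I_n) (l2 'I_n H) -> l2 (seq 'I_n) H :=
  \sum_i tensor_op (r%:C *: Wop i) (fun u : l2 'I_n H => u i).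

Definition Wresolvent (r : R) : l2 (seq 'I_n) H -> l2 (seq 'I_n) H :=
  inv_on (tensor_space N setT)
    (idfun - \sum_i tensor_op (r%:C *: Wop i) (adj (eval f T i))).

Definition Theta_r (r : R) (x : l2 (seq 'I_n) (l2 'I_n H)) : l2 (seq 'I_n) H :=
  - tensor_op idfun (row (eval f T)) x +
  tensor_op idfun (defect f T)
    (Wresolvent r (Wrow r (tensor_op idfun (defect_adj f T) x))).

(* The constrained characteristic function, meaningful on
   [tensor_space N (defect_adj_space f T)] only. *)
Definition Theta (x : l2 (seq 'I_n) (l2 'I_n H)) : l2 (seq 'I_n) H :=
  lim (Theta_r r x @[r --> 1^'-]).

End CharacteristicFunction.

(* Here [A] maps [tensor_space N D1] to [tensor_space N D2], and likewise [A']. *)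
Definition coincide (R : realType) n (N : set (l2 (seq 'I_n) R[i]))
    (K1 K2 K1' K2' : hilbertType R)
    (D1 : set K1) (D2 : set K2) (D1' : set K1') (D2' : set K2')
    (A : l2 (seq 'I_n) K1 -> l2 (seq 'I_n) K2)
    (A' : l2 (seq 'I_n) K1' -> l2 (seq 'I_n) K2') :=
  exists (tau1 : K1 -> K1') (tau2 : K2 -> K2'),
    [/\ unitary_on D1 D1' tau1, unitary_on D2 D2' tau2 &
      forall x, tensor_space N D1 x ->
        A' (tensor_op idfun tau1 x) = tensor_op idfun tau2 (A x)].

(* Main.v *)
Require Import Defs.
From HB Require Import structures.
From mathcomp Require Import all_boot all_order all_algebra.
From mathcomp Require Import finmap complex.
From mathcomp Require Import all_classical all_reals.
From mathcomp Require Import ereal topology normedtype.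
From mathcomp Require Import sequences exp.
From mathcomp Require Import ring lra.
From mathcomp Require summability.
Import Defs.

Set Implicit Arguments.
Unset Strict Implicit.
Unset Printing Implicit Defensive.

Import Order.TTheory GRing.Theory Num.Theory.
Import numFieldNormedType.Exports.

Local Open Scope classical_set_scope.
Local Open Scope complex_scope.
Local Open Scope ring_scope.

(** Let [A = f(T)]: a row contraction [X], with adjoint [X'] and defect
    operators [Ds] on [H^(n)] and [Dl] on [H]. Since [T = g(A)] and the value
    of a series at a tuple is unique (by Abel's theorem it does not depend on
    the sense in which the series is summed), a unitary which intertwines [A]
    with [A'] also intertwines [T] with [T'].

    The Julia operator [(X', Ds; Dl, -X)] is unitary. It defines a linear
    system whose states, inputs and outputs are indexed by words. The output for
    the initial state [h] and zero input is [K h], with coordinates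
    [Dl ((A_w)^* h)]: [K] is the Poisson kernel of [A]. The output for the
    zero state and the input [x] is [Th x]. Because the system can also be run
    backwards, [K K^* + Th Th^* = I] ([Xi_adj_norm]). The compression of
    [Th] to [N (x) H], where [N] is the orthogonal complement of [J H^2], is
    the constrained characteristic function ([ThetaE]), and the identity
    survives the compression: [Th^*] maps [N (x) D] to tensors with [N] again
    ([adj_Th_space]), and [K] takes its values in [N (x) D] ([Kop_in]), where
    [D] is the defect space of [T].

    The last fact expresses that [J] annihilates [T]. It rests on what the three
    model properties have in common ([model_universal]): [f(M_Z)] is the tuple
    of left creations, and [M_Z] commutes with the right creations. Hence each
    [psi] in [J] commutes with the right creations, so that it is the radial
    limit of its Fourier series at the left creations ([commuting_eval_rad]);
    and the inner product of [psi e_w (x) k] with [K h] is that of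
    [psi(A) (A_w (Dl k))] with [h], where [psi(A)] is [0]. On the other hand,
    [K] is injective because [T] is completely non-coisometric ([Kop_inj]).

    If the characteristic functions coincide by means of [tau1] and [tau2], then
    [Th^* v] and [Th'^* (tau2 v)] have the same norm for [v] in [N (x) D],
    hence so do [K^* v] and [K'^* (tau2 v)]. As [K] and [K'] are injective,
    these vectors are dense, and [K^* v |-> K'^* (tau2 v)] extends to a
    unitary [U] with [K' U = (I (x) tau2) K]. Comparison of the
    coordinates at the words [i w] and [w] gives [U (A_i)^* = (A'_i)^* U].
    Conversely, a unitary which intertwines [T] with [T'] transports every
    ingredient of the characteristic function, as evaluations and positive
    square roots are unique. *)

(** * Bounded operators on Hilbert spaces *)

Section InnerMore.
Variables (R : realType) (H : hilbertType R).
Implicit Types x y z : H.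

Lemma inner0l x : inner 0 x = 0.
Proof. by rewrite -(scale0r x) innerZl mul0r. Qed.

Lemma inner0r x : inner x 0 = 0.
Proof. by rewrite innerC inner0l conjc0. Qed.

Lemma innerNl x y : inner (- x) y = - inner x y.
Proof. by rewrite -scaleN1r innerZl mulN1r. Qed.

Lemma innerBl x y z : inner (x - y) z = inner x z - inner y z.
Proof. by rewrite innerDl innerNl. Qed.

Lemma innerBr x y z : inner x (y - z) = inner x y - inner x z.
Proof. by rewrite innerDr innerNr. Qed.

Lemma inner_suml I (r : seq I) (P : pred I) (F : I -> H) y :
  inner (\sum_(i <- r | P i) F i) y = \sum_(i <- r | P i) inner (F i) y.
Proof.
by apply: (big_morph (fun x => inner x y)) => [x z|]; rewrite (innerDl, inner0l).
Qed.

Lemma inner_sumr I (r : seq I) (P : pred I) (F : I -> H) y :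
  inner y (\sum_(i <- r | P i) F i) = \sum_(i <- r | P i) inner y (F i).
Proof.
by apply: (big_morph (inner y)) => [x z|]; rewrite (innerDr, inner0r).
Qed.

Lemma nrm_eq0 (V : normedModType R[i]) (x : V) : nrm x = 0 -> x = 0.
Proof. by move=> x0; apply/eqP; rewrite -normr_eq0 nrmE x0. Qed.

Lemma Re_inner x : complex.Re (inner x x) = nrm x ^+ 2.
Proof. by rewrite innerE. Qed.

Lemma inner_self_eq0 x : inner x x = 0 -> x = 0.
Proof.
by rewrite innerE => /complexI/eqP; rewrite sqrf_eq0 => /eqP/nrm_eq0.
Qed.

Lemma inner_inj x y : (forall z, inner z x = inner z y) -> x = y.
Proof.
move=> xy; apply/eqP; rewrite -subr_eq0; apply/eqP/inner_self_eq0.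
by rewrite innerBr xy subrr.
Qed.

Lemma Re_innerC x y : complex.Re (inner x y) = complex.Re (inner y x).
Proof. by rewrite innerC; case: (inner y x). Qed.

Lemma nrmB_sqr x y :
  nrm (x - y) ^+ 2 = nrm x ^+ 2 + nrm y ^+ 2 - complex.Re (inner x y) *+ 2.
Proof. by rewrite nrmD_sqr nrmN innerNr; case: (inner x y) => a b /=; ring. Qed.

Lemma parallelogram x y :
  nrm (x + y) ^+ 2 + nrm (x - y) ^+ 2 = (nrm x ^+ 2 + nrm y ^+ 2) *+ 2.
Proof. by rewrite nrmD_sqr nrmB_sqr; ring. Qed.

Lemma nrm_real (V : normedModType R[i]) (r : R) (x : V) :
  nrm (r%:C *: x) = `|r| * nrm x.
Proof. by rewrite nrmZ /nrm normc_def /= expr0n /= addr0 sqrtr_sqr. Qed.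

Lemma cauchy_schwarz x y : nrm (inner x y) <= nrm x * nrm y.
Proof.
have [y0|y0] := eqVneq (nrm y) 0.
  by rewrite (nrm_eq0 y0) inner0r !nrm0 mulr0.
have yp : 0 < nrm y by rewrite lt_neqAle eq_sym y0 nrm_ge0.
set c := inner x y.
have := sqr_ge0 (nrm ((nrm y ^+ 2)%:C *: x - c *: y)).
rewrite nrmB_sqr nrm_real nrmZ innerZl innerZr -/c.
rewrite (_ : complex.Re _ = nrm y ^+ 2 * nrm c ^+ 2); last first.
  by rewrite nrm_sqrE; case: (c) => a b /=; ring.
rewrite ger0_norm ?sqr_ge0 // => h.
rewrite -(@ler_pXn2r _ 2) ?nnegrE ?mulr_ge0 ?nrm_ge0 // exprMn.
rewrite -(ler_pM2l (exprn_gt0 2 yp)) -subr_ge0.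
by move: h; congr (0 <= _); ring.
Qed.

Lemma Re_cauchy_schwarz x y : complex.Re (inner x y) <= nrm x * nrm y.
Proof.
by apply: le_trans (cauchy_schwarz x y); apply: le_trans (Re_nrm _); apply: ler_norm.
Qed.

End InnerMore.

Section BoundedLinear.
Variable R : realType.
Implicit Types H K L : hilbertType R.

Lemma blD H K (A : H -> K) : bounded_linear A -> {morph A : x y / x + y}.
Proof. by move=> [lA _] x y; have := lA 1 x y; rewrite !scale1r. Qed.

Lemma bl0 H K (A : H -> K) : bounded_linear A -> A 0 = 0.
Proof.
move=> bA; apply: (@addrI _ (A 0)); by rewrite -(blD bA) !addr0.
Qed.

Lemma blZ H K (A : H -> K) : bounded_linear A -> forall a x, A (a *: x) = a *: A x.
Proof. by move=> bA a x; have := bA.1 a x 0; rewrite (bl0 bA) !addr0. Qed.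

Lemma blN H K (A : H -> K) : bounded_linear A -> {morph A : x / - x}.
Proof. by move=> bA x; rewrite -scaleN1r (blZ bA) scaleN1r. Qed.

Lemma blB H K (A : H -> K) : bounded_linear A -> {morph A : x y / x - y}.
Proof. by move=> bA x y; rewrite (blD bA) (blN bA). Qed.

Lemma bl_sum H K (A : H -> K) (bA : bounded_linear A) I (r : seq I) (P : pred I)
  (F : I -> H) : A (\sum_(i <- r | P i) F i) = \sum_(i <- r | P i) A (F i).
Proof. by apply: (big_morph A) => [x y|]; [exact: blD | exact: bl0]. Qed.

Lemma bl_bound H K (A : H -> K) : bounded_linear A ->
  exists2 M : R, 0 < M & forall x, nrm (A x) <= M * nrm x.
Proof.
move=> [_ [M AM]]; exists (Num.max M 1) => [|x]; first by rewrite lt_max ltr01 orbT.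
by apply: le_trans (AM x) _; rewrite ler_wpM2r ?nrm_ge0 // le_max lexx.
Qed.

Lemma bl_intro H K (A : H -> K) (M : R) : {morph A : x y / x + y} ->
  (forall a x, A (a *: x) = a *: A x) -> (forall x, nrm (A x) <= M * nrm x) ->
  bounded_linear A.
Proof. by move=> AD AZ AM; split; [move=> a x y; rewrite AD AZ | exists M]. Qed.

Lemma bl_comp H K L (A : K -> L) (B : H -> K) :
  bounded_linear A -> bounded_linear B -> bounded_linear (A \o B).
Proof.
move=> bA bB; have [M M0 AM] := bl_bound bA; have [N N0 BN] := bl_bound bB.
apply: (@bl_intro _ _ _ (M * N)) => [x y|a x|x] /=.
- by rewrite (blD bB) (blD bA).
- by rewrite (blZ bB) (blZ bA).
- by apply: le_trans (AM _) _; rewrite -mulrA ler_wpM2l // ltW.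
Qed.

Lemma bl_id H : bounded_linear (idfun : H -> H).
Proof. by apply: (@bl_intro _ _ _ 1) => // x; rewrite mul1r. Qed.

Lemma bl_cst0 H K : bounded_linear (cst 0 : H -> K).
Proof.
apply: (@bl_intro _ _ _ 0) => [x y|a x|x] /=; rewrite ?addr0 ?scaler0 //.
by rewrite nrm0 mul0r.
Qed.

Lemma bl_zero H K : bounded_linear (0 : H -> K).
Proof. exact: bl_cst0. Qed.

Lemma bl_addf H K (A B : H -> K) :
  bounded_linear A -> bounded_linear B -> bounded_linear (A + B).
Proof.
move=> bA bB; have [M M0 AM] := bl_bound bA; have [N N0 BN] := bl_bound bB.
apply: (@bl_intro _ _ _ (M + N)) => [x y|a x|x]; rewrite !fctE.
- by rewrite (blD bB) (blD bA) addrACA.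
- by rewrite (blZ bB) (blZ bA) scalerDr.
- by apply: le_trans (ler_nrmD _ _) _; rewrite mulrDl lerD.
Qed.

Lemma bl_scalef H K (a : R[i]) (A : H -> K) :
  bounded_linear A -> bounded_linear (a *: A).
Proof.
move=> bA; have [M M0 AM] := bl_bound bA.
apply: (@bl_intro _ _ _ (nrm a * M)) => [x y|b x|x]; rewrite !fctE.
- by rewrite (blD bA) scalerDr.
- by rewrite (blZ bA) !scalerA mulrC.
- by rewrite nrmZ -mulrA ler_wpM2l ?nrm_ge0.
Qed.

Lemma bl_oppf H K (A : H -> K) : bounded_linear A -> bounded_linear (- A).
Proof. by move=> bA; rewrite -scaleN1r; apply: bl_scalef. Qed.

Lemma bl_subf H K (A B : H -> K) :
  bounded_linear A -> bounded_linear B -> bounded_linear (A - B).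
Proof. by move=> bA bB; apply: bl_addf => //; apply: bl_oppf. Qed.

Lemma bl_sumf H K I (r : seq I) (P : pred I) (F : I -> H -> K) :
  (forall i, bounded_linear (F i)) -> bounded_linear (\sum_(i <- r | P i) F i).
Proof.
move=> bF; apply: (big_ind (@bounded_linear R H K)) => //; first exact: bl_zero.
by move=> A B; apply: bl_addf.
Qed.

Lemma bl_inner H (y : H) : bounded_linear (fun x => inner x y : R[i]).
Proof.
apply: (@bl_intro _ _ _ (nrm y)) => [x z|a x|x]; rewrite ?innerDl ?innerZl //.
by rewrite mulrC cauchy_schwarz.
Qed.

Lemma bl_cvg H K (A : H -> K) T (F : set_system T) {FF : Filter F} (f : T -> H) x :
  bounded_linear A -> f @ F --> x -> (A \o f) @ F --> A x.
Proof.
move=> bA /cvg_nrmP fx; have [M M0 AM] := bl_bound bA.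
apply/cvg_nrmP => e e0; apply: filterS (fx (e / M) (divr_gt0 e0 M0)) => t ft.
by rewrite /= -(blB bA) (le_trans (AM _)) // mulrC -ler_pdivlMr.
Qed.

Lemma nrm_cvg_real H T (F : set_system T) {FF : Filter F} (f : T -> H) x :
  f @ F --> x -> (fun t => nrm (f t)) @ F --> nrm x.
Proof.
move=> /cvg_nrmP fx; apply/cvgrPdist_le => e e0; apply: filterS (fx _ e0) => t.
apply: le_trans; have := ler_nrmD (x - f t) (f t); have := ler_nrmD (f t - x) x.
by rewrite !subrK (nrm_distC (f t)) ler_norml => h1 h2; apply/andP; split; lra.
Qed.

End BoundedLinear.

(** * Closed subspaces, projections and adjoints *)

Section ClosedSubspaces.
Variable R : realType.
Implicit Types H K : hilbertType R.

Record closed_subspace H (D : set H) : Prop := ClosedSubspace {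
  csub0 : D 0;
  csubD : forall x y, D x -> D y -> D (x + y);
  csubZ : forall a x, D x -> D (a *: x);
  csub_cl : forall x, (forall e : R, 0 < e -> exists2 y, D y & nrm (x - y) < e) -> D x
}.

Lemma csubB H (D : set H) : closed_subspace D -> forall x y, D x -> D y -> D (x - y).
Proof. by move=> cD x y Dx Dy; rewrite -scaleN1r; apply: (csubD cD) => //; apply: (csubZ cD). Qed.

Lemma csub_sum H (D : set H) : closed_subspace D -> forall I (r : seq I) (P : pred I) (F : I -> H),
  (forall i, D (F i)) -> D (\sum_(i <- r | P i) F i).
Proof.
move=> cD I r P F DF; apply: (big_ind D) => //; first exact: (csub0 cD).
exact: (csubD cD).
Qed.

Lemma csub_cvg H (D : set H) (cD : closed_subspace D) T (F : set_system T) {FF : ProperFilter F}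
  (f : T -> H) x : (\forall t \near F, D (f t)) -> f @ F --> x -> D x.
Proof.
move=> Df /cvg_nrmP fx; apply: (csub_cl cD) => // e e0.
have e2 : 0 < e / 2 by rewrite divr_gt0.
have [t [Dt ft]] := filter_ex (filterI Df (fx _ e2)); exists (f t) => //.
by apply: le_lt_trans ft _; lra.
Qed.

Lemma closureP H (S : set H) x :
  closure S x <-> forall e : R, 0 < e -> exists2 y, S y & nrm (x - y) < e.
Proof.
split=> [Sx e e0|Sx B].
  have /Sx[y [Sy]] : nbhs x (ball x e%:C) by apply: nbhsx_ballx; rewrite ltcR.
  by rewrite -ball_normE /ball_ /= nrmE ltcR; exists y.
move=> /nbhs_ballP[e /= e0 eB]; have eE : e = (complex.Re e)%:C.
  by rewrite RRe_real // gtr0_real.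
have [|y Sy xy] := Sx (complex.Re e); first by rewrite -ltcR -eE.
exists y; split=> //; apply: eB; rewrite -ball_normE /ball_ /= nrmE eE.
by rewrite ltcR.
Qed.

Lemma csub_setT H : closed_subspace [set: H].
Proof. by []. Qed.

Lemma csub_orth H (S : set H) : closed_subspace (orth S).
Proof.
split=> [x _|x y Sx Sy z Sz|a x Sx z Sz|x Sx z Sz]; rewrite ?inner0r //.
- by rewrite innerDr Sx // Sy // addr0.
- by rewrite innerZr Sx // mulr0.
apply: nrm_eq0; apply/le_anti; rewrite nrm_ge0 andbT.
apply/ler_addgt0Pr => e e0; rewrite add0r.
have d0 : 0 < e / (nrm z + 1) by rewrite divr_gt0 // ltr_wpDl ?nrm_ge0.
have [y Sy xy] := Sx _ d0.
rewrite -(subrK y x) innerDr (Sy z Sz) addr0; apply: le_trans (cauchy_schwarz _ _) _.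
have := ltW xy; rewrite ler_pdivlMr ?ltr_wpDl ?nrm_ge0 // => h.
apply: le_trans h; rewrite mulrC ler_wpM2l ?nrm_ge0 // lerDl ler01.
by [].
Qed.

Lemma csub_cspan H (S : set H) : closed_subspace (cspan S).
Proof.
(* [V] is the algebraic span, and [cspan S] is its closure. *)
pose V := [set x : H | exists m (c : 'I_m -> R[i]) (s : 'I_m -> H),
    (forall i, S (s i)) /\ x = \sum_(i < m) c i *: s i].
have VD x y : V x -> V y -> V (x + y).
  move=> [m [c [s [Ss ->]]]] [m' [c' [s' [Ss' ->]]]]; exists (m + m')%N.
  exists (fun i : 'I_(m + m') => match fintype.split i with inl j => c j | inr j => c' j end).
  exists (fun i : 'I_(m + m') => match fintype.split i with inl j => s j | inr j => s' j end).
  split=> [i|]; first by case: fintype.split.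
  rewrite big_split_ord /=; congr (_ + _); apply: eq_bigr => i _.
    by rewrite (unsplitK (inl i : 'I_m + 'I_m')).
  by rewrite (unsplitK (inr i : 'I_m + 'I_m')).
have VZ a x : V x -> V (a *: x).
  move=> [m [c [s [Ss ->]]]]; exists m, (fun i => a * c i), s; split => //.
  by rewrite scaler_sumr; apply: eq_bigr => i _; rewrite scalerA.
split=> [|x y|a x|x].
- apply/closureP => e e0; exists 0; last by rewrite subrr nrm0.
  by exists 0%N, (fun=> 0), (fun=> 0); split; [case|rewrite big_ord0].
- move=> /closureP Vx /closureP Vy; apply/closureP => e e0.
  have e2 : 0 < e / 2 by rewrite divr_gt0.
  have [x' Vx' xx'] := Vx _ e2; have [y' Vy' yy'] := Vy _ e2.
  exists (x' + y'); first exact: VD.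
  rewrite opprD addrACA (le_lt_trans (ler_nrmD _ _)) //; lra.
- move=> /closureP Vx; apply/closureP => e e0.
  have a1 : 0 < nrm a + 1 by rewrite ltr_wpDl ?nrm_ge0.
  have [x' Vx' xx'] := Vx _ (divr_gt0 e0 a1).
  exists (a *: x'); first exact: VZ.
  rewrite -scalerBr nrmZ; move: xx'; rewrite ltr_pdivlMr //.
  by have := nrm_ge0 (x - x'); have := nrm_ge0 a; nra.
- move=> Vx; apply/closureP => e e0; have e2 : 0 < e / 2 by rewrite divr_gt0.
  have [y /closureP Vy xy] := Vx _ e2; have [z Vz yz] := Vy _ e2.
  exists z => //; rewrite -(subrKA y) (le_lt_trans (ler_nrmD _ _)) //; lra.
Qed.

Lemma sub_cspan H (S : set H) : S `<=` cspan S.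
Proof.
move=> x Sx; apply/closureP => e e0; exists x; last by rewrite subrr nrm0.
exists 1%N, (fun=> 1), (fun=> x); split => //.
by rewrite big_ord_recl big_ord0 scale1r addr0.
Qed.

Lemma cspan_min H (S D : set H) : closed_subspace D -> S `<=` D -> cspan S `<=` D.
Proof.
move=> cD SD x /closureP Sx; apply: (csub_cl cD) => // e /Sx[y [m [c [s [Ss ->]]]] xy].
eexists; last exact: xy.
by apply: (csub_sum cD) => i; apply: (csubZ cD); apply: SD.
Qed.

Lemma csub_preim H K (A : H -> K) (D : set K) :
  bounded_linear A -> closed_subspace D -> closed_subspace (A @^-1` D).
Proof.
move=> bA cD; split=> [|x y|a x|x] /=.
- by rewrite (bl0 bA); apply: (csub0 cD).
- by rewrite (blD bA); apply: (csubD cD).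
- by rewrite (blZ bA); apply: (csubZ cD).
move=> Ax; apply: (csub_cl cD) => // e e0; have [M M0 AM] := bl_bound bA.
have [y Dy xy] := Ax _ (divr_gt0 e0 M0); exists (A y) => //.
rewrite -(blB bA) (le_lt_trans (AM _)) //.
by rewrite mulrC -ltr_pdivlMr.
Qed.

Lemma csub_eq H K (A B : H -> K) : bounded_linear A -> bounded_linear B ->
  closed_subspace [set x | A x = B x].
Proof.
move=> bA bB; have bAB := bl_subf bA bB.
rewrite (_ : mkset _ = (A - B) @^-1` [set 0]); last first.
  rewrite predeqE => x; rewrite /= !fctE; split => [->|/eqP]; first by rewrite subrr.
  by rewrite subr_eq0 => /eqP.
apply: csub_preim => //; split => [|x y -> ->|a x ->|x xe] //=.
- by rewrite addr0.
- by rewrite scaler0.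
apply: nrm_eq0; apply/le_anti; rewrite nrm_ge0 andbT; apply/ler_addgt0Pr => e e0.
by rewrite add0r; have [y -> /ltW] := xe e e0; rewrite subr0.
Qed.

Lemma eq_on_cspan H K (A B : H -> K) (S : set H) :
  bounded_linear A -> bounded_linear B -> (forall x, S x -> A x = B x) ->
  forall x, cspan S x -> A x = B x.
Proof. by move=> bA bB AB x Sx; exact: (cspan_min (csub_eq bA bB) AB Sx). Qed.

Lemma map_cspan H K (A : H -> K) (S : set H) (D : set K) :
  bounded_linear A -> closed_subspace D -> (forall x, S x -> D (A x)) ->
  forall x, cspan S x -> D (A x).
Proof.
by move=> bA cD SD x Sx; exact: (cspan_min (csub_preim bA cD) SD Sx).
Qed.

Lemma orth_cspan H (S : set H) y : orth S y -> orth (cspan S) y.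
Proof.
by move=> Sy x Sx; apply: (eq_on_cspan (bl_inner y) (@bl_cst0 _ _ _) Sy Sx).
Qed.

End ClosedSubspaces.

Section Complete.
Variable R : realType.

(** The increments of [u] are dominated by those of a bounded, hence convergent,
    real sequence. The rate of convergence is part of the conclusion: it makes
    pointwise limits of operators bounded, or uniform. *)
Lemma dominated_cvg (V : completeNormedModType R[i]) (u : nat -> V) (s : nat -> R) (B : R) :
  (forall k, nrm (u k.+1 - u k) <= s k.+1 - s k) -> (forall k, s k <= B) ->
  exists2 l, u @ \oo --> l & forall k, nrm (l - u k) <= B - s k.
Proof.
move=> us sB.
have us' k j : nrm (u (k + j)%N - u k) <= s (k + j)%N - s k.
  elim: j => [|j IH]; first by rewrite addn0 !subrr nrm0.
  rewrite addnS -(subrKA (u (k + j)%N)) (le_trans (ler_nrmD _ _)) //.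
  by have := us (k + j)%N; lra.
have smono : nondecreasing_seq s.
  by apply/nondecreasing_seqP => k; have := us k; have := nrm_ge0 (u k.+1 - u k); lra.
have /cvg_ex[S sS] : cvgn s.
  by apply: nondecreasing_is_cvgn => //; exists B => _ [k _ <-].
have sleS k : s k <= S.
  rewrite -(cvg_lim _ sS) //; apply: nondecreasing_cvgn_le => //.
  by apply/cvg_ex; exists S.
have SB : S <= B.
  rewrite -(cvg_lim _ sS) //; apply: limr_le; first by apply/cvg_ex; exists S.
  by apply: nearW.
have usS k j : (k <= j)%N -> nrm (u j - u k) <= S - s k.
  by move=> kj; have := us' k (j - k)%N; rewrite subnKC //; have := sleS j; lra.
have /cvg_ex[l ul] : cvg (u @ \oo).
  apply: cauchy_cvg; apply/cauchy_ballP => e e0.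
  have eE : e = (complex.Re e)%:C by rewrite RRe_real // gtr0_real.
  have e20 : 0 < complex.Re e / 4 by rewrite divr_gt0 // -ltcR -eE.
  move/cvgrPdist_le : sS => /(_ _ e20)[N _ sN].
  have uN j : (N <= j)%N -> nrm (u j - u N) <= complex.Re e / 4.
    move=> Nj; apply: le_trans (usS _ _ Nj) _.
    by apply: le_trans (ler_norm _) (sN N _) => /=.
  exists (u @` [set j | (N <= j)%N], u @` [set j | (N <= j)%N]).
    by split; exists N => // j /= Nj; exists j.
  move=> [_ _] /= [[j Nj <-] [k Nk <-]]; rewrite -ball_normE /ball_ /= nrmE eE ltcR.
  rewrite -(subrKA (u N)) (le_lt_trans (ler_nrmD _ _)) // (nrm_distC (u N)).
  by have := uN j Nj; have := uN k Nk; lra.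
exists l => // k; apply/ler_addgt0Pr => e e0.
move/cvg_nrmP : ul => /(_ e e0)[N _ uN].
have /uN lu : (N <= maxn N k)%N by rewrite leq_maxl.
rewrite -(subrKA (u (maxn N k))) (le_trans (ler_nrmD _ _)) //.
by have := usS k (maxn N k) (leq_maxr _ _); move: lu; rewrite /=; lra.
Qed.

Lemma seq_complete (V : completeNormedModType R[i]) (u : nat -> V) :
  (forall e : R, 0 < e -> exists N, forall j k, (N <= j)%N -> (N <= k)%N ->
     nrm (u j - u k) <= e) -> exists l : V, u @ \oo --> l.
Proof.
move=> uc; apply/cvg_ex; apply: cauchy_cvg; apply/cauchy_ballP => e e0.
have eE : e = (complex.Re e)%:C by rewrite RRe_real // gtr0_real.
have e20 : 0 < complex.Re e / 2 by rewrite divr_gt0 // -ltcR -eE.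
have [N uN] := uc _ e20.
exists (u @` [set j | (N <= j)%N], u @` [set j | (N <= j)%N]).
  by split; exists N => // j /= Nj; exists j.
move=> [_ _] /= [[j Nj <-] [k Nk <-]]; rewrite -ball_normE /ball_ /= nrmE eE ltcR.
by apply: le_lt_trans (uN _ _ Nj Nk) _; lra.
Qed.

End Complete.

Section Projection.
Variables (R : realType) (H : hilbertType R).

(** A minimizing sequence for the distance from [x] to [D] is Cauchy by the
    parallelogram identity. The minimizer is orthogonal because a move along [z]
    cannot decrease the distance. *)
Lemma proj_exists (D : set H) (cD : closed_subspace D) (x : H) :
  exists y, D y /\ orth D (x - y).
Proof.
pose E : set R := [set nrm (x - y) ^+ 2 | y in D].
have E0 : has_inf E.
  split; first by exists (nrm (x - 0) ^+ 2), 0 => //; apply: (csub0 cD).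
  by exists 0 => _ [y _ <-]; apply: sqr_ge0.
have dE y : D y -> inf E <= nrm (x - y) ^+ 2.
  by move=> Dy; apply: ge_inf; [exact: E0.2|exists y].
have [k|u uP] := @choice nat H
    (fun k y => D y /\ nrm (x - y) ^+ 2 < inf E + k.+1%:R^-1).
  have [|_ [y Dy <-] xy] := @inf_adherent _ E k.+1%:R^-1 _ E0; first by rewrite invr_gt0.
  by exists y.
have uu j k : nrm (u j - u k) ^+ 2 <= (j.+1%:R^-1 + k.+1%:R^-1) *+ 2.
  have [Dj xj] := uP j; have [Dk xk] := uP k.
  have := parallelogram (x - u k) (x - u j).
  rewrite (_ : x - u k - (x - u j) = u j - u k); last by rewrite opprB addrC addrA subrK.
  rewrite (_ : x - u k + (x - u j) = 2%:R%:C *: (x - (2%:R^-1)%:C *: (u k + u j))).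
    rewrite nrm_real exprMn ger0_norm //.
    have : D ((2%:R^-1)%:C *: (u k + u j)) by apply: (csubZ cD); apply: (csubD cD).
    move=> /dE; move: xj xk; set a := j.+1%:R^-1; set b := k.+1%:R^-1.
    set p := nrm _ ^+ 2; set q := nrm _ ^+ 2; set s := nrm _ ^+ 2.
    set t := nrm _ ^+ 2. set w := inf E.
    rewrite (_ : 2 ^+ 2 * s = s *+ 4); last by ring.
    lra.
  rewrite scalerBr scalerA -rmorphM /= divff // scale1r.
  by rewrite rmorph_nat scaler_nat mulr2n opprD addrACA.
have [e|y uy] := seq_complete (u := u).
  move=> e0; have e4 : 0 < e ^+ 2 / 4 by rewrite divr_gt0 // exprn_gt0.
  pose N := Num.truncn (e ^+ 2 / 4)^-1; exists N.
  have inv k : (N <= k)%N -> k.+1%:R^-1 <= e ^+ 2 / 4.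
    move=> Nk; rewrite invf_ple ?posrE //; apply: ltW.
    apply: lt_le_trans (truncnS_gt _) _; by rewrite ler_nat ltnS.
  move=> j k /inv j4 /inv k4; rewrite -(@ler_pXn2r _ 2) ?nnegrE ?nrm_ge0 ?(ltW e0) //.
  by apply: le_trans (uu j k) _; move: j4 k4; set a := j.+1%:R^-1; set b := k.+1%:R^-1; lra.
have Dy : D y by apply: (csub_cvg cD _ uy); apply: nearW => k; case: (uP k).
have xy : nrm (x - y) ^+ 2 <= inf E.
  have xuy : (fun k => nrm (x - u k) ^+ 2) @ \oo --> nrm (x - y) ^+ 2.
    rewrite expr2; under eq_fun do rewrite expr2.
    by apply: cvgM; apply: nrm_cvg_real; apply: cvgB => //; apply: cvg_cst.
  have i0 : (fun k => inf E + k.+1%:R^-1) @ \oo --> inf E.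
    rewrite -[X in _ --> X]addr0; apply: cvgD; first exact: cvg_cst.
    exact: cvg_harmonic.
  apply: (ler_cvg_to xuy i0); apply: nearW => k.
  by have [_ /ltW] := uP k.
exists y; split => // z Dz; apply: nrm_eq0.
have [//|c0] := eqVneq (nrm (inner z (x - y))) 0; exfalso.
(* A move by [t c z] strictly decreases the distance as soon as
   [0 < t < 2 / |z|^2]. *)
pose c := inner (x - y) z; pose t : R := (nrm z ^+ 2 + 1)^-1.
have t0 : 0 < t by rewrite invr_gt0 ltr_wpDl // sqr_ge0.
have cp : 0 < nrm c ^+ 2.
  rewrite exprn_gt0 // lt_neqAle eq_sym nrm_ge0 andbT.
  by move: c0; rewrite innerC /nrm normcJ.
have : D (y + (t%:C * c) *: z) by apply: (csubD cD) => //; apply: (csubZ cD).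
move=> /dE; rewrite opprD addrA (_ : x - y - _ = (x - y) - (t%:C * c) *: z) //.
rewrite nrmB_sqr -scalerA nrm_real nrmZ !innerZr -/c.
rewrite (_ : complex.Re _ = t * nrm c ^+ 2); last first.
  by rewrite nrm_sqrE; case: (c) => a b /=; ring.
rewrite (ger0_norm (ltW t0)) => h.
have {}h : 0 <= nrm c ^+ 2 * (t ^+ 2 * nrm z ^+ 2 - t *+ 2).
  by have := le_trans xy h; rewrite -subr_ge0; congr (0 <= _); ring.
move: h; rewrite (pmulr_rge0 _ cp).
have tz : t * (nrm z ^+ 2 + 1) = 1.
  by rewrite mulVf // gt_eqF // ltr_wpDl // sqr_ge0.
have -> : t ^+ 2 * nrm z ^+ 2 - t *+ 2 = t * (t * (nrm z ^+ 2 + 1)) - t ^+ 2 - t *+ 2 by ring.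
rewrite tz; have := exprn_gt0 2 t0; lra.
Qed.

Lemma projP (D : set H) (cD : closed_subspace D) (x : H) : D (proj D x) /\ orth D (x - proj D x).
Proof. by rewrite /proj; apply: (xgetPex 0 (proj_exists cD x)). Qed.

Lemma proj_in (D : set H) (cD : closed_subspace D) (x : H) : D (proj D x).
Proof. by case: (projP cD x). Qed.

Lemma proj_orth (D : set H) (cD : closed_subspace D) (x : H) : orth D (x - proj D x).
Proof. by case: (projP cD x). Qed.

Lemma proj_uniq (D : set H) (cD : closed_subspace D) (x y : H) :
  D y -> orth D (x - y) -> proj D x = y.
Proof.
move=> Dy xy; apply/eqP; rewrite -subr_eq0; apply/eqP/inner_self_eq0.
have Dpy : D (proj D x - y) by apply: (csubB cD) => //; apply: (proj_in cD).
rewrite {2}(_ : proj D x - y = (x - y) - (x - proj D x)).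
  by rewrite innerBr xy // (proj_orth cD) // subrr.
by rewrite opprB [RHS]addrC addrA subrK.
Qed.

Lemma proj_id (D : set H) (cD : closed_subspace D) (x : H) : D x -> proj D x = x.
Proof. by move=> Dx; apply: proj_uniq => // z _; rewrite subrr inner0r. Qed.

Lemma proj_idem (D : set H) (cD : closed_subspace D) (x : H) : proj D (proj D x) = proj D x.
Proof. exact: (proj_id cD (proj_in cD x)). Qed.

Lemma proj_fixP (D : set H) (cD : closed_subspace D) (x : H) : proj D x = x -> D x.
Proof. by move=> <-; apply: (proj_in cD). Qed.

Lemma inner_proj (D : set H) (cD : closed_subspace D) (x y : H) :
  inner (proj D x) y = inner x (proj D y).
Proof.
have h (z w : H) : inner (proj D z) w = inner (proj D z) (proj D w).
  apply/eqP; by rewrite -subr_eq0 -innerBr (proj_orth cD w (proj_in cD z)).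
by rewrite h [RHS]innerC (h y x) -innerC.
Qed.

Lemma nrm_proj (D : set H) (cD : closed_subspace D) (x : H) : nrm (proj D x) <= nrm x.
Proof.
rewrite -(@ler_pXn2r _ 2) ?nnegrE ?nrm_ge0 //.
rewrite -{2}(subrK (proj D x) x) nrmD_sqr Re_innerC (proj_orth cD x (proj_in cD x)).
by rewrite mul0rn addr0 lerDr sqr_ge0.
Qed.

Lemma bl_proj (D : set H) (cD : closed_subspace D) : bounded_linear (proj D).
Proof.
apply: (@bl_intro _ _ _ _ 1) => [x y|a x|x].
- apply: (proj_uniq cD); first by apply: (csubD cD); apply: (proj_in cD).
  move=> z Dz; rewrite opprD addrACA innerDr.
  by rewrite !(proj_orth cD) // addr0.
- apply: (proj_uniq cD); first by apply: (csubZ cD); apply: (proj_in cD).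
  by move=> z Dz; rewrite -scalerBr innerZr (proj_orth cD) // mulr0.
- by rewrite mul1r nrm_proj.
Qed.

Lemma orth_orth (D : set H) (cD : closed_subspace D) (x : H) : orth (orth D) x -> D x.
Proof.
move=> xx; apply: (proj_fixP cD); apply/eqP; rewrite eq_sym -subr_eq0; apply/eqP.
apply: inner_self_eq0; rewrite innerBr xx; last exact: (proj_orth cD).
by rewrite innerC (proj_orth cD x (proj_in cD x)) conjc0 subrr.
Qed.

Lemma orth_total (S : set H) (x : H) :
  (forall y, orth S y -> y = 0) -> cspan S x.
Proof.
move=> S0; apply: (orth_orth (@csub_cspan _ _ S)) => y Sy.
rewrite (S0 y) ?inner0l // => z Sz.
by apply: Sy; apply: sub_cspan.
Qed.

(** A functional is determined by its value at one vector [u] orthogonal to its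
    kernel. *)
Lemma riesz (phi : H -> R[i]) : bounded_linear phi -> exists z, forall x, phi x = inner x z.
Proof.
move=> bphi; pose D := [set x | phi x = 0].
have cD : closed_subspace D by apply: (csub_eq bphi); apply: bl_cst0.
have [D1|] := pselect (forall x, D x); first by exists 0 => x; rewrite inner0r D1.
move=> /existsNP[x0 Dx0].
pose u := x0 - proj D x0.
have phiu : phi u != 0.
  by apply/eqP; rewrite /u (blB bphi) (proj_in cD x0) subr0 => h; apply: Dx0.
have u0 : nrm u ^+ 2 != 0.
  by apply: contraNneq phiu => /eqP; rewrite sqrf_eq0 => /eqP/nrm_eq0 ->; rewrite (bl0 bphi).
exists ((((nrm u ^+ 2)^-1)%:C * (phi u)^*%C) *: u) => x.
rewrite -{2}(subrK ((phi x / phi u) *: u) x) innerDl [X in _ = X + _]innerZr.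
rewrite (proj_orth cD) ?mulr0 ?add0r.
  rewrite innerZl innerZr innerE rmorphM /= conjcK oppr0.
  rewrite -[(_ +i* 0)%C]/((nrm u ^+ 2)^-1)%:C [X in _ = _ * X]mulrAC -rmorphM mulVf // rmorph1.
  by rewrite mul1r divfK.
rewrite /D /= (blB bphi) (blZ bphi) -[X in _ - X]/(phi x / phi u * phi u).
by rewrite divfK // subrr.
Qed.

End Projection.

Section Adjoint.
Variable R : realType.
Implicit Types H K L : hilbertType R.

Lemma adjP H K (A : H -> K) : bounded_linear A ->
  forall x y, inner (A x) y = inner x (adj A y).
Proof.
move=> bA; have [y|B BP] := @choice K H (fun y z => forall x, inner (A x) y = inner x z).
  exact: (riesz (bl_comp (bl_inner y) bA)).
rewrite /adj; apply: (@xgetPex _ (cst 0) [set B | forall x y, inner (A x) y = inner x (B y)]).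
by exists B => x y.
Qed.

Lemma adjP' H K (A : H -> K) : bounded_linear A ->
  forall x y, inner (adj A x) y = inner x (A y).
Proof. by move=> bA x y; rewrite innerC -adjP // -innerC. Qed.

Lemma adj_uniq H K (A : H -> K) (B : K -> H) : bounded_linear A ->
  (forall x y, inner (A x) y = inner x (B y)) -> adj A = B.
Proof.
by move=> bA AB; apply/funext => y; apply: inner_inj => x; rewrite -adjP.
Qed.

Lemma adj_bound H K (A : H -> K) (M : R) : bounded_linear A -> 0 <= M ->
  (forall x, nrm (A x) <= M * nrm x) -> forall y, nrm (adj A y) <= M * nrm y.
Proof.
move=> bA M0 AM y; have [->|y0] := eqVneq (nrm (adj A y)) 0.
  by rewrite mulr_ge0 ?nrm_ge0.
have yp : 0 < nrm (adj A y) by rewrite lt_neqAle eq_sym y0 nrm_ge0.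
rewrite -(ler_pM2l yp) -expr2 -Re_inner -adjP //.
apply: le_trans (Re_cauchy_schwarz _ _) _.
by apply: le_trans (ler_wpM2r (nrm_ge0 y) (AM _)) _; rewrite mulrCA mulrA.
Qed.

Lemma bl_adj H K (A : H -> K) : bounded_linear A -> bounded_linear (adj A).
Proof.
move=> bA; have [M M0 AM] := bl_bound bA.
apply: (@bl_intro _ _ _ _ M) => [x y|a x|].
- by apply: inner_inj => z; rewrite -adjP // !innerDr -!adjP.
- by apply: inner_inj => z; rewrite -adjP // !innerZr -!adjP.
- exact: (adj_bound bA (ltW M0) AM).
Qed.

Lemma adjK H K (A : H -> K) : bounded_linear A -> adj (adj A) = A.
Proof. by move=> bA; apply: adj_uniq => [|x y]; [exact: bl_adj|exact: adjP']. Qed.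

Lemma opnorm_has_sup H K (A : H -> K) : bounded_linear A ->
  has_sup [set nrm (A x) | x in [set x | nrm x <= 1]].
Proof.
move=> bA; have [M M0 AM] := bl_bound bA; split.
  by exists (nrm (A 0)), 0 => //=; rewrite nrm0.
exists M => _ [x /= x1 <-]; apply: le_trans (AM x) _.
by rewrite -[leRHS]mulr1 ler_wpM2l // ltW.
Qed.

Lemma opnorm_ge0 H K (A : H -> K) : bounded_linear A -> 0 <= opnorm A.
Proof.
move=> bA; apply: le_trans (nrm_ge0 (A 0)) _.
by apply: sup_upper_bound; [exact: opnorm_has_sup|exists 0 => //=; rewrite nrm0].
Qed.

Lemma opnorm_bound H K (A : H -> K) : bounded_linear A ->
  forall x, nrm (A x) <= opnorm A * nrm x.
Proof.
move=> bA x; have [->|x0] := eqVneq x 0.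
  by rewrite (bl0 bA) !nrm0 mulr0.
have xp : 0 < nrm x.
  rewrite lt_neqAle nrm_ge0 andbT eq_sym; apply: contra_neq x0; exact: nrm_eq0.
have : nrm (A ((nrm x)^-1%:C *: x)) <= opnorm A.
  apply: sup_upper_bound; first exact: opnorm_has_sup.
  exists ((nrm x)^-1%:C *: x) => //=.
  by rewrite nrm_real ger0_norm ?invr_ge0 ?nrm_ge0 // mulVf // gt_eqF.
rewrite (blZ bA) nrm_real ger0_norm ?invr_ge0 ?nrm_ge0 //.
by rewrite ler_pdivrMl // mulrC.
Qed.

Lemma opnorm_le H K (A : H -> K) (M : R) : 0 <= M ->
  (forall x, nrm (A x) <= M * nrm x) -> opnorm A <= M.
Proof.
move=> M0 AM; apply: ge_sup => [|_ [x /= x1 <-]].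
  by exists (nrm (A 0)), 0 => //=; rewrite nrm0.
by apply: le_trans (AM x) _; rewrite -[leRHS]mulr1 ler_wpM2l.
Qed.

Lemma norm_cvgP H K T (F : set_system T) {FF : Filter F} (A : T -> H -> K) (L : H -> K) :
  bounded_linear L -> (forall t, bounded_linear (A t)) ->
  (norm_cvg F A L <-> forall e : R, 0 < e ->
     \forall t \near F, forall x, nrm (A t x - L x) <= e * nrm x).
Proof.
move=> bL bA; split=> [[_ /cvgrPdist_le AL] e e0|AL].
  apply: filterS (AL e e0) => t; rewrite sub0r normrN => h x.
  have bAL := bl_subf (bA t) bL.
  apply: le_trans (opnorm_bound bAL x) _; rewrite ler_wpM2r ?nrm_ge0 //.
  exact: le_trans (ler_norm _) h.
split => //; apply/cvgrPdist_le => e e0; apply: filterS (AL e e0) => t h.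
have bAL := bl_subf (bA t) bL.
by rewrite sub0r normrN ger0_norm ?opnorm_ge0 // opnorm_le // ltW.
Qed.

Lemma norm_cvg_pt H K T (F : set_system T) {FF : Filter F} (A : T -> H -> K) (L : H -> K) :
  (forall t, bounded_linear (A t)) -> norm_cvg F A L ->
  forall x, A t x @[t --> F] --> L x.
Proof.
move=> bA AL x; have [bL _] := AL; move/(norm_cvgP bL bA) : AL => AL.
apply/cvg_nrmP => e e0.
have e1 : 0 < e / (nrm x + 1) by rewrite divr_gt0 // ltr_wpDl ?nrm_ge0.
apply: filterS (AL _ e1) => t /(_ x); rewrite nrm_distC => h; apply: le_trans h _.
rewrite mulrAC ler_pdivrMr ?ltr_wpDl ?nrm_ge0 //.
by rewrite ler_wpM2l ?(ltW e0) // lerDl ler01.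
Qed.

Lemma inner_cvg H T (F : set_system T) {FF : Filter F} (f : T -> H) (x y : H) :
  f @ F --> x -> (fun t => inner (f t) y : R[i]) @ F --> (inner x y : R[i]).
Proof. by move=> fx; apply: (bl_cvg (bl_inner y) fx). Qed.

Lemma inner_cvgr H T (F : set_system T) {FF : Filter F} (f : T -> H) (x y : H) :
  f @ F --> y -> (fun t => inner x (f t) : R[i]) @ F --> (inner x y : R[i]).
Proof.
move=> fy; have /cvg_nrmP h := @inner_cvg H T F FF f y x fy.
apply/cvg_nrmP => e /h; apply: filterS => t.
by rewrite (innerC y x) (innerC (f t) x) -rmorphB /nrm normcJ.
Qed.

Lemma hcvg_uniq H T (F : set_system T) {FF : ProperFilter F} (f : T -> H) (x y : H) :
  f @ F --> x -> f @ F --> y -> x = y.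
Proof. by move=> fx fy; apply: (cvg_unique _ fx fy). Qed.

Lemma neumann H (C : H -> H) (q : R) (v : H) : bounded_linear C -> 0 <= q < 1 ->
  (forall x, nrm (C x) <= q * nrm x) -> exists y, y = C y + v.
Proof.
move=> bC /andP[q0 q1] Cq; have q1' : 0 < 1 - q by rewrite subr_gt0.
pose u k := iter k (fun y => C y + v) 0.
pose s k := - (nrm v / (1 - q) * q ^+ k).
have us k : nrm (u k.+1 - u k) <= nrm v * q ^+ k.
  elim: k => [|k IH]; first by rewrite /u /= (bl0 bC) add0r subr0 mulr1.
  rewrite {1}/u !iterS -/(u k) -/(u k.+1) opprD addrACA subrr addr0 -(blB bC).
  apply: le_trans (Cq _) _; rewrite exprS mulrCA ler_wpM2l //.
have [|k|l ul _] := @dominated_cvg _ _ u s 0.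
- move=> k; apply: le_trans (us k) _; rewrite /s exprS le_eqVlt; apply/orP; left.
  by apply/eqP; field; rewrite gt_eqF.
- by rewrite oppr_le0 mulr_ge0 ?divr_ge0 ?nrm_ge0 ?exprn_ge0 // ltW.
exists l; have ul1 : (fun k => u k.+1) @ \oo --> l by rewrite (cvg_shiftS u).
apply: (hcvg_uniq ul1); apply: cvgD; last exact: cvg_cst.
exact: (bl_cvg bC ul).
Qed.

Lemma neumann_uniq H (C : H -> H) (q : R) (x : H) : q < 1 ->
  (forall x, nrm (C x) <= q * nrm x) -> x = C x -> x = 0.
Proof.
move=> q1 Cq xC; apply: nrm_eq0; have := Cq x; rewrite -xC => h.
apply/le_anti; rewrite nrm_ge0 andbT -(pmulr_rle0 _ (_ : 0 < 1 - q)) ?subr_gt0 //.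
by rewrite mulrBl mul1r subr_le0.
Qed.

End Adjoint.

(** * Positive square roots and defect operators *)

Section SquareRoot.
Variable R : realType.
Implicit Types H K : hilbertType R.

Definition selfadj H (C : H -> H) := forall x y, inner (C x) y = inner x (C y).

(** A fixed point [Y] of [Y = (C + Y^2) / 2] satisfies
    [(I - Y)^2 = I - C], so that the limit of this iteration gives the
    square root [I - Y]. The iterates are polynomials in [C]: whatever
    intertwines two operators also intertwines the square roots. *)
Fixpoint sqrt_iter H (C : H -> H) (k : nat) (x : H) : H :=
  if k is k'.+1 then
    (2%:R^-1)%:C *: (C x + sqrt_iter C k' (sqrt_iter C k' x))
  else 0.

(** The same iteration for the scalar [C = 1], which dominates it. *)
Fixpoint sqrt_bound (k : nat) : R :=
  if k is k'.+1 then (1 + sqrt_bound k' ^+ 2) / 2 else 0.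

Lemma sqrt_bound_itv k : 0 <= sqrt_bound k <= 1.
Proof.
elim: k => [|k /andP[k0 k1]] /=; first by rewrite lexx ler01.
by apply/andP; split; nra.
Qed.

Lemma half_scale H (x : H) : (2%:R^-1)%:C *: (x + x) = x.
Proof.
rewrite -mulr2n -[x *+ 2]scaler_nat scalerA -(rmorph_nat (real_complex R)) -rmorphM /=.
by rewrite mulVf // scale1r.
Qed.

Lemma sqrt_iter_intertwine H K (X : H -> K) (C : H -> H) (C' : K -> K) :
  bounded_linear X -> (forall x, X (C x) = C' (X x)) ->
  forall k x, X (sqrt_iter C k x) = sqrt_iter C' k (X x).
Proof.
move=> bX XC; elim=> [|k IH] x /=; first exact: (bl0 bX).
by rewrite (blZ bX) (blD bX) XC !IH.
Qed.

(** By polarization, as all [inner (A x) x] are real. *)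
Lemma positive_selfadj H (A : H -> H) :
  bounded_linear A -> positive_op A -> selfadj A.
Proof.
move=> bA pA.
have Im0 x : complex.Im (inner (A x) x) = 0.
  by have := pA x; rewrite lecE /= => /andP[/eqP].
have h x y : complex.Im (inner (A x) y) = - complex.Im (inner (A y) x).
  have := Im0 (x + y); rewrite (blD bA) innerDl !innerDr.
  have := Im0 x; have := Im0 y.
  case: (inner (A x) x) (inner (A x) y) (inner (A y) x) (inner (A y) y) =>
    [a b] [c d] [e f] [i j] /= -> ->; rewrite add0r addr0 => /eqP.
  by rewrite addr_eq0 => /eqP.
move=> x y; rewrite (innerC (A y) x); have h1 := h x y; have := h x ('i%C *: y).
rewrite (blZ bA) innerZl innerZr.
case: (inner (A x) y) (inner (A y) x) h1 => [a b] [c d] /= -> h2.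
by congr (_ +i* _)%C; move: h2; lra.
Qed.

(** The nonnegative polynomial [inner (A (x + t A x)) (x + t A x)] in
    [t] has no constant term, so that its linear coefficient [2 |A x|^2]
    vanishes. *)
Lemma positive_ker H (A : H -> H) (x : H) :
  bounded_linear A -> positive_op A -> inner (A x) x = 0 -> A x = 0.
Proof.
move=> bA pA xx; have sA := positive_selfadj bA pA.
have [M M0 AM] := bl_bound bA.
have key (t : R) : 0 <= t * nrm (A x) ^+ 2 *+ 2 + t ^+ 2 * (M * nrm (A x) ^+ 2).
  have := pA (x + t%:C *: A x); rewrite lecE => /andP[_] /=.
  rewrite (blD bA) (blZ bA) innerDl !innerDr xx !innerZl !innerZr conjc_real.
  rewrite (sA (A x) x) innerE add0r.
  have : complex.Re (inner (A (A x)) (A x)) <= M * nrm (A x) ^+ 2.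
    apply: le_trans (Re_cauchy_schwarz _ _) _.
    by rewrite expr2 mulrA ler_wpM2r ?nrm_ge0.
  case: (inner (A (A x)) (A x)) => a b /= h.
  have : t ^+ 2 * a <= t ^+ 2 * (M * nrm (A x) ^+ 2) by rewrite ler_wpM2l ?sqr_ge0.
  by lra.
apply: nrm_eq0; apply/eqP; rewrite -sqrf_eq0; apply/eqP; apply/le_anti.
(* At [t = - 1 / M] the polynomial is at most [- |A x|^2 / M]. *)
rewrite sqr_ge0 andbT; have := key (- M^-1).
have MM : M^-1 * M = 1 by rewrite mulVf // gt_eqF.
have Mi : 0 < M^-1 by rewrite invr_gt0.
set a := nrm _ ^+ 2; set m := M^-1 in MM Mi *.
rewrite (_ : _ + _ = - (m * a) *+ 2 + m * (m * M) * a); last by ring.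
rewrite MM mulr1 mulNrn => h; rewrite -(pmulr_rle0 _ Mi); lra.
Qed.

Section Construction.
Variables (H : hilbertType R) (C : H -> H).
Hypotheses (bC : bounded_linear C) (C1 : forall x, nrm (C x) <= nrm x).
Hypothesis (sC : selfadj C).

Let Y := sqrt_iter C.

Lemma bl_sqrt_iter k : bounded_linear (Y k).
Proof.
elim: k => [|k IH]; first exact: bl_cst0.
exact: (bl_scalef _ (bl_addf bC (bl_comp IH IH))).
Qed.

Lemma sqrt_iter_comm j k x : Y j (Y k x) = Y k (Y j x).
Proof.
apply: (sqrt_iter_intertwine (bl_sqrt_iter j)) => {}x.
by rewrite /Y (sqrt_iter_intertwine bC (C' := C)).
Qed.

Lemma sqrt_iter_bound k x : nrm (Y k x) <= sqrt_bound k * nrm x.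
Proof.
elim: k x => [|k IH] x /=; first by rewrite nrm0 mul0r.
rewrite nrm_real ger0_norm ?invr_ge0 // [leRHS]mulrAC [leRHS]mulrC ler_wpM2l ?invr_ge0 //.
apply: le_trans (ler_nrmD _ _) _; rewrite mulrDl mul1r lerD //.
rewrite expr2 -mulrA; apply: le_trans (IH _) _; rewrite ler_wpM2l //.
by case/andP: (sqrt_bound_itv k).
Qed.

(** The iterates commute, so that the increment [Y (k + 2) - Y (k + 1)]
    is [(Y (k + 1) + Y k) / 2] applied to [Y (k + 1) - Y k]; the
    dominating scalars obey the same recurrence. *)
Lemma sqrt_iter_step k x :
  nrm (Y k.+1 x - Y k x) <= (sqrt_bound k.+1 - sqrt_bound k) * nrm x.
Proof.
elim: k x => [|k IH] x.
  rewrite /Y /= !subr0 addr0 nrm_real ger0_norm ?invr_ge0 // expr0n /= addr0 mul1r.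
  by rewrite ler_wpM2l ?invr_ge0.
have -> : Y k.+2 x - Y k.+1 x = (2%:R^-1)%:C *:
    (Y k.+1 (Y k.+1 x - Y k x) + Y k (Y k.+1 x - Y k x)).
  rewrite [Y k.+2 x]/= {2}[Y k.+1 x]/= -scalerBr opprD addrACA subrr add0r.
  rewrite !(blB (bl_sqrt_iter _)) (sqrt_iter_comm k.+1 k).
  by rewrite addrA subrK.
rewrite nrm_real ger0_norm ?invr_ge0 //.
have /andP[a0 a1] := sqrt_bound_itv k; have /andP[b0 b1] := sqrt_bound_itv k.+1.
have -> : sqrt_bound k.+2 - sqrt_bound k.+1 = 2%:R^-1 *
    ((sqrt_bound k.+1 + sqrt_bound k) * (sqrt_bound k.+1 - sqrt_bound k)).
  rewrite -[sqrt_bound k.+2]/((1 + sqrt_bound k.+1 ^+ 2) / 2).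
  by rewrite -[sqrt_bound k.+1]/((1 + sqrt_bound k ^+ 2) / 2); field.
rewrite -mulrA ler_wpM2l ?invr_ge0 //; apply: le_trans (ler_nrmD _ _) _.
apply: le_trans (lerD (sqrt_iter_bound _ _) (sqrt_iter_bound _ _)) _.
by rewrite -mulrDl -mulrA ler_wpM2l ?addr_ge0.
Qed.

Lemma sqrt_iter_cvg x : exists l, (fun k => Y k x) @ \oo --> (l : H).
Proof.
have [k|k|l Yl _] := @dominated_cvg _ _ (fun k => Y k x)
    (fun k => sqrt_bound k * nrm x) (nrm x).
- by rewrite -mulrBl sqrt_iter_step.
- by rewrite ler_piMl ?nrm_ge0 //; case/andP: (sqrt_bound_itv k).
by exists l.
Qed.

Lemma sqrt_exists : exists B : H -> H,
  [/\ bounded_linear B, positive_op B, forall x, B (B x) = x - C x &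
   forall x, B x = x - lim ((fun k => Y k x) @ \oo)].
Proof.
pose Z x := lim ((fun k => Y k x) @ \oo).
have YZ x : (fun k => Y k x) @ \oo --> Z x.
  by have [l Yl] := sqrt_iter_cvg x; rewrite /Z (cvg_lim _ Yl).
have Z1 x : nrm (Z x) <= nrm x.
  apply: (ler_cvg_to (nrm_cvg_real (YZ x)) (cvg_cst (nrm x))); apply: nearW => k.
  apply: le_trans (sqrt_iter_bound _ _) _; rewrite ler_piMl ?nrm_ge0 //.
  by case/andP: (sqrt_bound_itv k).
have bZ : bounded_linear Z.
  apply: (@bl_intro _ _ _ _ 1) => [x y|a x|x]; last by rewrite mul1r.
    apply: (hcvg_uniq (YZ _)); rewrite (_ : (fun k => Y k (x + y)) =
      (fun k => Y k x + Y k y)); first exact: cvgD.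
    by apply/funext => k; rewrite (blD (bl_sqrt_iter k)).
  apply: (hcvg_uniq (YZ _)); rewrite (_ : (fun k => Y k (a *: x)) =
      (fun k => a *: Y k x)); first exact: (cvgZr).
  by apply/funext => k; rewrite (blZ (bl_sqrt_iter k)).
have sZ : selfadj Z.
  have sY k : selfadj (Y k).
    elim: k => [|k IH] x y /=; first by rewrite inner0l inner0r.
    rewrite innerZl innerZr conjc_real innerDl innerDr sC.
    by rewrite -/(Y k) !IH.
  move=> x y.
  apply: (@hcvg_uniq _ (R[i] : hilbertType R) _ \oo _ (fun k => inner (Y k x) y)).
    exact: (inner_cvg (YZ x)).
  rewrite (_ : (fun k => inner (Y k x) y) = (fun k => inner x (Y k y))).
    exact: (inner_cvgr (YZ y)).
  by apply/funext => k; rewrite sY.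
(* Passing to the limit in [Y (k + 1) = (C + Y k ^ 2) / 2]. *)
have ZE x : Z x + Z x = C x + Z (Z x).
  have YY : (fun k => Y k (Y k x)) @ \oo --> Z (Z x).
    rewrite (_ : (fun k => Y k (Y k x)) =
      (fun k => Y k (Y k x - Z x) + Y k (Z x))).
      rewrite -[X in _ --> X]add0r; apply: cvgD; last exact: YZ.
      have /cvg_nrmP YZx := YZ x; apply/cvg_nrmP => e /YZx; apply: filterS => k.
      rewrite sub0r nrmN nrm_distC; apply: le_trans.
      apply: le_trans (sqrt_iter_bound _ _) _; rewrite ler_piMl ?nrm_ge0 //.
      by case/andP: (sqrt_bound_itv k).
    by apply/funext => k; rewrite (blB (bl_sqrt_iter k)) subrK.
  have Y1 : (fun k => Y k.+1 x) @ \oo --> Z x by rewrite (cvg_shiftS (fun k => Y k x)).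
  have Y2 : (fun k => Y k.+1 x) @ \oo --> (2%:R^-1)%:C *: (C x + Z (Z x)).
    by apply: cvgZr; apply: cvgD => //; apply: cvg_cst.
  by rewrite {1 2}(hcvg_uniq Y1 Y2) -scalerDr half_scale.
exists (fun x => x - Z x); split.
- exact: (bl_subf (bl_id H) bZ).
- move=> x; rewrite innerBl lecE /=; apply/andP; split.
    have : complex.Im (inner (Z x) x) = - complex.Im (inner (Z x) x).
      by rewrite {1}sZ innerC; case: (inner (Z x) x).
    have : complex.Im (inner x x) = 0 by rewrite innerE.
    case: (inner x x) (inner (Z x) x) => [a b] [c d] /= -> h.
    by apply/eqP; move: h; lra.
  have : complex.Re (inner (Z x) x) <= nrm x ^+ 2.
    apply: le_trans (Re_cauchy_schwarz _ _) _.
    by rewrite expr2 ler_wpM2r ?nrm_ge0.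
  have := Re_inner x; case: (inner x x) (inner (Z x) x) => [a b] [c d] /=.
  lra.
- move=> x; rewrite (blB bZ).
  have -> : Z (Z x) = Z x + Z x - C x by rewrite ZE addrAC subrr add0r.
  by rewrite opprB [X in _ + X = _]addrAC addrK addrA subrK.
- by [].
Qed.

End Construction.

End SquareRoot.

Section SquareRootSpec.
Variable R : realType.
Implicit Types H K : hilbertType R.

(** The square root [B] of [sqrt_exists] is the only positive one. Another one,
    [B'], commutes with [C], hence with [B]; for [y = B' x - B x] this
    gives [B' y + B y = 0], thus [inner (B' y) y] and
    [inner (B y) y] are opposite and nonnegative. So [B' y = B y = 0]
    and [inner y y = 0]. *)
Lemma sqrt_op_spec H (C : H -> H) : bounded_linear C -> (forall x, nrm (C x) <= nrm x) ->
  selfadj C -> let B := sqrt_op (idfun - C) in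
  [/\ bounded_linear B, positive_op B, forall x, B (B x) = x - C x &
   forall x, B x = x - lim ((fun k => sqrt_iter C k x) @ \oo)].
Proof.
move=> bC C1 sC; have [B [bB pB BB BE]] := sqrt_exists bC C1 sC.
suff uniq (B' : H -> H) : bounded_linear B' -> positive_op B' ->
    (forall x, B' (B' x) = x - C x) -> B' = B.
  rewrite /= /sqrt_op.
  have [bB' pB' BB'] : [set B | [/\ bounded_linear B, positive_op B & B \o B = idfun - C]]
      (sqrt_op (idfun - C)).
    apply: xgetPex; exists B; split=> //; apply/funext => x; exact: BB.
  rewrite -/(sqrt_op _) (uniq _ bB' pB') // => x.
  by have := congr1 (@^~ x) BB'.
move=> bB' pB' BB'.
have CE x : C x = x - B' (B' x) by rewrite BB' subKr.
have B'C x : B' (C x) = C (B' x) by rewrite !CE (blB bB').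
have comm x : B' (B x) = B (B' x).
  rewrite !BE (blB bB'); congr (_ - _).
  have [l Yl] := sqrt_iter_cvg bC C1 x.
  rewrite (cvg_lim _ Yl) //.
  rewrite (_ : (fun k => sqrt_iter C k (B' x)) = B' \o (fun k => sqrt_iter C k x)).
    by rewrite (cvg_lim _ (bl_cvg bB' Yl)).
  by apply/funext => k /=; rewrite (sqrt_iter_intertwine bB' B'C).
apply/funext => x; apply/eqP; rewrite -subr_eq0; apply/eqP/inner_self_eq0.
pose y := B' x - B x.
have sumE : B' y + B y = 0.
  rewrite /y (blB bB) (blB bB') BB BB' comm addrA subrK subrr //.
have B0 : B' y = 0 /\ B y = 0.
  have /eqP : inner (B' y) y + inner (B y) y = 0 by rewrite -innerDl sumE inner0l.
  rewrite paddr_eq0 ?pB ?pB' // => /andP[/eqP h' /eqP h].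
  by split; apply: positive_ker.
rewrite -/y {1}/y innerBl (positive_selfadj bB' pB') (positive_selfadj bB pB).
by rewrite !B0.1 !B0.2 subrr.
Qed.

(** Each step of the iteration is intertwined, hence the limit. *)
Lemma sqrt_op_intertwine H K (C : H -> H) (C' : K -> K) (X : H -> K) :
  bounded_linear C -> (forall x, nrm (C x) <= nrm x) -> selfadj C ->
  bounded_linear C' -> (forall x, nrm (C' x) <= nrm x) -> selfadj C' ->
  bounded_linear X -> (forall x, X (C x) = C' (X x)) ->
  forall x, X (sqrt_op (idfun - C) x) = sqrt_op (idfun - C') (X x).
Proof.
move=> bC C1 sC bC' C1' sC' bX XC x.
have [_ _ _ ->] := sqrt_op_spec bC C1 sC; have [_ _ _ ->] := sqrt_op_spec bC' C1' sC'.
rewrite (blB bX); congr (_ - _); have [l Yl] := sqrt_iter_cvg bC C1 x.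
rewrite (cvg_lim _ Yl) //.
rewrite (_ : (fun k => sqrt_iter C' k (X x)) = X \o (fun k => sqrt_iter C k x)).
  by rewrite (cvg_lim _ (bl_cvg bX Yl)).
by apply/funext => k /=; rewrite (sqrt_iter_intertwine bX XC).
Qed.

End SquareRootSpec.

Section Defect.
Variables (R : realType) (G H : hilbertType R) (X : G -> H).
Hypotheses (bX : bounded_linear X) (X1 : forall u, nrm (X u) <= nrm u).

Let X' := adj X.
Definition defect_of := sqrt_op (idfun - (adj X \o X)).
Definition codefect_of := sqrt_op (idfun - (X \o adj X)).
Let Ds := defect_of.
Let Dl := codefect_of.

Let bX' : bounded_linear X' := bl_adj bX.

Lemma nrm_adj_contr h : nrm (adj X h) <= nrm h.
Proof. by rewrite -[leRHS]mul1r; apply: adj_bound => // u; rewrite mul1r. Qed.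

Let bC1 : bounded_linear (X' \o X) := bl_comp bX' bX.
Let bC2 : bounded_linear (X \o X') := bl_comp bX bX'.
Let C11 u : nrm ((X' \o X) u) <= nrm u.
Proof. exact: le_trans (nrm_adj_contr _) (X1 u). Qed.
Let C21 u : nrm ((X \o X') u) <= nrm u.
Proof. exact: le_trans (X1 _) (nrm_adj_contr u). Qed.
Let sC1 : selfadj (X' \o X).
Proof. by move=> u v; rewrite /= (adjP' bX) (adjP bX). Qed.
Let sC2 : selfadj (X \o X').
Proof. by move=> u v; rewrite /= (adjP bX) (adjP' bX). Qed.

Lemma bl_defect : bounded_linear Ds.
Proof. by case: (sqrt_op_spec bC1 C11 sC1). Qed.

Lemma bl_codefect : bounded_linear Dl.
Proof. by case: (sqrt_op_spec bC2 C21 sC2). Qed.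

Lemma selfadj_defect : selfadj Ds.
Proof.
by have [b p _ _] := sqrt_op_spec bC1 C11 sC1; apply: positive_selfadj.
Qed.

Lemma selfadj_codefect : selfadj Dl.
Proof.
by have [b p _ _] := sqrt_op_spec bC2 C21 sC2; apply: positive_selfadj.
Qed.

Lemma defect_sqr u : Ds (Ds u) = u - adj X (X u).
Proof. by have [_ _ h _] := sqrt_op_spec bC1 C11 sC1; apply: h. Qed.

Lemma codefect_sqr h : Dl (Dl h) = h - X (adj X h).
Proof. by have [_ _ e _] := sqrt_op_spec bC2 C21 sC2; apply: e. Qed.

Lemma defect_intertwine u : X (Ds u) = Dl (X u).
Proof. exact: (sqrt_op_intertwine bC1 C11 sC1 bC2 C21 sC2 bX). Qed.

Lemma codefect_intertwine h : adj X (Dl h) = Ds (adj X h).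
Proof. exact: (sqrt_op_intertwine bC2 C21 sC2 bC1 C11 sC1 bX'). Qed.

End Defect.

Lemma defect_transport (R : realType) (G H G' H' : hilbertType R) (X : G -> H) (X' : G' -> H')
  (U : H -> H') (V : G -> G') :
  bounded_linear X -> (forall u, nrm (X u) <= nrm u) ->
  bounded_linear X' -> (forall u, nrm (X' u) <= nrm u) ->
  bounded_linear U -> bounded_linear V ->
  (forall u, U (X u) = X' (V u)) -> (forall h, V (adj X h) = adj X' (U h)) ->
  (forall u, V (defect_of X u) = defect_of X' (V u)) /\
  (forall h, U (codefect_of X h) = codefect_of X' (U h)).
Proof.
move=> bX X1 bX' X1' bU bV UX VX.
have bA := bl_adj bX; have bA' := bl_adj bX'.
have A1 := nrm_adj_contr bX X1; have A1' := nrm_adj_contr bX' X1'.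
split=> x; apply: sqrt_op_intertwine => //.
- exact: bl_comp.
- by move=> u; apply: le_trans (A1 _) (X1 u).
- by move=> u v; rewrite /= (adjP' bX) (adjP bX).
- exact: bl_comp.
- by move=> u; apply: le_trans (A1' _) (X1' u).
- by move=> u v; rewrite /= (adjP' bX') (adjP bX').
- by move=> u /=; rewrite VX UX.
- exact: bl_comp.
- by move=> u; apply: le_trans (X1 _) (A1 u).
- by move=> u v; rewrite /= (adjP bX) (adjP' bX).
- exact: bl_comp.
- by move=> u; apply: le_trans (X1' _) (A1' u).
- by move=> u v; rewrite /= (adjP bX') (adjP' bX').
- by move=> u /=; rewrite UX VX.
Qed.

(** * Operators on square-summable families *)

#[local] Existing Instance summability.totally_filter.

(** The family [0] replaces a family that is not square-summable, so that
    operators can be given by the formula for their coordinates. *)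
HB.lock Definition mkl2 (R : realType) (W : choiceType) (K : hilbertType R)
  (x : W -> K) : l2 W K := insubd 0 x.

Section L2Tools.
Variable R : realType.
Implicit Types K L : hilbertType R.
Implicit Types W V : choiceType.

Lemma l2_ext W K (x y : l2 W K) : (forall w, x w = y w) -> x = y.
Proof. by move=> xy; apply/val_inj/funext. Qed.

Lemma l2addE W K (x y : l2 W K) w : (x + y) w = x w + y w. Proof. by []. Qed.
Lemma l2subE W K (x y : l2 W K) w : (x - y) w = x w - y w. Proof. by []. Qed.
Lemma l2scaleE W K a (x : l2 W K) w : (a *: x) w = a *: x w. Proof. by []. Qed.

Lemma nrm_l2_sup W K (x : l2 W K) : nrm x ^+ 2 = sup (range (sqsum x)).
Proof. by apply: complexI; rewrite -innerE inner_l2E l2_innerE // l2P. Qed.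

Lemma sqsum_le_nrm W K (x : l2 W K) A : sqsum x A <= nrm x ^+ 2.
Proof. by rewrite nrm_l2_sup sqsum_le_sup // l2P. Qed.

Lemma nrm_l2_le W K (x : l2 W K) (M : R) : (forall A, sqsum x A <= M) -> nrm x ^+ 2 <= M.
Proof.
move=> xM; rewrite nrm_l2_sup; apply: ge_sup => [|_ [A _ <-]//].
by exists (sqsum x fset0), fset0.
Qed.

Lemma nrm_coord W K (x : l2 W K) w : nrm (x w) <= nrm x.
Proof.
rewrite -(@ler_pXn2r _ 2) ?nnegrE ?nrm_ge0 //.
by have := sqsum_le_nrm x [fset w]%fset; rewrite /sqsum big_seq_fset1.
Qed.

Lemma bl_coord W K (w : W) : bounded_linear (fun x : l2 W K => x w).
Proof. by apply: (@bl_intro _ _ _ _ 1) => // x; rewrite mul1r nrm_coord. Qed.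

Lemma l2_sumE W K I (r : seq I) (P : pred I) (F : I -> l2 W K) (w : W) :
  (\sum_(i <- r | P i) F i) w = \sum_(i <- r | P i) F i w.
Proof. exact: (bl_sum (bl_coord K w)). Qed.

Lemma mkl2E W K (x : W -> K) (M : R) : (forall A, sqsum x A <= M) ->
  forall w, mkl2 x w = x w.
Proof.
move=> xM w; have xs : x \in square_summable (K := K) by apply/asboolP; exists M.
by rewrite mkl2.unlock; have := val_insubd (0 : l2 W K) x; rewrite xs => /= ->.
Qed.

Lemma mkl2_op W V K L (Op : l2 W K -> V -> L) (M : R) : 0 <= M ->
  (forall x A, sqsum (Op x) A <= M ^+ 2 * nrm x ^+ 2) ->
  (forall x y w, Op (x + y) w = Op x w + Op y w) ->
  (forall a x w, Op (a *: x) w = a *: Op x w) ->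
  [/\ forall x w, mkl2 (Op x) w = Op x w,
    bounded_linear (fun x => mkl2 (Op x)) &
    forall x, nrm (mkl2 (Op x)) <= M * nrm x].
Proof.
move=> M0 OM OD OZ.
have E x w : mkl2 (Op x) w = Op x w by apply: (mkl2E (OM x)).
have B x : nrm (mkl2 (Op x)) <= M * nrm x.
  rewrite -(@ler_pXn2r _ 2) ?nnegrE ?mulr_ge0 ?nrm_ge0 // exprMn.
  apply: nrm_l2_le => A; rewrite (_ : l2fun _ = Op x) //.
  by apply/funext => w; apply: E.
split => //; apply: bl_intro B => [x y|a x]; apply: l2_ext => w.
- by rewrite l2funD fctE !E OD.
- by rewrite l2funZ fctE !E OZ.
Qed.

Lemma singleD W K (w : W) (k l : K) : single w (k + l) = single w k + single w l.
Proof. by apply: l2_ext => v; rewrite l2funD fctE /=; case: eqP; rewrite ?addr0. Qed.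

Lemma singleZ W K (w : W) (a : R[i]) (k : K) : single w (a *: k) = a *: single w k.
Proof. by apply: l2_ext => v; rewrite l2funZ fctE /=; case: eqP; rewrite ?scaler0. Qed.

Lemma nrm_single W K (w : W) (k : K) : nrm (single w k) = nrm k.
Proof.
apply/eqP; rewrite -(@eqrXn2 _ 2) ?nrm_ge0 // -!Re_inner inner_single /=.
by rewrite eqxx.
Qed.

Lemma bl_single W K (w : W) : bounded_linear (single w : K -> l2 W K).
Proof.
apply: (@bl_intro _ _ _ _ 1) => [x y|a x|x]; first exact: singleD.
  exact: singleZ.
by rewrite mul1r nrm_single.
Qed.

Lemma single_tens W K (w : W) (k : K) : single w k = tens (single w (1 : R[i])) k.
Proof. by apply: l2_ext => v /=; case: eqP; rewrite ?scale1r ?scale0r. Qed.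

Lemma single_total W K (x : l2 W K) :
  cspan [set y | exists w k, y = single w k] x.
Proof.
apply: orth_total => y Sy; apply: l2_ext => w.
apply: inner_self_eq0; rewrite -inner_single; apply: Sy.
by exists w, (y w).
Qed.

Lemma eq_on_single W K L (A B : l2 W K -> L) : bounded_linear A -> bounded_linear B ->
  (forall w k, A (single w k) = B (single w k)) -> forall x, A x = B x.
Proof.
move=> bA bB AB x; have h : forall y, [set y | exists w k, y = single w k] y -> A y = B y.
  by move=> _ [w [k ->]].
exact: (eq_on_cspan bA bB h (@single_total _ _ x)).
Qed.

Lemma tens_cspan W K (x : l2 W K) : cspan [set y | exists a k, y = tens a k] x.
Proof.
apply: (cspan_min _ _ (@single_total _ _ x)) => [|_ [w [k ->]]].
  exact: csub_cspan.
by apply: sub_cspan; exists (single w (1 : R[i])), k; rewrite -single_tens.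
Qed.

Lemma eq_on_tens W K L (A B : l2 W K -> L) : bounded_linear A -> bounded_linear B ->
  (forall a k, A (tens a k) = B (tens a k)) -> forall x, A x = B x.
Proof.
move=> bA bB AB x; have h : forall y, [set y | exists a k, y = tens a k] y -> A y = B y.
  by move=> _ [w [k ->]].
exact: (eq_on_cspan bA bB h (@tens_cspan _ _ x)).
Qed.

Lemma basisE W (w : W) (c : R[i]) : single w (c : R[i]) = c *: single w (1 : R[i]).
Proof. by rewrite -singleZ; congr single; rewrite -[LHS]mulr1. Qed.

(** [I (x) A], when [l2 W K] is read as the tensor product of [l2 W R[i]]
    and [K]. *)
Definition pw W K L (A : K -> L) (x : l2 W K) : l2 W L := mkl2 (fun w => A (x w)).

Lemma pw_spec W K L (A : K -> L) (M : R) : bounded_linear A -> 0 <= M ->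
  (forall k, nrm (A k) <= M * nrm k) ->
  [/\ forall (x : l2 W K) w, pw A x w = A (x w),
    bounded_linear (@pw W K L A) &
    forall x : l2 W K, nrm (pw A x) <= M * nrm x].
Proof.
move=> bA M0 AM; apply: mkl2_op => // [x S|x y w|a x w].
- apply: (@le_trans _ _ (M ^+ 2 * sqsum x S)).
    rewrite /sqsum mulr_sumr; apply: ler_sum => w _.
    by rewrite -exprMn ler_pXn2r ?nnegrE ?nrm_ge0 ?mulr_ge0 ?nrm_ge0.
  by rewrite ler_wpM2l ?sqr_ge0 // sqsum_le_nrm.
- by rewrite l2funD fctE (blD bA).
- by rewrite l2funZ fctE (blZ bA).
Qed.

Lemma pwE W K L (A : K -> L) : bounded_linear A ->
  forall (x : l2 W K) w, pw A x w = A (x w).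
Proof.
by move=> bA; have [M M0 AM] := bl_bound bA; case: (pw_spec W bA (ltW M0) AM).
Qed.

Lemma bl_pw W K L (A : K -> L) : bounded_linear A -> bounded_linear (@pw W K L A).
Proof.
by move=> bA; have [M M0 AM] := bl_bound bA; case: (pw_spec W bA (ltW M0) AM).
Qed.

Lemma nrm_pw W K L (A : K -> L) : bounded_linear A -> (forall k, nrm (A k) <= nrm k) ->
  forall (x : l2 W K), nrm (pw A x) <= nrm x.
Proof.
move=> bA A1 x; rewrite -[leRHS]mul1r.
have A1' k : nrm (A k) <= 1 * nrm k by rewrite mul1r.
by case: (pw_spec W bA ler01 A1').
Qed.

Lemma pw_single W K L (A : K -> L) : bounded_linear A ->
  forall (w : W) k, pw A (single w k) = single w (A k).
Proof.
move=> bA w k; apply: l2_ext => v; rewrite pwE //=.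
by case: eqP => // _; apply: bl0.
Qed.

Lemma pw_tens W K L (A : K -> L) : bounded_linear A ->
  forall (a : l2 W R[i]) k, pw A (tens a k) = tens a (A k).
Proof. by move=> bA a k; apply: l2_ext => v; rewrite pwE //= (blZ bA). Qed.

Lemma inner_pw W K L (A : K -> L) : bounded_linear A ->
  forall (x : l2 W K) (y : l2 W L), inner (pw A x) y = inner x (pw (adj A) y).
Proof.
move=> bA x y; apply: (@eq_on_single W K _ (fun x => inner (pw A x) y)
  (fun x => inner x (pw (adj A) y))); last 1 first.
- move=> w k; rewrite (pw_single bA) !inner_single (pwE (bl_adj bA)).
  exact: (adjP bA).
- exact: (bl_comp (bl_inner y) (bl_pw _ bA)).
- exact: bl_inner.
Qed.

Lemma tens_bl_l W K (k : K) : bounded_linear (fun a : l2 W R[i] => tens a k).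
Proof.
apply: (@bl_intro _ _ _ _ (nrm k)) => [x y|a x|x].
- by apply: l2_ext => w; exact: scalerDl.
- by apply: l2_ext => w; rewrite [RHS]scalerA.
- rewrite -(@ler_pXn2r _ 2) ?nnegrE ?mulr_ge0 ?nrm_ge0 // -Re_inner inner_tens.
  by rewrite !innerE -rmorphM exprMn /= mulrC.
Qed.

Definition diag W K (d : W -> R) (x : l2 W K) : l2 W K := mkl2 (fun w => (d w)%:C *: x w).

Lemma diag_spec W K (d : W -> R) : (forall w, 0 <= d w <= 1) ->
  [/\ forall (x : l2 W K) w, diag d x w = (d w)%:C *: x w,
    bounded_linear (@diag W K d) &
    forall x : l2 W K, nrm (diag d x) <= nrm x].
Proof.
move=> d1; pose Op (x : l2 W K) w := (d w)%:C *: x w.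
have [x S|x y w|a x w|E B N] := @mkl2_op W W K K Op 1 ler01.
- rewrite expr1n mul1r; apply: le_trans (sqsum_le_nrm x S); apply: ler_sum => w _.
  have /andP[d0 d1'] := d1 w; rewrite /Op nrm_real ger0_norm //.
  by rewrite ler_pXn2r ?nnegrE ?nrm_ge0 ?mulr_ge0 ?nrm_ge0 // ler_piMl ?nrm_ge0.
- by rewrite /Op l2funD fctE scalerDr.
- by rewrite /Op l2funZ fctE !scalerA mulrC.
by split=> // x; rewrite -[leRHS]mul1r; apply: N.
Qed.

Lemma diagE W K (d : W -> R) : (forall w, 0 <= d w <= 1) ->
  forall (x : l2 W K) w, diag d x w = (d w)%:C *: x w.
Proof. by move=> /(@diag_spec W K d)[]. Qed.

Lemma bl_diag W K (d : W -> R) : (forall w, 0 <= d w <= 1) ->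
  bounded_linear (@diag W K d).
Proof. by move=> /(@diag_spec W K d)[]. Qed.

Lemma nrm_diag W K (d : W -> R) : (forall w, 0 <= d w <= 1) ->
  forall x : l2 W K, nrm (diag d x) <= nrm x.
Proof. by move=> /(@diag_spec W K d)[]. Qed.

Lemma diag_single W K (d : W -> R) : (forall w, 0 <= d w <= 1) ->
  forall w (k : K), diag d (single w k) = (d w)%:C *: single w k.
Proof.
move=> d1 w k; apply: l2_ext => v; rewrite diagE // l2funZ fctE /=.
by case: eqP => [->//|_]; rewrite !scaler0.
Qed.

(** For uniformly bounded operators, the vectors at which they converge form a
    closed subspace. *)
Lemma cvg_total K L T (F : set_system T) {FF : Filter F} (A : T -> K -> L) (B : K -> L)
  (M : R) (S : set K) :
  (forall t, bounded_linear (A t)) -> bounded_linear B ->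
  (\forall t \near F, forall x, nrm (A t x) <= M * nrm x) ->
  (forall x, S x -> A t x @[t --> F] --> B x) ->
  forall x, cspan S x -> A t x @[t --> F] --> B x.
Proof.
move=> bA bB AM SF x; apply: (@cspan_min _ K S [set x | A t x @[t --> F] --> B x]) => //.
split=> [|y z /= Ay Az|a y /= Ay|y /= Ay].
- rewrite /= (bl0 bB) (_ : (fun t => A t 0) = cst 0); first exact: cvg_cst.
  by apply/funext => t; exact: bl0 (bA t).
- rewrite (blD bB) (_ : (fun t => A t (y + z)) = (fun t => A t y + A t z)).
    exact: cvgD.
  by apply/funext => t; exact: blD (bA t) _ _.
- rewrite (blZ bB) (_ : (fun t => A t (a *: y)) = (fun t => a *: A t y)).
    exact: cvgZr.
  by apply/funext => t; exact: blZ (bA t) _ _.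
apply/cvg_nrmP => e e0; have [N N0 BN] := bl_bound bB.
have c0 : 0 < `|M| + N + 1 by rewrite addrC ltr_pwDl // addr_ge0 // ltW.
have [z Az yz] := Ay _ (divr_gt0 e0 (mulr_gt0 (ltr0n R 2) c0)).
have e2 : 0 < e / 2 by rewrite divr_gt0.
move/cvg_nrmP : Az => /(_ _ e2) Az.
apply: filterS2 AM Az => t AM Az.
have -> : B y - A t y = B (y - z) + (B z - A t z) + A t (z - y).
  by rewrite (blB bB) (blB (bA t)) !subrKA.
apply: le_trans (ler_nrmD _ _) _.
have h1 : nrm (A t (z - y)) <= `|M| * nrm (y - z).
  by rewrite nrm_distC (le_trans (AM _)) // ler_wpM2r ?nrm_ge0 ?ler_norm.
have h2 := BN (y - z).
have := ler_nrmD (B (y - z)) (B z - A t z).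
move: yz; rewrite ltr_pdivlMr ?mulr_gt0 // => yz.
have := nrm_ge0 (y - z); have := normr_ge0 M; nra.
Qed.

Lemma diag_cvg W K T (F : set_system T) {FF : Filter F} (d : T -> W -> R) (x : l2 W K) :
  (forall t w, 0 <= d t w <= 1) -> (forall w, d t w @[t --> F] --> (1 : R)) ->
  diag (d t) x @[t --> F] --> x.
Proof.
move=> d1 dF.
apply: (@cvg_total _ _ _ _ _ (fun t => diag (d t)) idfun 1 _ _ _ _ _ _ (@single_total _ _ x)).
- by move=> t; apply: bl_diag.
- exact: bl_id.
- by apply: nearW => t y; rewrite mul1r nrm_diag.
move=> _ [w [k ->]] /=; apply/cvg_nrmP => e e0.
have k0 : 0 < nrm k + 1 by rewrite ltr_wpDl ?nrm_ge0.
move/cvgrPdist_le : (dF w) => /(_ _ (divr_gt0 e0 k0)); apply: filterS => t h.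
rewrite diag_single // -{1}[single w k]scale1r -scalerBl -(rmorph1 (real_complex R)).
rewrite -rmorphB nrm_real nrm_single; move: h; rewrite ler_pdivlMr //.
by apply: le_trans; rewrite ler_wpM2l ?lerDl.
Qed.

Lemma sum_uniq_le_nrm W K (x : l2 W K) (l : seq W) : uniq l ->
  \sum_(w <- l) nrm (x w) ^+ 2 <= nrm x ^+ 2.
Proof.
move=> ul; apply: le_trans (sqsum_le_nrm x [fset w in l]%fset).
rewrite le_eqVlt; apply/orP; left; apply/eqP; apply: perm_big.
by apply: uniq_perm => // w; rewrite !inE.
Qed.

Lemma l2_fin_single (I : finType) K (x : l2 I K) : x = \sum_i single i (x i).
Proof.
apply: l2_ext => j; rewrite l2_sumE (bigD1 j) //= eqxx big1 ?addr0 // => i ij.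
by rewrite eq_sym (negbTE ij).
Qed.

Lemma inner_fin (I : finType) K (x y : l2 I K) : inner x y = \sum_i inner (x i) (y i).
Proof.
rewrite {1}(l2_fin_single x) inner_suml; apply: eq_bigr => i _.
by rewrite inner_single.
Qed.

(** The formula only involves the partial inverse [t] of an injection [s] of [W]
    into [V]; this is the isometry which sends the basis vector at [w] to the
    one at [s w]. *)
Definition reix W V K (t : V -> option W) (x : l2 W K) : l2 V K :=
  mkl2 (fun v => oapp x 0 (t v)).

Section Reindex.
Variables (W V : choiceType) (s : W -> V) (t : V -> option W).
Hypotheses (ts : forall w, t (s w) = Some w) (st : ocancel t s).
Variable K : hilbertType R.

Lemma reix_spec :
  [/\ forall (x : l2 W K) v, reix t x v = oapp x 0 (t v),
    bounded_linear (@reix W V K t) &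
    forall x : l2 W K, nrm (reix t x) <= nrm x].
Proof.
pose Op (x : l2 W K) v := oapp x 0 (t v).
have [x A|x y v|a x v|E B N] := @mkl2_op W V K K Op 1 ler01.
- rewrite expr1n mul1r.
  have E (l : seq V) : \sum_(v <- l) nrm (Op x v) ^+ 2 = \sum_(w <- pmap t l) nrm (x w) ^+ 2.
    elim: l => [|v l IH]; first by rewrite !big_nil.
    rewrite big_cons IH /Op /=; case: (t v) => [w|] /=; first by rewrite big_cons.
    by rewrite nrm0 expr0n add0r.
  by rewrite /sqsum E sum_uniq_le_nrm // (pmap_uniq st) // fset_uniq.
- by rewrite /Op; case: (t v) => //=; rewrite addr0.
- by rewrite /Op; case: (t v) => //=; rewrite scaler0.
by split=> // x; rewrite -[leRHS]mul1r; apply: N.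
Qed.

Lemma reixE (x : l2 W K) v : reix t x v = oapp x 0 (t v).
Proof. by case: reix_spec. Qed.

Lemma bl_reix : bounded_linear (@reix W V K t).
Proof. by case: reix_spec. Qed.

Lemma reix_single w (k : K) : reix t (single w k) = single (s w) k.
Proof.
apply: l2_ext => v; rewrite reixE /=; case E: (t v) => [u|] /=.
  have := st v; rewrite E /= => <-.
  by rewrite (inj_eq (can_inj (g := fun v => odflt u (t v)) _)) // => z; rewrite ts.
by case: eqP => // vE; move: E; rewrite vE ts.
Qed.

Lemma adj_reixE (y : l2 V K) w : adj (@reix W V K t) y w = y (s w).
Proof.
apply: inner_inj => z; rewrite -inner_single -(adjP bl_reix) reix_single.
exact: inner_single.
Qed.

End Reindex.

Lemma reix_tens W V K (s : W -> V) (t : V -> option W) (st : ocancel t s)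
  (a : l2 W R[i]) (k : K) : reix t (tens a k) = tens (reix t a) k.
Proof.
apply: l2_ext => v; rewrite (reixE st) /= (reixE st).
by case: (t v) => //=; rewrite scale0r.
Qed.

End L2Tools.

(** * Words and creation operators *)

Section Words.
Variables (R : realType) (n : nat).
Notation word := (seq 'I_n).
Implicit Types (w v : word) (K H : hilbertType R).

Definition words (m : nat) : seq word :=
  flatten [seq [seq tval t | t <- enum {: k.-tuple 'I_n}] | k <- iota 0 m].

Lemma mem_words m w : (w \in words m) = (size w < m)%N.
Proof.
apply/flatten_mapP/idP => [[k]|wm].
  by rewrite mem_iota => km /mapP[t _ ->]; rewrite size_tuple.
exists (size w); first by rewrite mem_iota.
by apply/mapP; exists (in_tuple w); rewrite ?mem_enum.
Qed.

Lemma words_uniq m : uniq (words m).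
Proof.
rewrite /words; elim: m => [//|m IH].
rewrite -addn1 iotaD map_cat flatten_cat cat_uniq IH /= cats0 add0n.
rewrite map_inj_uniq ?enum_uniq ?andbT; last exact: val_inj.
apply/hasPn => w /mapP[t _ ->]; rewrite mem_words -leqNgt size_tuple //.
Qed.

Lemma sum_words (V : nmodType) m (F : word -> V) :
  \sum_(k < m) \sum_(al : k.-tuple 'I_n) F al = \sum_(w <- words m) F w.
Proof.
rewrite /words big_flatten big_map -(big_mkord xpredT (fun k => \sum_(al : k.-tuple 'I_n) F al)).
rewrite /index_iota subn0; apply: eq_bigr => k _.
by rewrite big_map big_enum.
Qed.

Lemma sum_words_cons (V : nmodType) m (F : word -> V) :
  \sum_(w <- words m.+1) F w = F [::] + \sum_(i < n) \sum_(w <- words m) F (i :: w).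
Proof.
rewrite (@perm_big _ _ _ _ _ ([::] :: [seq i :: w | i <- enum 'I_n, w <- words m])) /=.
  by rewrite big_cons big_allpairs_dep big_enum.
apply: uniq_perm; first exact: words_uniq.
  rewrite /= allpairs_uniq ?enum_uniq ?words_uniq ?andbT //; last by move=> [i w] [j v] _ _ [-> ->].
  by apply/negP => /allpairsP[[i w] []].
move=> w; rewrite mem_words inE; case: w => [//|i w] /=.
rewrite ltnS -mem_words; apply/idP/allpairsP => [wm|[[j v] /= [_ vm [_ ->]]]//].
by exists (i, w); rewrite mem_enum.
Qed.

Lemma sum_words_rcons (V : nmodType) m (F : word -> V) :
  \sum_(w <- words m.+1) F w = F [::] + \sum_(i < n) \sum_(w <- words m) F (rcons w i).
Proof.
have rv k (G : word -> V) : \sum_(w <- words k) G w = \sum_(w <- words k) G (rev w).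
  rewrite -[RHS](big_map rev xpredT G); apply: perm_big; apply: uniq_perm.
  - exact: words_uniq.
  - by rewrite (map_inj_uniq (can_inj revK)) words_uniq.
  move=> w; rewrite -{2}(revK w) (mem_map (can_inj revK)) !mem_words size_rev //.
rewrite rv sum_words_cons; congr (_ + _); apply: eq_bigr => i _.
by rewrite rv; apply: eq_bigr => w _; rewrite rev_cons revK.
Qed.

Lemma sum_words_delta (V : nmodType) m (F : word -> V) v :
  (forall w, w != v -> F w = 0) ->
  \sum_(w <- words m) F w = if (size v < m)%N then F v else 0.
Proof.
move=> F0; rewrite -mem_words; case: ifPn => vm; last first.
  by rewrite big_seq big1 // => w wm; apply: F0; apply: contraNneq vm => <-.
by rewrite (bigD1_seq v) ?words_uniq //= big1 ?addr0.
Qed.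

Definition uncons (i : 'I_n) w : option word :=
  if w is j :: v then (if j == i then Some v else None) else None.
Definition unrcons (i : 'I_n) w : option word := omap rev (uncons i (rev w)).

Lemma unconsK i w : uncons i (i :: w) = Some w.
Proof. by rewrite /= eqxx. Qed.

Lemma uncons_ocancel i : ocancel (uncons i) (cons i).
Proof. by case=> //= j v; case: eqP => //= ->. Qed.

Lemma unrcons_rcons i w j : unrcons i (rcons w j) = if j == i then Some w else None.
Proof. by rewrite /unrcons rev_rcons /=; case: eqP => //= _; rewrite revK. Qed.

Lemma unrconsK i w : unrcons i (rcons w i) = Some w.
Proof. by rewrite unrcons_rcons eqxx. Qed.

Lemma unrcons_ocancel i : ocancel (unrcons i) (rcons^~ i).
Proof. by elim/last_ind => //= v j _; rewrite unrcons_rcons; case: eqP => //= ->. Qed.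

(** The left and right creations, amplified by the identity of [K]. *)
Definition Lop K (i : 'I_n) : l2 word K -> l2 word K := reix (uncons i).
Definition Rop K (i : 'I_n) : l2 word K -> l2 word K := reix (unrcons i).
Arguments Lop : clear implicits.
Arguments Rop : clear implicits.

Lemma bl_Lop K i : bounded_linear (Lop K i).
Proof. exact: bl_reix (@uncons_ocancel i) K. Qed.

Lemma bl_Rop K i : bounded_linear (Rop K i).
Proof. exact: bl_reix (@unrcons_ocancel i) K. Qed.

Lemma Lop_nil K i x : Lop K i x [::] = 0.
Proof. by rewrite /Lop (reixE (@uncons_ocancel i)). Qed.

Lemma Lop_cons K i x j w : Lop K i x (j :: w) = if j == i then x w else 0.
Proof. by rewrite /Lop (reixE (@uncons_ocancel i)) /=; case: eqP. Qed.

Lemma Rop_nil K i x : Rop K i x [::] = 0.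
Proof. by rewrite /Rop (reixE (@unrcons_ocancel i)). Qed.

Lemma Rop_rcons K i x j w : Rop K i x (rcons w j) = if j == i then x w else 0.
Proof. by rewrite /Rop (reixE (@unrcons_ocancel i)) unrcons_rcons; case: eqP. Qed.

Lemma Rop_tens K i (a : l2 word R[i]) (k : K) : Rop K i (tens a k) = tens (Rop _ i a) k.
Proof. exact: reix_tens (@unrcons_ocancel i) a k. Qed.

Lemma basis_op_uniq (s : word -> word) (A : l2 word R[i] -> l2 word R[i]) :
  bounded_linear A -> (forall w, A (basis R w) = basis R (s w)) -> basis_op s = A.
Proof.
move=> bA As; have [bB Bs] : [set L | bounded_linear L /\
    forall al, L (basis R al) = basis R (s al)] (basis_op s).
  by apply: xgetPex; exists A.
apply/funext; apply: eq_on_single => // w c.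
by rewrite (basisE w c) (blZ bB) (blZ bA) -/(basis R w) Bs As.
Qed.

Lemma left_creationE i : left_creation i = Lop R[i] i.
Proof.
apply: basis_op_uniq => [|w]; first exact: bl_Lop.
exact: reix_single (@unconsK i) (@uncons_ocancel i) _ _ _.
Qed.

Lemma right_creationE i : right_creation i = Rop R[i] i.
Proof.
apply: basis_op_uniq => [|w]; first exact: bl_Rop.
exact: reix_single (@unrconsK i) (@unrcons_ocancel i) _ _ _.
Qed.

Definition coord H (i : 'I_n) (u : l2 'I_n H) : H := u i.

(** The row of right creations. It appends a last letter to each word, which
    makes it an isometry onto the families vanishing at the empty word. *)
Definition Rrow H (x : l2 word (l2 'I_n H)) : l2 word H :=
  \sum_i Rop H i (pw (@coord H i) x).

Lemma bl_Rrow H : bounded_linear (@Rrow H).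
Proof.
rewrite (_ : @Rrow H = \sum_i (Rop H i \o pw (@coord H i))).
  by apply: bl_sumf => i; apply: (bl_comp (bl_Rop H i) (bl_pw _ (bl_coord H i))).
by apply/funext => x; rewrite fct_sumE.
Qed.

Lemma Rrow_nil H x : @Rrow H x [::] = 0.
Proof. by rewrite l2_sumE big1 // => i _; rewrite Rop_nil. Qed.

Lemma Rrow_rcons H x w i : @Rrow H x (rcons w i) = x w i.
Proof.
rewrite l2_sumE (bigD1 i) //= Rop_rcons eqxx pwE; last exact: bl_coord.
by rewrite big1 ?addr0 // => j ji; rewrite Rop_rcons eq_sym (negbTE ji).
Qed.

Lemma Rrow_single H w i (h : H) : Rrow (single w (single i h)) = single (rcons w i) h.
Proof.
apply: l2_ext; elim/last_ind => [|v j _].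
  by rewrite Rrow_nil /=; case: eqP => // /(congr1 size); rewrite size_rcons.
rewrite Rrow_rcons /= eqseq_rcons.
by case: (v == w) => //=.
Qed.

Lemma adj_RrowE H (y : l2 word H) w i : adj (@Rrow H) y w i = y (rcons w i).
Proof.
apply: inner_inj => z; rewrite -[LHS]inner_single -[LHS]inner_single -(adjP (@bl_Rrow H)).
by rewrite Rrow_single inner_single.
Qed.

Lemma adj_RrowK H (x : l2 word (l2 'I_n H)) : adj (@Rrow H) (Rrow x) = x.
Proof. by apply: l2_ext => w; apply: l2_ext => i; rewrite adj_RrowE Rrow_rcons. Qed.

Lemma nrm_Rrow H (x : l2 word (l2 'I_n H)) : nrm (Rrow x) = nrm x.
Proof.
apply/eqP; rewrite -(@eqrXn2 _ 2) ?nrm_ge0 // -!Re_inner (adjP (@bl_Rrow H)).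
by rewrite adj_RrowK.
Qed.

Lemma RrowK H (y : l2 word H) : Rrow (adj (@Rrow H) y) = y - single [::] (y [::]).
Proof.
apply: l2_ext; elim/last_ind => [|w i _].
  by rewrite Rrow_nil l2funB !fctE /= subrr.
rewrite Rrow_rcons adj_RrowE l2funB !fctE [X in _ - X](_ : _ = 0) ?subr0 //.
by case: w.
Qed.

Lemma nrm_adj_Rrow H (y : l2 word H) :
  nrm (adj (@Rrow H) y) ^+ 2 = nrm y ^+ 2 - nrm (y [::]) ^+ 2.
Proof.
rewrite -nrm_Rrow RrowK nrmB_sqr nrm_single Re_innerC inner_single Re_inner; ring.
Qed.

(** [e_w |-> r^|w| e_w]: on Fourier coefficients, the passage from a tuple
    [Y] to [r Y]. *)
Definition dil K (r : R) : l2 word K -> l2 word K := diag (fun w => r ^+ size w).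
Definition trunc K (m : nat) : l2 word K -> l2 word K :=
  diag (fun w => (size w < m)%:R).

Lemma dil_itv (r : R) : 0 <= r <= 1 -> forall w, 0 <= r ^+ size w <= 1.
Proof. by move=> /andP[r0 r1] w; rewrite exprn_ge0 //= exprn_ile1. Qed.

Lemma trunc_itv m w : 0 <= ((size w < m)%:R : R) <= 1.
Proof. by rewrite ler0n lern1; case: (_ < _)%N. Qed.

Lemma truncE K m (x : l2 word K) w : trunc m x w = if (size w < m)%N then x w else 0.
Proof.
rewrite /trunc diagE; last exact: trunc_itv.
by case: ifP => _; rewrite ?scale1r ?scale0r.
Qed.

Lemma trunc_sum K m (x : l2 word K) : trunc m x = \sum_(w <- words m) single w (x w).
Proof.
apply: l2_ext => v; rewrite truncE l2_sumE (@sum_words_delta _ m _ v) /= ?eqxx //.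
by move=> w wv; rewrite eq_sym (negbTE wv).
Qed.

Lemma trunc_cvg K (x : l2 word K) : (fun m => trunc m x) @ \oo --> x.
Proof.
apply: diag_cvg => [t w|w]; first exact: trunc_itv.
by apply: cvg_near_cst; exists (size w).+1 => // m /= wm; rewrite wm.
Qed.

End Words.

Arguments Lop {R n} K i.
Arguments Rop {R n} K i.

(** * Tensor products with a subspace of Fock space *)

HB.lock Definition projN (R : realType) (n : nat) (N : set (l2 (seq 'I_n) R[i]))
  (K : hilbertType R) : l2 (seq 'I_n) K -> l2 (seq 'I_n) K :=
  proj (tensor_space N setT).
Arguments projN {R n} N K x.

Section TensorTools.
Variables (R : realType) (n : nat).
Notation word := (seq 'I_n).
Notation H2 := (l2 word R[i]).
Implicit Types K L : hilbertType R.

Lemma at_left1_itv : \forall r \near (1 : R)^'-, 0 < r < 1.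
Proof.
near=> r; apply/andP; split; near: r; first exact: nbhs_left_gt.
exact: nbhs_left_lt.
Unshelve. all: by end_near. Qed.

Lemma cvg_at_left1 (p : nat) : (fun r : R => r ^+ p) @ (1 : R)^'- --> (1 : R).
Proof.
elim: p => [|p IH]; first exact: cvg_cst.
rewrite -[X in _ --> X]mulr1; under eq_fun do rewrite exprS.
by apply: cvgM => //; apply: cvg_at_left_filter; exact: cvg_id.
Qed.

Lemma dil_cvg K (x : l2 word K) : (fun r => dil r x) @ (1 : R)^'- --> x.
Proof.
pose d (r : R) (w : word) := if 0 < r < 1 then r ^+ size w else 0.
have : (fun r => diag (d r) x) @ (1 : R)^'- --> x.
  apply: diag_cvg => [r w|w].
    rewrite /d; case: ifP => [/andP[/ltW r0 /ltW r1]|_]; last by rewrite lexx ler01.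
    by rewrite exprn_ge0 // exprn_ile1.
  have /cvgrPdist_le h := @cvg_at_left1 (size w).
  apply/cvgrPdist_le => e e0; apply: filterS2 at_left1_itv (h e e0) => r r1.
  by rewrite /d r1.
move=> /cvg_nrmP h; apply/cvg_nrmP => e e0.
apply: filterS2 at_left1_itv (h e e0) => r r1.
by rewrite /dil (_ : d r = (fun w => r ^+ size w)) //; apply/funext => w; rewrite /d r1.
Qed.

Lemma tensor_opE K L (B : H2 -> H2) (A : K -> L) (V : l2 word K -> l2 word L) :
  bounded_linear V -> (forall a k, V (tens a k) = tens (B a) (A k)) -> tensor_op B A = V.
Proof.
move=> bV Vt; have [bU Ut] : [set V | bounded_linear V /\
    forall a k, V (tens a k) = tens (B a) (A k)] (tensor_op B A).
  by apply: xgetPex; exists V.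
by apply/funext; apply: eq_on_tens => // a k; rewrite Vt Ut.
Qed.

Lemma tensor_op_id K L (A : K -> L) : bounded_linear A ->
  tensor_op idfun A = @pw R word K L A.
Proof. by move=> bA; apply: tensor_opE => [|a k]; [exact: bl_pw|exact: pw_tens]. Qed.

Section Subspace.
Variable N : set H2.
Hypothesis cN : closed_subspace N.

Notation projN := (projN N).

Lemma projNE K : projN K = proj (tensor_space N setT).
Proof. by rewrite projN.unlock. Qed.

Lemma csub_tensor K (D : set K) : closed_subspace (tensor_space N D).
Proof. exact: csub_cspan. Qed.

Lemma tensor_in K (D : set K) a d : N a -> D d -> tensor_space N D (tens a d).
Proof. by move=> Na Dd; apply: sub_cspan; exists a => //; exists d. Qed.

Lemma bl_projN K : bounded_linear (projN K).
Proof. by rewrite projNE; exact: bl_proj (csub_tensor _). Qed.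

Lemma projN_in K x : tensor_space N setT (projN K x).
Proof. by rewrite projNE; exact: proj_in (csub_tensor _) _. Qed.

Lemma projN_tens K a k : projN K (tens a k) = tens (proj N a) k.
Proof.
rewrite projNE; apply: (proj_uniq (csub_tensor _)); first by apply: tensor_in => //; exact: proj_in.
rewrite -(blB (tens_bl_l _ k)); apply: orth_cspan => _ [b Nb [l _ <-]].
by rewrite inner_tens (proj_orth cN) // mul0r.
Qed.

Lemma projN_pw K L (A : K -> L) : bounded_linear A ->
  forall x, projN L (pw A x) = pw A (projN K x).
Proof.
move=> bA; have bp := bl_pw word bA.
apply: (@eq_on_tens _ _ _ _ (projN L \o pw A) (pw A \o projN K)) => [||a k] /=.
- exact: (bl_comp (@bl_projN L) bp).
- exact: (bl_comp bp (@bl_projN K)).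
- by rewrite pw_tens // !projN_tens pw_tens.
Qed.

Lemma projN_idem K x : projN K (projN K x) = projN K x.
Proof. by rewrite projNE; exact: proj_idem (csub_tensor _) _. Qed.

Lemma inner_projN K x y : inner (projN K x) y = inner x (projN K y).
Proof. by rewrite projNE; exact: inner_proj (csub_tensor _) _ _. Qed.

Lemma nrm_projN K x : nrm (projN K x) <= nrm x.
Proof. by rewrite projNE; exact: nrm_proj (csub_tensor _) _. Qed.

Lemma projN_fix K (x : l2 word K) :
  (forall a k, orth N a -> inner (tens a k) x = 0) -> projN K x = x.
Proof.
move=> x0; apply/eqP; rewrite eq_sym -subr_eq0; apply/eqP; apply: tens_total => a k.
rewrite innerBr -inner_projN projN_tens -innerBl -(blB (tens_bl_l _ k)).
by apply: x0; exact: proj_orth.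
Qed.

(** The projections [P_N (x) I] and [I (x) P_D] commute, so that their
    ranges intersect in [N (x) D]. *)
Lemma tensor_spaceP K (D : set K) (cD : closed_subspace D) (x : l2 word K) :
  tensor_space N D x <-> projN K x = x /\ forall w, D (x w).
Proof.
split=> [Dx|[xx Dx]].
  split.
    rewrite projNE; apply: (proj_id (csub_tensor _)).
    apply: (cspan_min _ _ Dx) => [|_ [a Na [d Dd <-]]]; first exact: csub_tensor.
    exact: tensor_in.
  move=> w; apply: (@map_cspan _ _ _ (fun x : l2 word K => x w) _ _ (bl_coord K w) cD _ _ Dx).
  by move=> _ [a Na [d Dd <-]] /=; apply: (csubZ cD).
have bD := bl_proj cD.
have -> : x = pw (proj D) (projN K x).
  by rewrite xx; apply: l2_ext => w; rewrite pwE // (proj_id cD).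
apply: (@map_cspan _ _ _ (pw (proj D)) _ _ (bl_pw word bD) (csub_tensor _) _ _
  (@projN_in _ x)).
by move=> _ [a Na [d _ <-]]; rewrite pw_tens //; apply: tensor_in => //; exact: proj_in.
Qed.

(* [N] is coinvariant under the right creations, hence so is [N (x) K]. *)
Hypothesis RN : forall i a, orth N a -> orth N (Rop R[i] i a).

Lemma proj_Rop i a : proj N (Rop _ i (proj N a)) = proj N (Rop _ i a).
Proof.
apply/eqP; rewrite eq_sym -subr_eq0 -(blB (bl_proj cN)) -(blB (bl_Rop R[i] i)).
apply/eqP; apply: (proj_uniq cN); first exact: csub0.
rewrite subr0; apply: RN; exact: proj_orth.
Qed.

Lemma projN_Rop K i x : projN K (Rop K i (projN K x)) = projN K (Rop K i x).
Proof.
have bP := @bl_projN K; have bR := bl_Rop K i.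
apply: (@eq_on_tens _ _ _ _ (projN K \o (Rop K i \o projN K)) (projN K \o Rop K i)) => [||a k] /=.
- exact: (bl_comp bP (bl_comp bR bP)).
- exact: (bl_comp bP bR).
- by rewrite projN_tens !Rop_tens !projN_tens proj_Rop.
Qed.

Lemma projN_Rrow K x : projN K (Rrow (projN (l2 'I_n K) x)) = projN K (Rrow x).
Proof.
rewrite /Rrow !(bl_sum (@bl_projN K)); apply: eq_bigr => i _.
rewrite -(projN_pw (bl_coord K i)).
exact: projN_Rop.
Qed.

Lemma tensor_op_Wop K L (r : R) i (A : K -> L) : bounded_linear A ->
  tensor_op (r%:C *: Wop N i) A = (fun x => r%:C *: projN L (Rop L i (pw A x))).
Proof.
move=> bA; apply: tensor_opE => [|a k].
  exact: (bl_scalef _ (bl_comp (@bl_projN L) (bl_comp (bl_Rop L i) (bl_pw word bA)))).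
rewrite pw_tens // Rop_tens projN_tens -(blZ (tens_bl_l _ (A k))).
by rewrite [in RHS]fctE /Wop /= right_creationE.
Qed.

End Subspace.
End TensorTools.

(** * The linear system attached to a row contraction *)

(** The blocks of the Julia operator [(X', Ds; Dl, -X)] from the sum of [H]
    and [G] to the sum of [G] and [H], with the identities which make it
    unitary. Here [X'] is the adjoint of [X], and [Ds], [Dl] are its two defect
    operators. *)
Record colligation (R : realType) (G H : hilbertType R)
    (X : G -> H) (X' : H -> G) (Ds : G -> G) (Dl : H -> H) : Prop := Colligation {
  col_bX : bounded_linear X;
  col_bX' : bounded_linear X';
  col_bDs : bounded_linear Ds;
  col_bDl : bounded_linear Dl;
  col_X1' : forall h, nrm (X' h) <= nrm h;
  col_adjX : adj X = X';
  col_adjX' : adj X' = X;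
  col_adjDs : adj Ds = Ds;
  col_adjDl : adj Dl = Dl;
  col_sqrDs : forall u, Ds (Ds u) = u - X' (X u);
  col_sqrDl : forall h, Dl (Dl h) = h - X (X' h);
  col_XDs : forall u, X (Ds u) = Dl (X u);
  col_X'Dl : forall h, X' (Dl h) = Ds (X' h)
}.

Lemma contraction_colligation (R : realType) (G H : hilbertType R) (X : G -> H) :
  bounded_linear X -> (forall u, nrm (X u) <= nrm u) ->
  colligation X (adj X) (defect_of X) (codefect_of X).
Proof.
move=> bX X1; split.
- exact: bX.
- exact: bl_adj bX.
- exact: bl_defect bX X1.
- exact: bl_codefect bX X1.
- exact: nrm_adj_contr bX X1.
- by [].
- exact: adjK bX.
- exact: adj_uniq (bl_defect bX X1) (selfadj_defect bX X1).
- exact: adj_uniq (bl_codefect bX X1) (selfadj_codefect bX X1).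
- exact: defect_sqr bX X1.
- exact: codefect_sqr bX X1.
- exact: defect_intertwine bX X1.
- exact: codefect_intertwine bX X1.
Qed.

Section System.
Variables (R : realType) (n : nat) (H : hilbertType R).
Notation word := (seq 'I_n).
Notation G := (l2 'I_n H).
Variables (X : G -> H) (X' : H -> G) (Ds : G -> G) (Dl : H -> H).
Hypothesis col : colligation X X' Ds Dl.

Let bX := col_bX col.
Let bX' := col_bX' col.
Let bDs := col_bDs col.
Let bDl := col_bDl col.
Let X1' := col_X1' col.
Let adjX := col_adjX col.
Let adjX' := col_adjX' col.
Let adjDs := col_adjDs col.
Let adjDl := col_adjDl col.
Let sqrDs := col_sqrDs col.
Let sqrDl := col_sqrDl col.
Let XDs := col_XDs col.
Let X'Dl := col_X'Dl col.

(** The Julia operator is isometric, hence so is its amplification. *)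
Lemma julia_pw (y : l2 word H) (x : l2 word G) :
  nrm (pw X' y + pw Ds x) ^+ 2 + nrm (pw Dl y - pw X x) ^+ 2 = nrm y ^+ 2 + nrm x ^+ 2.
Proof.
have DsE : pw Ds (pw Ds x) = x - pw X' (pw X x).
  apply: l2_ext => w.
  by rewrite l2subE (pwE bDs) (pwE bDs) (pwE bX') (pwE bX) sqrDs.
have DlE : pw Dl (pw Dl y) = y - pw X (pw X' y).
  apply: l2_ext => w.
  by rewrite l2subE (pwE bDl) (pwE bDl) (pwE bX) (pwE bX') sqrDl.
have XD : pw X (pw Ds x) = pw Dl (pw X x).
  by apply: l2_ext => w; rewrite (pwE bX) (pwE bDs) (pwE bDl) (pwE bX) XDs.
have e1 : nrm (pw Ds x) ^+ 2 = nrm x ^+ 2 - nrm (pw X x) ^+ 2.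
  rewrite -!Re_inner (inner_pw bDs) adjDs DsE innerBr (inner_pw bX) adjX.
  by case: (inner x x) (inner x (pw X' (pw X x))) => a b [].
have e2 : nrm (pw Dl y) ^+ 2 = nrm y ^+ 2 - nrm (pw X' y) ^+ 2.
  rewrite -!Re_inner (inner_pw bDl) adjDl DlE innerBr (inner_pw bX') adjX'.
  by case: (inner y y) (inner y (pw X (pw X' y))) => a b [].
have e3 : inner (pw X' y) (pw Ds x) = inner (pw Dl y) (pw X x).
  by rewrite (inner_pw bX') adjX' (inner_pw bDl) adjDl XD.
rewrite nrmD_sqr nrmB_sqr e1 e2 e3.
move: (nrm x ^+ 2) (nrm y ^+ 2) (nrm (pw X x) ^+ 2) (nrm (pw X' y) ^+ 2) => a b c d.
by move: (complex.Re _ *+ 2) => e; ring.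
Qed.

(** The damped linear system of the Julia operator: the state at the empty word
    is [h], and the state at [rcons w i] is [r] times the [i]-th component of
    [X' (y w) + Ds (x w)]. For [r < 1] a Neumann series solves it;
    without damping the states need not be square-summable, and only the outputs
    are. *)
Definition is_state (r : R) (h : H) (x : l2 word G) (y : l2 word H) :=
  y = r%:C *: Rrow (pw X' y + pw Ds x) + single [::] h.

Lemma state_exists r h x : 0 <= r < 1 -> exists y, is_state r h x y.
Proof.
move=> r01; have /andP[r0 r1] := r01.
pose C y := r%:C *: Rrow (pw X' y) : l2 word H.
have bC : bounded_linear C.
  exact: (bl_scalef _ (bl_comp (@bl_Rrow R n H) (bl_pw word bX'))).
have [|y yE] := @neumann _ _ C r (r%:C *: Rrow (pw Ds x) + single [::] h) bC r01.
  move=> y; rewrite /C nrm_real ger0_norm // ler_wpM2l // nrm_Rrow.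
  exact: nrm_pw.
exists y; rewrite /is_state (blD (@bl_Rrow R n H)) scalerDr -addrA.
exact: yE.
Qed.

Lemma is_stateB r h x y h' x' y' : is_state r h x y -> is_state r h' x' y' ->
  is_state r (h - h') (x - x') (y - y').
Proof.
move=> yE yE'; rewrite /is_state {1}yE {1}yE' opprD addrACA -scalerBr.
rewrite -(blB (@bl_Rrow R n H)) -(blB (@bl_single R word H [::])).
by rewrite (blB (bl_pw word bX')) (blB (bl_pw word bDs)) opprD addrACA.
Qed.

(** Energy balance: the Julia operator and [Rrow] are isometries, so that the
    output has at most the energy of the initial state and of the input. *)
Lemma state_energy r h x y : 0 <= r <= 1 -> is_state r h x y ->
  nrm (pw Dl y - pw X x) ^+ 2 <= nrm h ^+ 2 + nrm x ^+ 2.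
Proof.
move=> /andP[r0 r1] yE; have := julia_pw y x.
set q := pw X' y + pw Ds x in yE *; set t := pw Dl y - pw X x.
have -> : nrm y ^+ 2 = r ^+ 2 * nrm q ^+ 2 + nrm h ^+ 2.
  rewrite {1}yE nrmD_sqr nrm_single nrm_real ger0_norm // nrm_Rrow exprMn.
  by rewrite Re_innerC inner_single l2scaleE Rrow_nil scaler0 inner0r mul0rn addr0.
have : r ^+ 2 * nrm q ^+ 2 <= 1 * nrm q ^+ 2 by rewrite ler_wpM2r ?sqr_ge0 // expr_le1.
lra.
Qed.

(** The states without damping. Letters are appended at the end of words, whence
    the recursion on the reversed word. *)
Fixpoint st (h : H) (x : word -> G) (s : word) : H :=
  if s is i :: s' then (X' (st h x s') + Ds (x (rev s'))) i else h.
Definition state (h : H) (x : word -> G) (w : word) : H := st h x (rev w).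

Lemma state_nil h x : state h x [::] = h. Proof. by []. Qed.

Lemma state_rcons h x w i : state h x (rcons w i) = (X' (state h x w) + Ds (x w)) i.
Proof. by rewrite /state rev_rcons /= revK. Qed.

(** A factor [r^|w|] on the input carries over to the states, by one factor [r]
    per letter. *)
Lemma is_state_coord r h (x : l2 word G) y : 0 <= r <= 1 -> is_state r h (dil r x) y ->
  forall w, y w = (r ^+ size w)%:C *: state h x w.
Proof.
move=> r01 yE; elim/last_ind => [|w i IH].
  by rewrite yE l2addE l2scaleE Rrow_nil scaler0 add0r /= scale1r.
rewrite yE l2addE l2scaleE Rrow_rcons [X in _ + X](_ : _ = 0); last by case: w {IH}.
have E : (pw X' y + pw Ds (dil r x)) w =
    (r ^+ size w)%:C *: (X' (state h x w) + Ds (x w)).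
  transitivity (X' (y w) + Ds (dil r x w)).
    by rewrite l2addE (pwE bX') (pwE bDs).
  by rewrite IH (diagE (dil_itv r01)) (blZ bX') (blZ bDs) scalerDr.
by rewrite addr0 E state_rcons size_rcons exprS rmorphM -scalerA.
Qed.

Definition output h (x : word -> G) (w : word) : H := Dl (state h x w) - X (x w).
Definition Xi h (x : l2 word G) : l2 word H := mkl2 (output h x).

Lemma output_dil r h (x : l2 word G) y : 0 <= r <= 1 -> is_state r h (dil r x) y ->
  forall w, (pw Dl y - pw X (dil r x)) w = (r ^+ size w)%:C *: output h x w.
Proof.
move=> r01 yE w; rewrite l2subE (pwE bDl) (pwE bX) (is_state_coord r01 yE).
by rewrite (diagE (dil_itv r01)) (blZ bX) (blZ bDl) -scalerBr.
Qed.

(** The energy bound of the damped systems, in the limit [r -> 1]. *)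
Lemma sqsum_output h (x : l2 word G) A : sqsum (output h x) A <= nrm h ^+ 2 + nrm x ^+ 2.
Proof.
have h1 : (fun r : R => \sum_(w <- A) (r ^+ size w * nrm (output h x w)) ^+ 2) @ (1 : R)^'-
    --> sqsum (output h x) A.
  rewrite /sqsum; apply: cvg_big => [|w _]; first exact: add_continuous.
  have hw : (fun r : R => r ^+ size w * nrm (output h x w)) @ (1 : R)^'- --> nrm (output h x w).
    rewrite -[X in _ --> X]mul1r; apply: cvgM; first exact: cvg_at_left1.
    exact: cvg_cst.
  by rewrite expr2; under eq_fun do rewrite expr2; apply: cvgM.
have h2 : (fun=> nrm h ^+ 2 + nrm x ^+ 2) @ (1 : R)^'- --> nrm h ^+ 2 + nrm x ^+ 2.
  exact: cvg_cst.
apply: (ler_cvg_to h1 h2); apply: filterS (at_left1_itv R) => r /andP[/ltW r0 r1].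
have [y yE] := state_exists h (dil r x) (introT andP (conj r0 r1)).
have r01 : 0 <= r <= 1 by rewrite r0 ltW.
have := sqsum_le_nrm (pw Dl y - pw X (dil r x)) A; rewrite {1}/sqsum.
under eq_bigr => w _ do rewrite (output_dil r01 yE) nrm_real ger0_norm ?exprn_ge0 //.
move=> h3; apply: le_trans h3 _; apply: le_trans (state_energy r01 yE) _.
rewrite lerD2l ler_pXn2r ?nnegrE ?nrm_ge0 //; exact: nrm_diag (dil_itv r01) _.
Qed.

Lemma XiE h x w : Xi h x w = output h x w.
Proof. exact: mkl2E (sqsum_output h x) w. Qed.

Lemma nrm_Xi h x : nrm (Xi h x) ^+ 2 <= nrm h ^+ 2 + nrm x ^+ 2.
Proof.
apply: nrm_l2_le => A; rewrite (_ : l2fun _ = output h x); first exact: sqsum_output.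
by apply/funext => w; apply: XiE.
Qed.

Lemma Xi_dil r h x y : 0 <= r <= 1 -> is_state r h (dil r x) y ->
  pw Dl y - pw X (dil r x) = dil r (Xi h x).
Proof.
move=> r01 yE; apply: l2_ext => w.
by rewrite (output_dil r01 yE) (diagE (dil_itv r01)) XiE.
Qed.

Lemma stateD h x h' x' w :
  state (h + h') (x + x') w = state h x w + state h' x' w.
Proof.
elim/last_ind: w => [//|w i IH]; rewrite !state_rcons IH (blD bX') fctE (blD bDs).
by rewrite addrACA l2addE.
Qed.

Lemma stateZ a h x w : state (a *: h) (a *: x) w = a *: state h x w.
Proof.
elim/last_ind: w => [//|w i IH]; rewrite !state_rcons IH (blZ bX') fctE (blZ bDs).
by rewrite -scalerDr l2scaleE.
Qed.

Lemma XiD h (x : l2 word G) h' x' : Xi (h + h') (x + x') = Xi h x + Xi h' x'.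
Proof.
apply: l2_ext => w; rewrite l2addE !XiE /output l2funD stateD (blD bDl).
by rewrite fctE (blD bX) opprD addrACA.
Qed.

Lemma XiZ a h (x : l2 word G) : Xi (a *: h) (a *: x) = a *: Xi h x.
Proof.
apply: l2_ext => w; rewrite l2scaleE !XiE /output l2funZ stateZ (blZ bDl).
by rewrite fctE (blZ bX) scalerBr.
Qed.

(** The two halves of the input-output map. When [X] is the row of a tuple [A],
    [Kop] is the Poisson kernel, with [Kop h w = Dl ((A_w)^* h)], and
    [Thop] is the characteristic function before compression to [N]. *)
Definition Kop (h : H) : l2 word H := Xi h 0.
Definition Thop (x : l2 word G) : l2 word H := Xi 0 x.

Lemma Xi_split h x : Xi h x = Kop h + Thop x.
Proof. by rewrite -XiD addr0 add0r. Qed.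

Lemma nrm_Kop h : nrm (Kop h) <= nrm h.
Proof.
rewrite -(@ler_pXn2r _ 2) ?nnegrE ?nrm_ge0 //; have := nrm_Xi h 0.
by rewrite nrm0 expr0n /= addr0.
Qed.

Lemma nrm_Thop x : nrm (Thop x) <= nrm x.
Proof.
rewrite -(@ler_pXn2r _ 2) ?nnegrE ?nrm_ge0 //; have := nrm_Xi 0 x.
by rewrite nrm0 expr0n /= add0r.
Qed.

Lemma bl_Kop : bounded_linear Kop.
Proof.
apply: (@bl_intro _ _ _ _ 1) => [h h'|a h|h]; last by rewrite mul1r nrm_Kop.
- by rewrite /Kop -XiD addr0.
- by rewrite /Kop -XiZ scaler0.
Qed.

Lemma bl_Thop : bounded_linear Thop.
Proof.
apply: (@bl_intro _ _ _ _ 1) => [h h'|a h|h]; last by rewrite mul1r nrm_Thop.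
- by rewrite /Thop -XiD addr0.
- by rewrite /Thop -XiZ scaler0.
Qed.

(** The output for the input [dil r x] is [dil r (Thop x)], which tends to
    [Thop x]; and the energy bound controls the change of output when
    [dil r x] is replaced by [x]. *)
Lemma Thop_cvg (x : l2 word G) (y : R -> l2 word H) :
  (forall r, 0 < r < 1 -> is_state r 0 x (y r)) ->
  (fun r => pw Dl (y r) - pw X x) @ (1 : R)^'- --> Thop x.
Proof.
move=> yE; apply/cvg_nrmP => e e0; have e2 : 0 < e / 2 by rewrite divr_gt0.
have /cvg_nrmP/(_ _ e2) h1 := @dil_cvg R n _ x; have /cvg_nrmP/(_ _ e2) h2 := @dil_cvg R n _ (Thop x).
move: (at_left1_itv R) h1 h2; apply: filterS3 => r r01 h1 h2.
have /andP[r0 r1] := r01; have r01' : 0 <= r <= 1 by rewrite !ltW.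
have [|z zE] := @state_exists r 0 (dil r x); first by rewrite ltW.
have dE := is_stateB (yE r r01) zE; rewrite subrr in dE.
have := state_energy r01' dE.
rewrite nrm0 expr0n /= add0r ler_pXn2r ?nnegrE ?nrm_ge0 // => h3.
have -> : Thop x - (pw Dl (y r) - pw X x) =
  (Thop x - dil r (Thop x)) + (pw Dl z - pw X (dil r x) - (pw Dl (y r) - pw X x)).
  by rewrite (Xi_dil r01' zE) subrKA.
apply: le_trans (ler_nrmD _ _) _; rewrite [e]splitr lerD //.
apply: le_trans h1; apply: le_trans h3.
rewrite (blB (bl_pw word bDl)) (blB (bl_pw word bX)) nrm_distC.
by rewrite !opprD !opprK addrACA.
Qed.

Notation Rr := (@Rrow R n H).

(** The adjoint of [Rrow] removes a last letter: the equation gives [z] on the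
    words of length [k] from [z] on the words of length [k + 1], starting at
    length [m] where [z] vanishes. *)
Lemma backward_exists m (b : l2 word H) : (forall w, (m <= size w)%N -> b w = 0) ->
  exists z, z = pw X (adj Rr z) + b.
Proof.
elim: m b => [|m IH] b b0.
  exists 0; have -> : b = 0 by apply: l2_ext => w; apply: b0.
  by rewrite (bl0 (bl_adj (@bl_Rrow R n H))) (bl0 (bl_pw word bX)) addr0.
have [|z zE] := IH (pw X (adj Rr b)).
  move=> w wm; rewrite (pwE bX) (_ : adj Rr b w = 0) ?(bl0 bX) //.
  by apply: l2_ext => i; rewrite adj_RrowE b0 // size_rcons.
exists (z + b); rewrite {1}zE (blD (bl_adj (@bl_Rrow R n H))) (blD (bl_pw word bX)).
by [].
Qed.

(** The system can be run backwards from a finitely supported output [v]: the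
    inverse of the Julia operator computes the state and the input at [w] from
    [v w] and the states at the words [rcons w i]. No energy is lost on the
    way. *)
Lemma Xi_preimage m (v : l2 word H) : (forall w, (m <= size w)%N -> v w = 0) ->
  exists h x, Xi h x = v /\ nrm h ^+ 2 + nrm x ^+ 2 = nrm v ^+ 2.
Proof.
move=> v0; have [|z zE] := @backward_exists m (pw Dl v).
  by move=> w wm; rewrite (pwE bDl) v0 // (bl0 bDl).
pose u := adj Rr z; pose x := pw Ds u - pw X' v.
have zw w : z w = X (u w) + Dl (v w) by rewrite {1}zE l2addE (pwE bX) (pwE bDl).
have xw w : x w = Ds (u w) - X' (v w) by rewrite l2subE (pwE bDs) (pwE bX').
have inv1 w : X' (z w) + Ds (x w) = u w.
  rewrite zw xw (blD bX') (blB bDs) X'Dl sqrDs.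
  by rewrite addrAC addrA subrKC subrK.
have inv2 w : Dl (z w) - X (x w) = v w.
  rewrite zw xw (blD bDl) (blB bX) XDs sqrDl.
  by rewrite opprB -addrA subrKA addrC subrK.
have stE w : state (z [::]) x w = z w.
  by elim/last_ind: w => [//|w i IH]; rewrite state_rcons IH inv1 adj_RrowE.
exists (z [::]), x; split.
  by apply: l2_ext => w; rewrite XiE /output stE inv2.
have := julia_pw z x.
rewrite (_ : pw X' z + pw Ds x = u); last first.
  by apply: l2_ext => w; rewrite l2addE (pwE bX') (pwE bDs) inv1.
rewrite (_ : pw Dl z - pw X x = v); last first.
  by apply: l2_ext => w; rewrite l2subE (pwE bDl) (pwE bX) inv2.
rewrite nrm_adj_Rrow; move: (nrm z ^+ 2) (nrm x ^+ 2) (nrm v ^+ 2) (nrm (z [::]) ^+ 2).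
by move=> a b c d; lra.
Qed.

(** [K K^* + Th Th^* = I]. For the contraction [Xi] the left-hand side is
    at most the right-hand side. A finitely supported [v] has a preimage of the
    same norm, which has to be [(K^* v, Th^* v)], so that equality holds for
    [v]; such [v] are dense. *)
Lemma Xi_adj_norm (v : l2 word H) :
  nrm (adj Kop v) ^+ 2 + nrm (adj Thop v) ^+ 2 = nrm v ^+ 2.
Proof.
have bK := bl_adj bl_Kop; have bT := bl_adj bl_Thop.
have le1 y : nrm (adj Kop y) ^+ 2 + nrm (adj Thop y) ^+ 2 <= nrm y ^+ 2.
  set s := _ + _; have s0 : 0 <= s by rewrite addr_ge0 ?sqr_ge0.
  have := nrm_Xi (adj Kop y) (adj Thop y); rewrite -/s => h.
  have : s <= nrm (Xi (adj Kop y) (adj Thop y)) * nrm y.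
    have := Re_cauchy_schwarz (Xi (adj Kop y) (adj Thop y)) y.
    rewrite Xi_split innerDl (adjP bl_Kop) (adjP bl_Thop) !innerE /= => h'.
    exact: h'.
  move=> h'.
  have [//|ys] := leP s (nrm y ^+ 2).
  have : s ^+ 2 <= (nrm (Xi (adj Kop y) (adj Thop y)) * nrm y) ^+ 2.
    by rewrite ler_pXn2r ?nnegrE ?mulr_ge0 ?nrm_ge0.
  rewrite exprMn => h2.
  have : s ^+ 2 <= s * nrm y ^+ 2 by apply: le_trans h2 _; rewrite ler_wpM2r ?sqr_ge0.
  have sp : 0 < s by apply: le_lt_trans ys; rewrite sqr_ge0.
  by rewrite expr2 ler_pM2l // leNgt ys.
have fin m (y : l2 word H) : (forall w, (m <= size w)%N -> y w = 0) ->
    nrm (adj Kop y) ^+ 2 + nrm (adj Thop y) ^+ 2 = nrm y ^+ 2.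
  move=> /Xi_preimage[h [x [yE nE]]]; apply/le_anti; rewrite le1 /=.
  have h1 : nrm y ^+ 2 = complex.Re (inner h (adj Kop y)) + complex.Re (inner x (adj Thop y)).
    rewrite -Re_inner -{1}yE Xi_split innerDl (adjP bl_Kop) (adjP bl_Thop).
    by case: (inner h _) (inner x _) => a b [].
  have := nrmB_sqr h (adj Kop y); have := nrmB_sqr x (adj Thop y).
  have := sqr_ge0 (nrm (h - adj Kop y)); have := sqr_ge0 (nrm (x - adj Thop y)).
  move: h1 nE.
  set a1 := complex.Re _; set a2 := complex.Re _.
  move: (nrm (h - adj Kop y) ^+ 2) (nrm (x - adj Thop y) ^+ 2) a1 a2.
  move: (nrm h ^+ 2) (nrm x ^+ 2) (nrm y ^+ 2) (nrm (adj Kop y) ^+ 2) (nrm (adj Thop y) ^+ 2).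
  by move=> *; lra.
have cv := @trunc_cvg R n H v.
have sq (V : hilbertType R) (u : nat -> V) (l : V) : u @ \oo --> l ->
    (fun m => nrm (u m) ^+ 2) @ \oo --> nrm l ^+ 2.
  move=> ul; rewrite expr2; under eq_fun do rewrite expr2.
  by apply: cvgM; exact: nrm_cvg_real ul.
have l1 : (fun m => nrm (adj Kop (trunc m v)) ^+ 2) @ \oo --> nrm (adj Kop v) ^+ 2.
  exact: sq (bl_cvg bK cv).
have l2 : (fun m => nrm (adj Thop (trunc m v)) ^+ 2) @ \oo --> nrm (adj Thop v) ^+ 2.
  exact: sq (bl_cvg bT cv).
have l3 := sq _ _ _ cv.
have l12 : (fun m => nrm (adj Kop (trunc m v)) ^+ 2 + nrm (adj Thop (trunc m v)) ^+ 2)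
  @ \oo --> nrm (adj Kop v) ^+ 2 + nrm (adj Thop v) ^+ 2.
  by apply: cvgD; [exact: l1|exact: l2].
have E : (fun m => nrm (adj Kop (trunc m v)) ^+ 2 + nrm (adj Thop (trunc m v)) ^+ 2) =
    (fun m => nrm (trunc m v) ^+ 2).
  apply/funext => m; apply: (fin m) => w wm.
  by rewrite truncE ltnNge wm.
by rewrite E in l12; exact: (cvg_unique _ l12 l3).
Qed.

Section Compression.
Variable N : set (l2 word R[i]).
Hypothesis cN : closed_subspace N.
Hypothesis RN : forall i a, orth N a -> orth N (Rop R[i] i a).

Let bP K := @bl_projN R n N K.

Lemma projN_state r x y : 0 <= r < 1 -> is_state r 0 x y ->
  projN N _ x = 0 -> projN N _ y = 0.
Proof.
move=> /andP[r0 r1] yE Px; apply: (@neumann_uniq _ _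
  (fun y => r%:C *: projN N H (Rrow (pw X' y))) r) => // [z|].
  rewrite nrm_real ger0_norm // ler_wpM2l // (le_trans (nrm_projN _ _)) // nrm_Rrow.
  exact: nrm_pw.
rewrite {1}yE (blD (@bP H)) (blZ (@bP H)) (bl0 (@bl_single R word H [::])).
rewrite (bl0 (@bP H)) addr0 -(projN_Rrow cN RN) (blD (@bP _)).
by rewrite (projN_pw cN bX') (projN_pw cN bDs) Px (bl0 (bl_pw word bDs)) addr0.
Qed.

Lemma state_family h x : exists y : R -> l2 word H,
  forall r, 0 < r < 1 -> is_state r h x (y r).
Proof.
have [r|y yE] := @choice R (l2 word H) (fun r y => 0 < r < 1 -> is_state r h x y).
  have [r01|] := boolP (0 < r < 1); last by exists 0.
  have [|y yE] := @state_exists r h x; last by exists y.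
  by have /andP[/ltW -> ->] := r01.
by exists y.
Qed.

(** The kernel of [P_N (x) I] is preserved by the damped systems, by
    uniqueness of the state, hence by [Thop]. *)
Lemma projN_Thop x : projN N _ (Thop x) = projN N _ (Thop (projN N _ x)).
Proof.
apply/eqP; rewrite -subr_eq0 -(blB (@bP H)) -(blB bl_Thop); apply/eqP.
set z := x - _; have Pz : projN N _ z = 0 by rewrite /z (blB (@bP _)) projN_idem subrr.
have [y yE] := state_family 0 z; have cv := Thop_cvg yE.
have ck := csub_eq (@bP H) (@bl_cst0 R (l2 word H) (l2 word H)).
apply: (csub_cvg ck _ cv); apply: filterS (at_left1_itv R) => r r01 /=.
have Py : projN N _ (y r) = 0.
  by apply: projN_state (yE r r01) Pz; have /andP[/ltW -> ->] := r01.
rewrite (blB (@bP H)) (projN_pw cN bDl) (projN_pw cN bX) Py Pz.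
by rewrite (bl0 (bl_pw word bDl)) (bl0 (bl_pw word bX)) subrr.
Qed.

End Compression.

End System.

(** * The characteristic function as an input-output map *)

Section RowOperators.
Variables (R : realType) (n : nat) (H : hilbertType R) (A : 'I_n -> H -> H).
Hypothesis bA : forall i, bounded_linear (A i).

Lemma rowE : row A = \sum_i (A i \o @coord R n H i).
Proof. by apply/funext => u; rewrite /row fct_sumE. Qed.

Lemma bl_row : bounded_linear (row A).
Proof.
by rewrite rowE; apply: bl_sumf => i; apply: (bl_comp (bA i) (bl_coord H i)).
Qed.

Lemma row_single i h : row A (single i h) = A i h.
Proof.
rewrite /row (bigD1 i) //= eqxx big1 ?addr0 // => j ji.
by rewrite (negbTE ji) (bl0 (bA j)).
Qed.

Lemma adj_rowE h i : adj (row A) h i = adj (A i) h.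
Proof.
by apply: inner_inj => z; rewrite -inner_single -(adjP bl_row) row_single -(adjP (bA i)).
Qed.

Lemma row_sqrE : row_sqr A = row A \o adj (row A).
Proof.
apply/funext => h; rewrite /row_sqr fct_sumE /row /=; apply: eq_bigr => i _.
by rewrite adj_rowE.
Qed.

End RowOperators.

Section Characteristic.
Variables (R : realType) (n : nat) (H : hilbertType R).
Notation word := (seq 'I_n).
Notation G := (l2 'I_n H).
Variables (f : 'I_n -> fps R n) (T : 'I_n -> H -> H).
Notation A := (eval f T).
Hypothesis bA : forall i, bounded_linear (A i).
Hypothesis A1 : forall u, nrm (row A u) <= nrm u.

Let bX := bl_row bA.

Lemma defectE : defect f T = codefect_of (row A).
Proof. by rewrite /defect row_sqrE. Qed.

Lemma defect_adjE : defect_adj f T = defect_of (row A).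
Proof. by []. Qed.

Lemma row_colligation :
  colligation (row A) (adj (row A)) (defect_adj f T) (defect f T).
Proof. by rewrite defectE defect_adjE; exact: contraction_colligation bX A1. Qed.

Notation Th := (Thop (row A) (adj (row A)) (defect_adj f T) (defect f T)).
Let col := row_colligation.
Let bX' := col_bX' col.
Let bDs := col_bDs col.
Let bDl := col_bDl col.

Variable N : set (l2 word R[i]).
Hypothesis cN : closed_subspace N.
Hypothesis RN : forall i a, orth N a -> orth N (Rop R[i] i a).

Lemma WrowE r : @Wrow R n H N r = (fun x => r%:C *: projN N H (Rrow x)).
Proof.
apply/funext => x; rewrite /Wrow fct_sumE /Rrow (bl_sum (@bl_projN R n N H)) scaler_sumr.
by apply: eq_bigr => i _; rewrite (tensor_op_Wop cN r i (bl_coord H i)).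
Qed.

Lemma Wresolvent_opE r : \sum_i tensor_op (r%:C *: Wop N i) (adj (A i)) =
  (fun y => r%:C *: projN N H (Rrow (pw (adj (row A)) y))).
Proof.
apply/funext => x; rewrite fct_sumE /Rrow (bl_sum (@bl_projN R n N H)) scaler_sumr.
apply: eq_bigr => i _; rewrite (tensor_op_Wop cN r i (bl_adj (bA i))).
congr (_ *: projN N H (Rop H i _)); apply: l2_ext => w.
by rewrite (pwE (bl_adj (bA i))) (pwE (bl_coord H i)) (pwE bX') /coord adj_rowE.
Qed.

(** Coinvariance of [N] makes the compression of the state equation an equation
    in [N (x) H], which is the one that the resolvent solves. *)
Lemma Wresolvent_state r x y : 0 <= r < 1 ->
  is_state (adj (row A)) (defect_adj f T) r 0 x y ->
  Wresolvent f T N r (Wrow N r (pw (defect_adj f T) x)) = projN N _ y.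
Proof.
move=> /andP[r0 r1] yE; have bP := @bl_projN R n N.
rewrite /Wresolvent /inv_on Wresolvent_opE WrowE.
pose B y := r%:C *: projN N H (Rrow (pw (adj (row A)) y)); set S := mkset _.
have Sy : S (projN N H y).
  split; first exact: projN_in.
  rewrite -[LHS]/(projN N H y - r%:C *: projN N H (Rrow (pw (adj (row A)) (projN N H y)))).
  rewrite -(projN_pw cN bX') (projN_Rrow cN RN).
  rewrite {1}yE (bl0 (@bl_single R word H [::])) addr0 (blZ (bP H)) -scalerBr -(blB (bP H)).
  by rewrite -(blB (@bl_Rrow R n H)) addrAC subrr add0r.
have uniq y1 y2 : S y1 -> S y2 -> y1 = y2.
  move=> [Ny1 e1] [Ny2 e2]; apply/eqP; rewrite -subr_eq0; apply/eqP.
  apply: (@neumann_uniq R _ B r (y1 - y2)) => // [z|].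
    rewrite /B nrm_real ger0_norm // ler_wpM2l // (le_trans (nrm_projN _ _)) // nrm_Rrow.
    by apply: nrm_pw => //; exact: col_X1' col.
  have BB : B (y1 - y2) = B y1 - B y2.
    rewrite /B (blB (bl_pw word bX')) (blB (@bl_Rrow R n H)) (blB (bP H)).
    by rewrite scalerBr.
  rewrite BB; have := etrans e1 (esym e2) => /= e.
  have {}e : y1 - B y1 = y2 - B y2 by exact: e.
  move: e => /eqP; rewrite subr_eq => /eqP {1}->.
  by rewrite addrAC [y2 - _]addrC addrK addrC.
by apply: (uniq _ _ _ Sy); exact: (xgetPex 0 (ex_intro _ _ Sy)).
Qed.

Lemma Theta_rE r x y : 0 <= r < 1 -> projN N _ x = x ->
  is_state (adj (row A)) (defect_adj f T) r 0 x y ->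
  Theta_r f T N r x = projN N _ (pw (defect f T) y - pw (row A) x).
Proof.
move=> r01 Px yE; rewrite /Theta_r !tensor_op_id //.
rewrite (Wresolvent_state r01 yE) (blB (@bl_projN R n N H)).
by rewrite (projN_pw cN bDl) (projN_pw cN bX) Px addrC.
Qed.

(** For each [r], the formula for the characteristic function is the compression
    to [N] of the output of the damped system. *)
Lemma ThetaE x : projN N _ x = x -> Theta f T N x = projN N _ (Th x).
Proof.
move=> Px; have [y yE] := @state_family _ _ _ _ _ _ _ col 0 x.
have cv := Thop_cvg col yE.
apply: cvg_lim; first exact: norm_hausdorff.
have cv' : (fun r => projN N H (pw (defect f T) (y r) - pw (row A) x)) @ (1 : R)^'- -->
    projN N H (Th x) by exact: (bl_cvg (@bl_projN R n N H) cv).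
move/cvg_nrmP : cv' => cv'.
apply/cvg_nrmP => e e0; apply: filterS2 (at_left1_itv R) (cv' e e0) => r r01.
by rewrite (@Theta_rE r x (y r)) //; [have /andP[/ltW -> ->] := r01|exact: yE].
Qed.

End Characteristic.

(** * Uniqueness and unitary invariance of evaluations *)

Section Abel.
Variables (R : realType) (V : hilbertType R).

Lemma at_left1_gt (d : R) : d < 1 -> \forall r \near (1 : R)^'-, d < r < 1.
Proof.
move=> d1; near=> r; apply/andP; split; near: r; first exact: nbhs_left_gt.
exact: nbhs_left_lt.
Unshelve. all: by end_near. Qed.

(** Summation by parts, centered at the sum [s]. *)
Lemma abel_sum_id (t : nat -> V) (s : V) (r : R) m :
  \sum_(k < m) (r ^+ k)%:C *: t k - s =
  (r ^+ m)%:C *: (\sum_(k < m) t k - s) +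
  (1 - r)%:C *: \sum_(k < m) (r ^+ k)%:C *: (\sum_(j < k.+1) t j - s).
Proof.
elim: m => [|m IH].
  by rewrite !big_ord0 expr0 scale1r scaler0 addr0.
rewrite big_ord_recr /= addrAC IH [X in _ = _ + _ *: X]big_ord_recr /=.
set e := (\sum_(j < m.+1) t j - s).
have -> : t m = e - (\sum_(k < m) t k - s).
  by rewrite /e big_ord_recr /= opprB addrA subrK addrAC subrr add0r.
set E := (\sum_(k < m) t k - s).
rewrite (scalerBr _ e E) addrAC [X in X + _ = _](_ : _ = (r ^+ m)%:C *: e); last first.
  by rewrite addrC subrK.
rewrite (scalerDr (1 - r)%:C) addrA addrAC; congr (_ + _).
rewrite exprS scalerA -rmorphM -scalerDl -rmorphD.
by congr (_%:C *: _); ring.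
Qed.

(** In [abel_sum_id], the errors of the partial sums from [N] on are at most
    [eps] and their weights add up to at most [1]; the first [N] errors
    contribute [(1 - r) K]. *)
Lemma abel_bound (t : nat -> V) (s : V) (eps : R) : 0 < eps ->
  (fun m => \sum_(k < m) t k) @ \oo --> s ->
  exists (K : R) (N : nat), forall r m, 0 < r < 1 -> (N <= m)%N ->
    nrm (\sum_(k < m) (r ^+ k)%:C *: t k - s) <= eps *+ 2 + (1 - r) * K.
Proof.
move=> e0 /cvg_nrmP/(_ _ e0)[N _ SN].
pose e k := \sum_(j < k) t j - s.
have eN k : (N <= k)%N -> nrm (e k) <= eps by move=> Nk; rewrite nrm_distC; exact: SN.
pose K := \sum_(k < N) nrm (e k.+1).
have K0 : 0 <= K by apply: sumr_ge0 => k _; apply: nrm_ge0.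
exists K, N => r m /andP[r0 r1] Nm; rewrite abel_sum_id -/(e m).
have r1' : 0 <= 1 - r by rewrite subr_ge0 ltW.
have h p : nrm (\sum_(k < p) (r ^+ k)%:C *: e k.+1) * (1 - r) <= eps * (1 - r ^+ p) +
    (1 - r) * \sum_(k < minn p N) nrm (e k.+1).
  elim: p => [|p IH].
    by rewrite min0n !big_ord0 nrm0 mul0r expr0 subrr !mulr0 addr0.
  rewrite big_ord_recr /=; apply: le_trans (ler_wpM2r r1' (ler_nrmD _ _)) _.
  rewrite mulrDl nrm_real ger0_norm ?exprn_ge0 ?(ltW r0) //.
  have rp0 : 0 <= r ^+ p by rewrite exprn_ge0 // ltW.
  have rp1 : r ^+ p <= 1 by rewrite exprn_ile1 // ltW.
  have [Np|pN] := leqP N p.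
    have -> : minn p.+1 N = minn p N by rewrite !(minn_idPr _) // ltnW.
    have h1 : r ^+ p * nrm (e p.+1) * (1 - r) <= r ^+ p * eps * (1 - r).
      by rewrite ler_wpM2r // ler_wpM2l // eN // ltnW.
    apply: le_trans (lerD IH h1) _; rewrite exprS; lra.
  have -> : minn p.+1 N = p.+1 by apply/minn_idPl.
  have pE : minn p N = p by apply/minn_idPl/ltnW.
  rewrite pE in IH.
  rewrite big_ord_recr /= [(1 - r) * _]mulrDr addrA.
  have h1 : r ^+ p * nrm (e p.+1) * (1 - r) <= (1 - r) * nrm (e p.+1).
    by rewrite mulrC ler_wpM2l // ler_piMl // nrm_ge0.
  apply: le_trans (lerD IH h1) _; rewrite lerD2r lerD2r ler_wpM2l ?(ltW e0) //.
  by rewrite lerD2l lerN2 exprS ler_piMl // ltW.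
apply: le_trans (ler_nrmD _ _) _.
rewrite !nrm_real ger0_norm ?exprn_ge0 ?(ltW r0) // ger0_norm //.
have h1 : r ^+ m * nrm (e m) <= eps.
  apply: le_trans (_ : nrm (e m) <= _); last exact: eN.
  by rewrite ler_piMl ?nrm_ge0 // exprn_ile1 // ltW.
have := h m; have -> : minn m N = N by apply/minn_idPr.
have : eps * (1 - r ^+ m) <= eps by rewrite ler_piMr ?(ltW e0) // gerBl exprn_ge0 // ltW.
rewrite -/K [X in _ -> X <= _ -> _]mulrC; lra.
Qed.

(** Abel's theorem. *)
Lemma abel (t : nat -> V) (s L : V) (P : R -> V) :
  (fun m => \sum_(k < m) t k) @ \oo --> s ->
  (\forall r \near (1 : R)^'-, (fun m => \sum_(k < m) (r ^+ k)%:C *: t k) @ \oo --> P r) ->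
  P r @[r --> (1 : R)^'-] --> L -> L = s.
Proof.
move=> ts tP PL; apply/eqP; rewrite -subr_eq0; apply/eqP/nrm_eq0.
apply/le_anti; rewrite nrm_ge0 andbT; apply/ler_addgt0Pr => e e0; rewrite add0r.
have e8 : 0 < e / 8 by rewrite divr_gt0.
have [K [N KN]] := abel_bound e8 ts.
have K1 : 0 < `|K| + 1 by rewrite ltr_wpDl.
have d1 : 1 - e / 8 / (`|K| + 1) < 1 by rewrite gtrBl divr_gt0.
move/cvg_nrmP : PL => /(_ _ e8) PL.
have [r [r01 rd tr Pr]] : exists r, [/\ 0 < r < 1, 1 - e / 8 / (`|K| + 1) < r < 1,
    (fun m => \sum_(k < m) (r ^+ k)%:C *: t k) @ \oo --> P r & nrm (L - P r) <= e / 8].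
  have := filter_ex (filterI (filterI (at_left1_itv R) (at_left1_gt d1)) (filterI tP PL)).
  by case=> r [[? ?] [? ?]]; exists r.
move/cvg_nrmP : tr => /(_ _ e8)[m0 _ tr].
have h1 := tr _ (leq_maxl m0 N); have h2 := KN r _ r01 (leq_maxr m0 N).
have rK : (1 - r) * K <= e / 8.
  apply: (@le_trans _ _ ((1 - r) * (`|K| + 1))).
    have /andP[_ /ltW r1] := r01; rewrite ler_wpM2l ?subr_ge0 //.
    by rewrite (le_trans (ler_norm K)) // lerDl.
  by rewrite -ler_pdivlMr //; have /andP[] := rd; lra.
rewrite -(subrKA (P r)) (le_trans (ler_nrmD _ _)) //.
rewrite -(subrKA (\sum_(k < maxn m0 N) (r ^+ k)%:C *: t k) (P r)).
have := ler_nrmD (P r - \sum_(k < maxn m0 N) (r ^+ k)%:C *: t k)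
  (\sum_(k < maxn m0 N) (r ^+ k)%:C *: t k - s).
move: h1 h2 Pr rK e0; rewrite /=; move: (nrm _) (nrm _) (nrm _) (nrm _) ((1 - r) * K).
move=> a b c d k; lra.
Qed.

End Abel.

Section EvalTheory.
Variables (R : realType) (n : nat).
Implicit Types (H : hilbertType R) (a : fps R n) (f : 'I_n -> fps R n).

Lemma psumE H a (Y : 'I_n -> H -> H) m x :
  psum a Y m x = \sum_(w <- words n m) a w *: word_op Y w x.
Proof.
rewrite /psum (sum_words m (fun w => a w *: word_op Y w)) fct_sumE.
by [].
Qed.

Lemma psum_levels H a (Y : 'I_n -> H -> H) m x :
  psum a Y m x = \sum_(k < m) \sum_(al : k.-tuple 'I_n) a al *: word_op Y al x.
Proof. by rewrite psumE -(sum_words m (fun w => a w *: word_op Y w x)). Qed.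

Lemma bl_word_op H (Y : 'I_n -> H -> H) w : (forall i, bounded_linear (Y i)) ->
  bounded_linear (word_op Y w).
Proof.
move=> bY; elim: w => [|i w IH]; first exact: bl_id.
exact: bl_comp (bY i) IH.
Qed.

Lemma bl_psum H a (Y : 'I_n -> H -> H) m : (forall i, bounded_linear (Y i)) ->
  bounded_linear (psum a Y m).
Proof.
move=> bY; rewrite /psum; apply: bl_sumf => k; apply: bl_sumf => al.
exact: bl_scalef (bl_word_op _ bY).
Qed.

Lemma bl_scaled H (Y : 'I_n -> H -> H) c : (forall i, bounded_linear (Y i)) ->
  forall i, bounded_linear (c *: Y i).
Proof. by move=> bY i; apply: bl_scalef. Qed.

Lemma word_op_scaled H (Y : 'I_n -> H -> H) (r : R) w x :
  (forall i, bounded_linear (Y i)) ->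
  word_op (fun i => r%:C *: Y i) w x = (r ^+ size w)%:C *: word_op Y w x.
Proof.
move=> bY; elim: w => [|i w IH]; first by rewrite /= scale1r.
rewrite [LHS]/= -[LHS]/(r%:C *: Y i (word_op (fun i => r%:C *: Y i) w x)) IH.
by rewrite (blZ (bY i)) scalerA -rmorphM -exprS.
Qed.

Lemma word_op_cat H (Y : 'I_n -> H -> H) v w x :
  word_op Y (v ++ w) x = word_op Y v (word_op Y w x).
Proof. by elim: v => //= i v ->. Qed.

Lemma psum_scaled H a (Y : 'I_n -> H -> H) (r : R) m x :
  (forall i, bounded_linear (Y i)) ->
  psum a (fun i => r%:C *: Y i) m x =
  \sum_(k < m) (r ^+ k)%:C *: \sum_(al : k.-tuple 'I_n) a al *: word_op Y al x.
Proof.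
move=> bY; rewrite psum_levels; apply: eq_bigr => k _; rewrite scaler_sumr.
apply: eq_bigr => al _; rewrite (word_op_scaled _ _ _ bY) size_tuple.
by rewrite !scalerA mulrC.
Qed.

Lemma eval_norm_pt H a (Y : 'I_n -> H -> H) L : (forall i, bounded_linear (Y i)) ->
  eval_norm a Y L -> forall x, (fun m => psum a Y m x) @ \oo --> L x.
Proof.
move=> bY aL x.
exact: (@norm_cvg_pt _ _ _ _ _ _ _ _ (fun m => bl_psum a m bY) aL x).
Qed.

(** Needed because a series may be evaluated in one sense at [T] and in the
    other sense at a tuple unitarily equivalent to [T]. *)
Lemma eval_sot_rad H a (Y : 'I_n -> H -> H) L L' : (forall i, bounded_linear (Y i)) ->
  eval_sot a Y L -> eval_rad a Y L' -> L = L'.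
Proof.
move=> bY [_ aL] [d [P [/andP[d0 d1] aP [_ PL]]]]; apply/funext => x; symmetry.
apply: (abel (t := fun k => \sum_(al : k.-tuple 'I_n) a al *: word_op Y al x) (P := P^~ x)).
- by have := aL x; under eq_fun do rewrite psum_levels.
- apply: filterS (at_left1_gt d1) => r rd.
  have := @eval_norm_pt _ _ _ _ (bl_scaled r%:C bY) (aP r rd) x.
  by under eq_fun do rewrite psum_scaled //.
- exact: PL.
Qed.

Lemma eval_rad_uniq H a (Y : 'I_n -> H -> H) L L' : (forall i, bounded_linear (Y i)) ->
  eval_rad a Y L -> eval_rad a Y L' -> L = L'.
Proof.
move=> bY [d [P [/andP[d0 d1] aP [_ PL]]]] [d' [P' [/andP[d0' d1'] aP' [_ PL']]]].
apply/funext => x; apply: (hcvg_uniq (PL x)); apply/cvg_nrmP => e e0.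
have /cvg_nrmP/(_ e e0) h := PL' x.
apply: filterS3 (at_left1_gt d1) (at_left1_gt d1') h => r rd rd'.
suff -> : P r x = P' r x by [].
have bYr := bl_scaled r%:C bY.
by apply: hcvg_uniq (@eval_norm_pt _ _ _ _ bYr (aP r rd) x)
  (@eval_norm_pt _ _ _ _ bYr (aP' r rd') x).
Qed.

Lemma eval_sot_uniq H a (Y : 'I_n -> H -> H) L L' :
  eval_sot a Y L -> eval_sot a Y L' -> L = L'.
Proof. by move=> [_ h] [_ h']; apply/funext => x; apply: (hcvg_uniq (h x) (h' x)). Qed.

Lemma eval_spec_uniq H f (Y Z Z' : 'I_n -> H -> H) : (forall i, bounded_linear (Y i)) ->
  eval_spec f Y Z -> eval_spec f Y Z' -> Z = Z'.
Proof.
move=> bY [h|h] [h'|h']; apply/funext => i.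
- exact: eval_sot_uniq (h i) (h' i).
- exact: eval_sot_rad bY (h i) (h' i).
- symmetry; exact: eval_sot_rad bY (h' i) (h i).
- exact: eval_rad_uniq bY (h i) (h' i).
Qed.

Lemma evalE H f (Y Z : 'I_n -> H -> H) : (forall i, bounded_linear (Y i)) ->
  eval_spec f Y Z -> eval f Y = Z.
Proof.
move=> bY fZ; apply: (eval_spec_uniq bY _ fZ).
by apply: (xgetPex (cst (cst 0)) (P := [set Z | eval_spec f Y Z])); exists Z.
Qed.

Lemma eval_spec_bl H f (Y Z : 'I_n -> H -> H) : eval_spec f Y Z ->
  forall i, bounded_linear (Z i).
Proof. by case=> h i; [case: (h i)|case: (h i) => d [P [_ _ []]]]. Qed.

End EvalTheory.

Section Transport.
Variables (R : realType) (n : nat) (H H' : hilbertType R).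
Variables (U : H -> H') (V : H' -> H).
Hypotheses (bU : bounded_linear U) (bV : bounded_linear V).
Hypotheses (UK : cancel U V) (VK : cancel V U).
Implicit Types (a : fps R n) (f : 'I_n -> fps R n).

Definition conj_by (Y : H -> H) : H' -> H' := U \o Y \o V.

Lemma bl_conj Y : bounded_linear Y -> bounded_linear (conj_by Y).
Proof. by move=> bY; apply: (bl_comp (bl_comp bU bY) bV). Qed.

Lemma word_op_conj (Y : 'I_n -> H -> H) w x :
  word_op (fun i => conj_by (Y i)) w x = U (word_op Y w (V x)).
Proof.
elim: w => [|i w IH]; first by rewrite /= VK.
by rewrite [LHS]/= -[LHS]/(conj_by (Y i) (word_op _ w x)) IH /conj_by /= UK.
Qed.

Lemma psum_conj a (Y : 'I_n -> H -> H) m x :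
  psum a (fun i => conj_by (Y i)) m x = conj_by (psum a Y m) x.
Proof.
rewrite /conj_by /= !psumE (bl_sum bU); apply: eq_bigr => w _.
by rewrite word_op_conj (blZ bU).
Qed.

Lemma eval_sot_conj a (Y : 'I_n -> H -> H) L : eval_sot a Y L ->
  eval_sot a (fun i => conj_by (Y i)) (conj_by L).
Proof.
move=> [bL h]; split; first exact: bl_conj.
move=> x; under eq_fun do rewrite psum_conj; exact: (bl_cvg bU (h (V x))).
Qed.

Lemma eval_norm_conj a (Y : 'I_n -> H -> H) L : (forall i, bounded_linear (Y i)) ->
  eval_norm a Y L -> eval_norm a (fun i => conj_by (Y i)) (conj_by L).
Proof.
move=> bY h; have bL := h.1; have bY' i := bl_conj (bY i).
have [M M0 UM] := bl_bound bU; have [K K0 VK'] := bl_bound bV.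
apply/(norm_cvgP (bl_conj bL) (fun m => bl_psum a m bY')) => e e0.
move/(norm_cvgP bL (fun m => bl_psum a m bY)) : h => /(_ (e / (M * K)) _).
case=> [|N _ h]; first by rewrite divr_gt0 // mulr_gt0.
exists N => // m /h {}h x; rewrite psum_conj /conj_by /= -(blB bU).
apply: le_trans (UM _) _; apply: le_trans (ler_wpM2l (ltW M0) (h _)) _.
rewrite mulrCA mulrA; apply: le_trans (ler_wpM2l _ (VK' x)) _.
  by rewrite mulr_ge0 ?(ltW M0) // divr_ge0 ?mulr_ge0 // ltW.
rewrite le_eqVlt; apply/orP; left; apply/eqP; field.
by rewrite !gt_eqF.
Qed.

Lemma eval_rad_conj a (Y : 'I_n -> H -> H) L : (forall i, bounded_linear (Y i)) ->
  eval_rad a Y L -> eval_rad a (fun i => conj_by (Y i)) (conj_by L).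
Proof.
move=> bY [d [P [d01 aP [bL PL]]]]; exists d, (fun r => conj_by (P r)); split => //.
  move=> r rd; have := eval_norm_conj (bl_scaled r%:C bY) (aP r rd).
  rewrite (_ : (fun i => conj_by (r%:C *: Y i)) = (fun i => r%:C *: conj_by (Y i))) //.
  by apply/funext => i; apply/funext => x; rewrite /conj_by /= (blZ bU).
split; first exact: bl_conj.
by move=> x; exact: (bl_cvg bU (PL (V x))).
Qed.

Lemma eval_spec_conj f (Y Z : 'I_n -> H -> H) : (forall i, bounded_linear (Y i)) ->
  eval_spec f Y Z -> eval_spec f (fun i => conj_by (Y i)) (fun i => conj_by (Z i)).
Proof.
move=> bY [h|h]; [left|right] => i; first exact: eval_sot_conj.
exact: eval_rad_conj.
Qed.

End Transport.

(** * The commutant of the right creations *)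

Opaque adj.

Section DiagMore.
Variables (R : realType) (W : choiceType) (K : hilbertType R).

Lemma inner_diag (d : W -> R) : (forall w, 0 <= d w <= 1) ->
  forall x y : l2 W K, inner (diag d x) y = inner x (diag d y).
Proof.
move=> d1 x y; apply: (@eq_on_single _ W K _ (fun x => inner (diag d x) y)
  (fun x => inner x (diag d y))) => [||w k].
- exact: (bl_comp (bl_inner y) (bl_diag K d1)).
- exact: bl_inner.
rewrite (diag_single d1) innerZl !inner_single (diagE d1) innerZr.
by rewrite conjc_real.
Qed.

End DiagMore.

Section PoissonWeights.
Variables (R : realType) (r : R).
Hypothesis r01 : 0 < r < 1.

(** The numbers [pgam j p] and the weights [pwt j] factor the Poisson kernel:
    [r^|p - q|] is the sum over [j] of [pwt j * pgam j p * pgam j q]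
    ([sum_pgam_mul]). As the weights are nonnegative, the radial dilate of an
    operator becomes an average of compressions of it ([poisson_finite]). *)
Definition pgam (j p : nat) : R := if (j <= p)%N then r ^+ (p - j) else 0.
Definition pwt (j : nat) : R := if j == 0%N then 1 else 1 - r ^+ 2.

Lemma pgam_itv j p : 0 <= pgam j p <= 1.
Proof.
have /andP[/ltW r0 /ltW r1] := r01; rewrite /pgam; case: ifP => _.
  by rewrite exprn_ge0 // exprn_ile1.
by rewrite lexx ler01.
Qed.

Lemma pwt_ge0 j : 0 <= pwt j.
Proof.
have /andP[/ltW r0 /ltW r1] := r01; rewrite /pwt; case: ifP => // _.
by rewrite subr_ge0 exprn_ile1.
Qed.

Lemma pgamD j q d : (j <= q)%N -> pgam j (q + d) = r ^+ d * pgam j q.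
Proof.
by move=> jq; rewrite /pgam jq (leq_trans jq) ?leq_addr // -exprD addnC -addnBA.
Qed.

Lemma sum_pgam_sqr m q : (q < m)%N -> \sum_(j < m) pwt j * pgam j q ^+ 2 = 1.
Proof.
elim: q => [|q IH] qm.
  rewrite (bigD1 (Ordinal qm)) //= big1 ?addr0 ?mul1r ?expr1n //.
  move=> j j0; rewrite /pgam leqn0 -(inj_eq val_inj) /= in j0 *.
  by rewrite (negbTE j0) expr0n mulr0.
have E (j : 'I_m) : pwt j * pgam j q.+1 ^+ 2 = r ^+ 2 * (pwt j * pgam j q ^+ 2) +
    (if j == Ordinal qm then 1 - r ^+ 2 else 0).
  rewrite -(inj_eq val_inj) /=; have [jq|qj|->] := ltngtP j q.+1.
  - by rewrite -addn1 pgamD // expr1 addr0 exprMn mulrCA.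
  - rewrite /pgam ifN -?ltnNge // ifN -?ltnNge ?(ltn_trans _ qj) //.
    by rewrite expr0n !mulr0 addr0.
  - by rewrite /pwt /pgam leqnn ltnn subnn expr1n expr0n !mulr0 add0r mulr1.
rewrite (eq_bigr _ (fun j _ => E j)) big_split -mulr_sumr IH ?(ltnW qm) //=.
rewrite (bigD1 (Ordinal qm)) //= eqxx big1 ?addr0 => [|j /negbTE->//].
by rewrite mulr1 addrC subrK.
Qed.

Lemma sum_pgam_le m p : \sum_(j < m) pwt j * pgam j p ^+ 2 <= 1.
Proof.
have [pm|mp] := ltnP p m; first by rewrite sum_pgam_sqr.
rewrite -(@sum_pgam_sqr p.+1 p) // -(subnKC (leqW mp)) big_split_ord /= lerDl.
by apply: sumr_ge0 => j _; rewrite mulr_ge0 ?pwt_ge0 ?sqr_ge0.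
Qed.

Lemma sum_pgam_mul m p q : (q <= p)%N -> (q < m)%N ->
  \sum_(j < m) pwt j * (pgam j p * pgam j q) = r ^+ (p - q).
Proof.
move=> qp qm; rewrite -[RHS]mulr1 -(sum_pgam_sqr qm) mulr_sumr.
apply: eq_bigr => j _; rewrite [RHS]mulrCA; congr (_ * _).
have [jq|qj] := leqP j q; last first.
  have -> : pgam j q = 0 by rewrite /pgam ifN // -ltnNge.
  by rewrite expr0n !mulr0.
by rewrite -{1}(subnKC qp) pgamD // -mulrA expr2.
Qed.

End PoissonWeights.

Section Commutant.
Variables (R : realType) (n : nat).
Notation word := (seq 'I_n).
Notation H2 := (l2 word R[i]).
Notation S := (@Lop R n R[i]).

Let bS i : bounded_linear (S i) := bl_Lop R[i] i.

Lemma word_op_Lop w (x : H2) v :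
  word_op S w x v = if take (size w) v == w then x (drop (size w) v) else 0.
Proof.
elim: w v => [|i w IH] v; first by rewrite take0 drop0.
rewrite /=; case: v => [|j v]; first by rewrite Lop_nil.
by rewrite Lop_cons /= eqseq_cons IH; case: (j == i).
Qed.

(** The homogeneous component of degree [k] of the series [c] at the left
    creations. *)
Definition level (c : fps R n) k (x : H2) : H2 :=
  \sum_(al : k.-tuple 'I_n) c al *: word_op S al x.

Lemma levelE c k (x : H2) v :
  level c k x v = if (k <= size v)%N then c (take k v) * x (drop k v) else 0.
Proof.
rewrite /level l2_sumE; case: ifP => kv.
  have sz : size (take k v) == k by rewrite size_takel.
  rewrite (bigD1 (Tuple sz)) // big1 ?addr0 => [|al alv].
    rewrite l2scaleE word_op_Lop (eqP sz) /= eqxx; exact: addr0.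
  rewrite l2scaleE word_op_Lop size_tuple ifN ?scaler0 //.
  by apply: contra_neq alv => e; apply: val_inj.
rewrite big1 // => al _; rewrite l2scaleE word_op_Lop size_tuple ifN ?scaler0 //.
apply/eqP => e; have : (size (take k v) = k) by rewrite e size_tuple.
by rewrite size_take_min => /minn_idPl; rewrite kv.
Qed.

Lemma inner_Lop i j (x y : H2) : inner (S i x) (S j y) = if i == j then inner x y else 0.
Proof.
rewrite (adjP (bS i)); case: eqP => [<-|ij].
  congr inner; apply: l2_ext => w.
  by rewrite (adj_reixE (@unconsK n i) (@uncons_ocancel n i)) Lop_cons eqxx.
rewrite (_ : adj _ _ = 0) ?inner0r //; apply: l2_ext => w.
rewrite (adj_reixE (@unconsK n i) (@uncons_ocancel n i)) Lop_cons.
by case: eqP ij.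
Qed.

Lemma inner_word_op al be (x y : H2) : size al = size be ->
  inner (word_op S al x) (word_op S be y) = if al == be then inner x y else 0.
Proof.
elim: al be => [|i al IH] [|j be] //= [/IH E].
by rewrite inner_Lop eqseq_cons E; case: (i == j).
Qed.

(** The operators [S_al] with [size al = k] are isometries with orthogonal
    ranges. *)
Lemma nrm_level (c : H2) k (x : H2) : nrm (level c k x) <= nrm c * nrm x.
Proof.
rewrite -(@ler_pXn2r _ 2) ?nnegrE ?mulr_ge0 ?nrm_ge0 // exprMn.
have -> : nrm (level c k x) ^+ 2 = (\sum_(al : k.-tuple 'I_n) nrm (c al) ^+ 2) * nrm x ^+ 2.
  apply: complexI; rewrite -innerE /level inner_suml mulr_suml rmorph_sum.
  apply: eq_bigr => al _; rewrite inner_sumr (bigD1 al) //= big1 ?addr0 => [|be be_al].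
    by rewrite innerZl innerZr inner_word_op // eqxx mulrA innerE -sqr_normc nrmE
      -rmorphXn -rmorphM.
  rewrite innerZl innerZr inner_word_op ?size_tuple // ifN ?mulr0 //.
  by apply: contra_neq be_al => /val_inj ->.
rewrite ler_wpM2r ?sqr_ge0 //.
rewrite -[leLHS](big_map (fun al : k.-tuple 'I_n => tval al) xpredT (fun w => nrm (c w) ^+ 2)).
apply: sum_uniq_le_nrm; rewrite map_inj_uniq; last exact: val_inj.
by rewrite /index_enum -enumT enum_uniq.
Qed.

Section PoissonTransform.
Variables (c : H2) (r : R).
Hypothesis r01 : 0 < r < 1.
Notation rS := (fun i => r%:C *: S i).

Lemma psum_rS m x :
  psum c rS m x = \sum_(k < m) (r ^+ k)%:C *: level c k x.
Proof. exact: psum_scaled. Qed.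

(** By [nrm_level] the series at [r S] is dominated by a geometric series. *)
Lemma poisson_exists : exists P : H2 -> H2, eval_norm c rS P /\
  forall x v, P x v = \sum_(k < (size v).+1) (r ^+ k)%:C * c (take k v) * x (drop k v).
Proof.
have /andP[r0 r1] := r01; have r1' : 0 < 1 - r by rewrite subr_gt0.
have bY := bl_scaled r%:C bS.
pose q m : R := nrm c * r ^+ m / (1 - r).
have q0 m : 0 <= q m by rewrite divr_ge0 ?mulr_ge0 ?nrm_ge0 ?exprn_ge0 // ltW.
have ex x : exists l : H2, (fun m => psum c rS m x) @ \oo --> l /\
    forall m, nrm (l - psum c rS m x) <= q m * nrm x.
  have [m|m|l l1 l2] := @dominated_cvg _ _ (fun m => psum c rS m x) (fun m => - (q m * nrm x)) 0.
  - rewrite !psum_rS big_ord_recr /= addrAC subrr add0r nrm_real ger0_norm ?exprn_ge0 ?(ltW r0) //.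
    have h : r ^+ m * nrm (level c m x) <= r ^+ m * (nrm c * nrm x).
      by rewrite ler_wpM2l ?nrm_level // exprn_ge0 // ltW.
    apply: le_trans h _.
    rewrite le_eqVlt /q exprS; apply/orP; left; apply/eqP; field.
    by rewrite gt_eqF.
  - by rewrite oppr_le0 mulr_ge0 ?nrm_ge0.
  by exists l; split => // m; apply: le_trans (l2 m) _; rewrite sub0r opprK.
have [P PP] := choice ex; exists P.
have bP : bounded_linear P.
  apply: (@bl_intro _ _ _ _ (q 0%N)) => [x y|a x|x].
  - apply: (hcvg_uniq (PP _).1); rewrite (_ : (fun m => _) =
      (fun m => psum c rS m x + psum c rS m y)).
      exact: cvgD (PP x).1 (PP y).1.
    by apply/funext => m; rewrite (blD (bl_psum c m bY)).
  - apply: (hcvg_uniq (PP _).1); rewrite (_ : (fun m => _) =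
      (fun m => a *: psum c rS m x)).
      exact: cvgZr (PP x).1.
    by apply/funext => m; rewrite (blZ (bl_psum c m bY)).
  - by have := (PP x).2 0%N; rewrite psum_rS big_ord0 subr0.
split.
  apply/(norm_cvgP bP (fun m => bl_psum c m bY)) => e e0.
  have r_lt1 : `|r| < 1 by rewrite ger0_norm // ltW.
  have d0 : 0 < e * (1 - r) / (nrm c + 1) by rewrite divr_gt0 ?mulr_gt0 // ltr_wpDl ?nrm_ge0.
  have /cvgrPdist_le/(_ _ d0) := cvg_expr r_lt1.
  apply: filterS => m; rewrite sub0r normrN ger0_norm ?exprn_ge0 ?(ltW r0) // => h x.
  rewrite nrm_distC; apply: le_trans ((PP x).2 m) _; rewrite ler_wpM2r ?nrm_ge0 //.
  rewrite /q ler_pdivrMr //; move: h; rewrite ler_pdivlMr ?ltr_wpDl ?nrm_ge0 // => h.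
  by apply: le_trans h; rewrite mulrC ler_wpM2l ?exprn_ge0 ?(ltW r0) // lerDl ler01.
move=> x v; apply: (@hcvg_uniq _ (R[i] : hilbertType R) _ \oo _ (fun m => psum c rS m x v)).
  exact: (bl_cvg (bl_coord R[i] v) (PP x).1).
apply: cvg_near_cst; exists (size v).+1 => // m /= vm.
pose F (k : nat) : R[i] :=
  if (k <= size v)%N then (r ^+ k)%:C * c (take k v) * x (drop k v) else 0.
have FE (k : nat) : ((r ^+ k)%:C *: level c k x) v = F k.
  rewrite l2scaleE levelE /F; case: ifP => _; last exact: scaler0.
  by rewrite -[RHS]mulrA.
rewrite psum_rS l2_sumE (eq_bigr (fun k : 'I_m => F k)) //.
rewrite -(subnKC vm) big_split_ord /= [X in _ + X]big1 => [|k _].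
  rewrite [LHS]addr0; apply: eq_bigr => k _.
  by rewrite /F -ltnS ltn_ord.
by rewrite /F ifN // -ltnNge leq_addr.
Qed.

End PoissonTransform.

Section Commuting.
Variable psi : H2 -> H2.
Hypothesis bpsi : bounded_linear psi.
Hypothesis psiR : forall i x, psi (Rop R[i] i x) = Rop R[i] i (psi x).
Notation c := (psi (basis R [::])).

Lemma fmul_Rop_nil (a : fps R n) i (x : H2) : fmul a (Rop R[i] i x) [::] = 0.
Proof. by rewrite /fmul big_ord_recl big_ord0 Rop_nil mulr0 addr0. Qed.

Lemma fmul_Rop_rcons (a : fps R n) j (x : H2) v i :
  fmul a (Rop R[i] j x) (rcons v i) = if i == j then fmul a x v else 0.
Proof.
rewrite /fmul size_rcons big_ord_recr /= drop_oversize ?size_rcons // Rop_nil mulr0 addr0.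
case: ifP => ij; last first.
  by rewrite big1 // => k _; rewrite drop_rcons -1?ltnS // Rop_rcons ij mulr0.
apply: eq_bigr => k _; rewrite drop_rcons -1?ltnS // Rop_rcons ij.
by rewrite -cats1 takel_cat // -ltnS.
Qed.

Lemma bl_fmul (a : fps R n) v : bounded_linear (fun x : H2 => fmul a x v : R[i]).
Proof.
rewrite (_ : (fun x : H2 => fmul a x v) =
  \sum_(k < (size v).+1) (a (take k v) *: (fun x : H2 => x (drop k v) : R[i]))).
  by apply: bl_sumf => k; apply: bl_scalef; apply: bl_coord.
by apply/funext => y; rewrite fct_sumE.
Qed.

(** An operator commuting with the right creations is the left multiplication by
    its value at the empty word: a last letter can be taken out on both
    sides. *)
Lemma commuting_fmul (x : H2) v : psi x v = fmul c x v.
Proof.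
apply: (@eq_on_single _ _ R[i] _ (fun x => psi x v) (fun x => fmul c x v)) => [||w k].
- exact: (bl_comp (bl_coord R[i] v) bpsi).
- exact: bl_fmul.
elim/last_ind: w v => [|w j IH] v.
  have -> : psi (single [::] k) = k *: c by rewrite (basisE [::] k) (blZ bpsi).
  rewrite l2scaleE /fmul big_ord_recr take_size drop_size big1 => [|i _].
    by rewrite [RHS]add0r [RHS]mulrC.
  rewrite /= ifN ?mulr0 // -size_eq0 size_drop subn_eq0 -ltnNge.
  exact: ltn_ord.
have -> : single (rcons w j) k = Rop R[i] j (single w k).
  by rewrite /Rop (reix_single (@unrconsK n j) (@unrcons_ocancel n j)).
rewrite psiR; case/lastP: v => [|v i]; first by rewrite Rop_nil fmul_Rop_nil.
by rewrite Rop_rcons fmul_Rop_rcons IH.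
Qed.

Section Radial.
Variable r : R.
Hypothesis r01 : 0 < r < 1.
Variable P : H2 -> H2.
Hypothesis bP : bounded_linear P.
Hypothesis PE : forall x v,
  P x v = \sum_(k < (size v).+1) (r ^+ k)%:C * c (take k v) * x (drop k v).
Variable M : R.
Hypotheses (M0 : 0 < M) (psiM : forall x, nrm (psi x) <= M * nrm x).

Let r01' : 0 <= r <= 1.
Proof. by have /andP[/ltW-> /ltW->] := r01. Qed.

Lemma poisson_dil x : P (dil r x) = dil r (psi x).
Proof.
apply: l2_ext => v; rewrite PE (diagE (dil_itv r01')) commuting_fmul /fmul.
rewrite scaler_sumr; apply: eq_bigr => k _.
rewrite (diagE (dil_itv r01')) size_drop.
have kv : (k <= size v)%N by rewrite -ltnS.
rewrite -[X in _ * X]/((r ^+ (size v - k))%:C * x (drop k v)).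
rewrite -[RHS]/((r ^+ size v)%:C * (c (take k v) * x (drop k v))).
have -> : r ^+ size v = r ^+ k * r ^+ (size v - k) by rewrite -exprD subnKC.
rewrite rmorphM; ring.
Qed.

Let G j : H2 -> H2 := diag (fun w : word => pgam r j (size w)).
Let Gi j (w : word) : 0 <= pgam r j (size w) <= 1 := pgam_itv r01 j (size w).

(** The operators [pwt j G_j^2] add up to at most [I], by [sum_pgam_le]. *)
Lemma poisson_energy m (x : H2) :
  \sum_(j < m) pwt r j * nrm (G j x) ^+ 2 <= nrm x ^+ 2.
Proof.
pose d (w : word) := \sum_(j < m) pwt r j * pgam r j (size w) ^+ 2.
have d1 w : 0 <= d w <= 1.
  rewrite sum_pgam_le // andbT; apply: sumr_ge0 => j _.
  by rewrite mulr_ge0 ?sqr_ge0 ?pwt_ge0.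
have -> : \sum_(j < m) pwt r j * nrm (G j x) ^+ 2 = complex.Re (inner (diag d x) x).
  have -> : diag d x = \sum_(j < m) (pwt r j)%:C *: G j (G j x).
    apply: l2_ext => w; rewrite (diagE d1) l2_sumE rmorph_sum scaler_suml.
    apply: eq_bigr => j _; rewrite l2scaleE !(diagE (Gi j)) !scalerA -!rmorphM.
    by rewrite expr2 mulrA.
  rewrite inner_suml (big_morph (@complex.Re R) (id1 := 0) (op1 := +%R)) //; last by case=> ? ? [].
  apply: eq_bigr => j _; rewrite innerZl (inner_diag (Gi j)) innerE -rmorphM.
  by [].
apply: le_trans (Re_cauchy_schwarz _ _) _; rewrite expr2 ler_wpM2r ?nrm_ge0 //.
exact: nrm_diag.
Qed.

(** The dilate [psi (r S)] is the average of the compressions [G_j psi G_j],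
    because [psi (r S)] has the factor [r^k] where [psi] changes the length of
    words by [k]. *)
Lemma poisson_finite m (x : H2) : (forall v, (m <= size v)%N -> x v = 0) ->
  P x = \sum_(j < m) (pwt r j)%:C *: G j (psi (G j x)).
Proof.
move=> x0; apply: l2_ext => v; rewrite PE l2_sumE.
have E (j : 'I_m) : ((pwt r j)%:C *: G j (psi (G j x))) v =
    \sum_(k < (size v).+1) (pwt r j * (pgam r j (size v) * pgam r j (size v - k)))%:C *
      (c (take k v) * x (drop k v)).
  rewrite l2scaleE (diagE (Gi j)) commuting_fmul scalerA -rmorphM scaler_sumr.
  apply: eq_bigr => k _; rewrite (diagE (Gi j)) size_drop.
  rewrite -[X in _ *: (_ * X)]/((pgam r j (size v - k))%:C * x (drop k v)).
  rewrite -[LHS]/((pwt r j * pgam r j (size v))%:C *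
    (c (take k v) * ((pgam r j (size v - k))%:C * x (drop k v)))).
  by rewrite !rmorphM; ring.
rewrite (eq_bigr _ (fun j _ => E j)) exchange_big /=; apply: eq_bigr => k _.
rewrite -mulr_suml -rmorph_sum; have kv : (k <= size v)%N by rewrite -ltnS.
have [vm|vm] := leqP m (size v - k).
  by rewrite x0 ?size_drop // !mulr0.
by rewrite sum_pgam_mul ?leq_subr // subKn // mulrA.
Qed.

(** An average of compressions of [psi] is not larger than [psi]: by
    Cauchy-Schwarz in each term, [|P x|^2] is at most half of
    [M^2 |x|^2 + |P x|^2]. *)
Lemma nrm_poisson x : nrm (P x) <= M * nrm x.
Proof.
have fin m (y : H2) : (forall v, (m <= size v)%N -> y v = 0) -> nrm (P y) <= M * nrm y.
  move=> y0; rewrite -(@ler_pXn2r _ 2) ?nnegrE ?mulr_ge0 ?nrm_ge0 ?(ltW M0) // exprMn.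
  have h : nrm (P y) ^+ 2 <= \sum_(j < m)
      (M ^+ 2 * (pwt r j * nrm (G j y) ^+ 2) + pwt r j * nrm (G j (P y)) ^+ 2) / 2.
    rewrite -Re_inner {1}(poisson_finite y0) inner_suml.
    rewrite (big_morph (@complex.Re R) (id1 := 0) (op1 := +%R)) //; last by case=> ? ? [].
    apply: ler_sum => j _; rewrite innerZl (inner_diag (Gi j)).
    have w0 := pwt_ge0 r01 j; have cs := Re_cauchy_schwarz (psi (G j y)) (G j (P y)).
    rewrite (_ : complex.Re _ = pwt r j * complex.Re (inner (psi (G j y)) (G j (P y)))); last first.
      by case: (inner _ _) => a b /=; ring.
    have pM := psiM (G j y).
    move: cs pM; set a := complex.Re _; set b := nrm (psi _); set e := nrm (G j y).
    set f := nrm (G j (P y)) => cs pM; have f0 : 0 <= f by apply: nrm_ge0.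
    have h1 : a <= M * e * f by apply: le_trans cs _; rewrite ler_wpM2r.
    have h2 : M * e * f <= (M ^+ 2 * e ^+ 2 + f ^+ 2) / 2.
      by have := sqr_ge0 (M * e - f); lra.
    have := ler_wpM2l w0 (le_trans h1 h2); lra.
  have := h; rewrite -mulr_suml big_split -mulr_sumr /=.
  have h1 := poisson_energy m y; have h2 := poisson_energy m (P y).
  have h3 : M ^+ 2 * (\sum_(j < m) pwt r j * nrm (G j y) ^+ 2) <= M ^+ 2 * nrm y ^+ 2.
    by rewrite ler_wpM2l ?sqr_ge0.
  lra.
have cv := @trunc_cvg R n R[i] x.
have h1 : (fun m => nrm (P (trunc m x))) @ \oo --> nrm (P x).
  exact: nrm_cvg_real (bl_cvg bP cv).
have h2 : (fun m => M * nrm (trunc m x)) @ \oo --> M * nrm x.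
  by apply: cvgMr; exact: nrm_cvg_real cv.
apply: (ler_cvg_to h1 h2); apply: nearW => m; apply: (fin m) => v vm.
by rewrite truncE ltnNge vm.
Qed.

End Radial.

(** With [D] the dilation by [r], [psi (r S) D = D psi]. So
    [psi x - psi (r S) x] is the sum of [psi x - D (psi x)], which
    tends to [0], and [psi (r S) (D x - x)], which tends to [0] because
    the [psi (r S)] are uniformly bounded. *)
Lemma commuting_eval_rad : eval_rad c S psi.
Proof.
have [M M0 psiM] := bl_bound bpsi.
have [r|P PP] := @choice R (H2 -> H2) (fun r P => 0 < r < 1 ->
    eval_norm c (fun i => r%:C *: S i) P /\
    forall x v, P x v = \sum_(k < (size v).+1) (r ^+ k)%:C * c (take k v) * x (drop k v)).
  have [r01|] := boolP (0 < r < 1); last by exists (cst 0).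
  by have [P PP] := poisson_exists c r01; exists P.
have half : 0 < (2%:R^-1 : R) < 1 by rewrite invr_gt0 ltr0n invf_lt1 ?ltr1n.
have half' (r : R) : 2%:R^-1 < r < 1 -> 0 < r < 1.
  by case/andP=> h ->; rewrite andbT (lt_trans _ h) //; case/andP: half.
exists 2%:R^-1, P; split=> // [r /half' r01|]; first by case: (PP r r01).
split=> // x; apply/cvg_nrmP => e e0.
have d0 : 0 < e / 2 / M by rewrite !divr_gt0.
have /cvg_nrmP/(_ _ d0) h1 := @dil_cvg R n _ x.
have e2 : 0 < e / 2 by rewrite divr_gt0.
have /cvg_nrmP/(_ _ e2) h2 := @dil_cvg R n _ (psi x).
move: (at_left1_itv R) h1 h2; apply: filterS3 => r r01 h1 h2.
have [ev PE] := PP r r01; have bP := ev.1.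
have -> : psi x - P r x = (psi x - dil r (psi x)) + P r (dil r x - x).
  by rewrite (blB bP) (poisson_dil r01 PE) subrKA.
apply: le_trans (ler_nrmD _ _) _; rewrite [e]splitr lerD //.
apply: le_trans (nrm_poisson r01 bP PE M0 psiM _) _.
by rewrite nrm_distC mulrC -ler_pdivlMr.
Qed.

End Commuting.

End Commutant.

(** * Composition of formal series *)

Section FormalSeries.
Variables (R : realType) (n : nat).
Notation word := (seq 'I_n).
Notation H2 := (l2 word R[i]).
Implicit Types (a b c p q : fps R n) (f g h : 'I_n -> fps R n) (w v : word).

(** The identity [a = a [::] + \sum_i Z_i * fder i a] allows inductions on
    words. *)
Definition fder i a : fps R n := fun w => a (i :: w).

Lemma fmul_nil a b : fmul a b [::] = a [::] * b [::].
Proof. by rewrite /fmul big_ord_recl big_ord0 addr0. Qed.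

Lemma fmul_cons a b i w : fmul a b (i :: w) = a [::] * b (i :: w) + fmul (fder i a) b w.
Proof. by rewrite /fmul big_ord_recl. Qed.

Lemma fmulDl a b c w : fmul (a + b) c w = fmul a c w + fmul b c w.
Proof. by rewrite /fmul -big_split; apply: eq_bigr => k _; rewrite mulrDl. Qed.

Lemma fmulZl (x : R[i]) a c w : fmul (x *: a) c w = x * fmul a c w.
Proof. by rewrite /fmul mulr_sumr; apply: eq_bigr => k _; rewrite mulrA. Qed.

Lemma fmulDr a b c w : fmul a (b + c) w = fmul a b w + fmul a c w.
Proof. by rewrite /fmul -big_split; apply: eq_bigr => k _; rewrite mulrDr. Qed.

Lemma fmulZr (x : R[i]) a c w : fmul a (x *: c) w = x * fmul a c w.
Proof. by rewrite /fmul mulr_sumr; apply: eq_bigr => k _; rewrite mulrCA. Qed.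

Lemma fmul0l a w : fmul 0 a w = 0.
Proof. by rewrite /fmul big1 // => k _; rewrite mul0r. Qed.

Lemma fmul0r a w : fmul a 0 w = 0.
Proof. by rewrite /fmul big1 // => k _; rewrite mulr0. Qed.

Lemma fmul_suml I (r : seq I) (F : I -> fps R n) (c : I -> R[i]) b :
  fmul (\sum_(i <- r) c i *: F i) b = \sum_(i <- r) c i *: fmul (F i) b.
Proof.
elim: r => [|i r IH]; first by rewrite !big_nil; apply/funext => w; exact: fmul0l.
by rewrite !big_cons -IH; apply/funext => w; rewrite fmulDl fmulZl.
Qed.

Lemma fmul_sumr I (r : seq I) (F : I -> fps R n) (c : I -> R[i]) b :
  fmul b (\sum_(i <- r) c i *: F i) = \sum_(i <- r) c i *: fmul b (F i).
Proof.
elim: r => [|i r IH]; first by rewrite !big_nil; apply/funext => w; exact: fmul0r.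
by rewrite !big_cons -IH; apply/funext => w; rewrite fmulDr fmulZr.
Qed.

Lemma fmulA a b c : fmul a (fmul b c) = fmul (fmul a b) c.
Proof.
apply/funext => w; elim: w a b => [|i w IH] a b; first by rewrite !fmul_nil mulrA.
rewrite !fmul_cons fmul_nil IH mulrDr !mulrA -addrA; congr (_ + _).
rewrite -fmulZl -fmulDl; congr (fmul _ c w); apply/funext => v.
by rewrite /fder fmul_cons.
Qed.

Lemma fmul1l a : fmul (@fone R n) a = a.
Proof.
apply/funext => -[|i w]; first by rewrite fmul_nil /fone eqxx mul1r.
rewrite fmul_cons /fone eqxx mul1r (_ : fder i _ = 0) ?fmul0l ?addr0 //.
Qed.

Lemma fmul1r a : fmul a (@fone R n) = a.
Proof.
apply/funext => w; elim: w a => [|i w IH] a; first by rewrite fmul_nil /fone eqxx mulr1.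
by rewrite fmul_cons IH /fone /= mulr0 add0r.
Qed.

Lemma fmul_fZ_nil i a : fmul (fZ R i) a [::] = 0.
Proof. by rewrite fmul_nil /fZ mul0r. Qed.

Lemma fmul_fZ_cons i a j w : fmul (fZ R i) a (j :: w) = if j == i then a w else 0.
Proof.
rewrite fmul_cons /fZ /= mul0r add0r; case: eqP => [->|ji].
  rewrite (_ : fder i _ = @fone R n) ?fmul1l //; apply/funext => v.
  by rewrite /fder /fone eqseq_cons eqxx.
rewrite (_ : fder j _ = 0) ?fmul0l //; apply/funext => v.
by rewrite /fder eqseq_cons; case: eqP.
Qed.

Lemma fmul_fZ_Lop i (x : H2) w : fmul (fZ R i) x w = Lop R[i] i x w.
Proof.
case: w => [|j w]; first by rewrite fmul_fZ_nil Lop_nil.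
by rewrite fmul_fZ_cons Lop_cons.
Qed.

Lemma fword_cat f v w : fword f (v ++ w) = fmul (fword f v) (fword f w).
Proof. by elim: v => [|i v IH] /=; [rewrite fmul1l|rewrite IH fmulA]. Qed.

Lemma fword_rcons f w i : fword f (rcons w i) = fmul (fword f w) (f i).
Proof. by rewrite -cats1 fword_cat /= fmul1r. Qed.

Lemma fcomp_ltE d c f : fcomp_lt d c f = \sum_(w <- words n d) c w *: fword f w.
Proof.
apply/funext => v; rewrite /fcomp_lt (sum_words d (fun al => c al * fword f al v)).
by rewrite fct_sumE.
Qed.

Lemma fcomp_lt_at d c f v : fcomp_lt d c f v = \sum_(w <- words n d) c w * fword f w v.
Proof. by rewrite fcomp_ltE fct_sumE. Qed.

Lemma sum_words_stable (V : nmodType) m d (F : word -> V) : (m <= d)%N ->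
  (forall w, (m <= size w)%N -> F w = 0) -> \sum_(w <- words n d) F w = \sum_(w <- words n m) F w.
Proof.
move=> md F0; rewrite -!sum_words -(subnKC md) big_split_ord /= [X in _ + X]big1 ?addr0 //.
by move=> k _; rewrite big1 // => al _; rewrite F0 // size_tuple leq_addr.
Qed.

End FormalSeries.

Section ModelS.
Variables (R : realType) (n : nat).
Notation word := (seq 'I_n).
Notation H2 := (l2 word R[i]).
Variable f : 'I_n -> fps R n.
Hypothesis f0 : forall i, f i [::] = 0.
Implicit Types (a c : fps R n) (w : word).

(** The [f i] have no constant term, thus [f_al] has no term of degree less
    than [size al]. *)
Lemma fword_low al w : (size w < size al)%N -> fword f al w = 0.
Proof.
elim: al w => [//|i al IH] [|j w] /=; first by rewrite fmul_nil f0 mul0r.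
rewrite !ltnS => h; rewrite fmul_cons f0 mul0r add0r /fmul big1 // => k _.
by rewrite IH ?mulr0 // size_drop (leq_ltn_trans (leq_subr _ _)).
Qed.

(** The terms of degree [size al] of [f_al] only involve the linear
    coefficients of [f]. *)
Lemma fword_diag i al j w : size al = size w ->
  fword f (i :: al) (j :: w) = f i [:: j] * fword f al w.
Proof.
move=> sz; rewrite /= fmul_cons f0 mul0r add0r /fmul big_ord_recl /= take0 drop0.
rewrite /fder big1 ?addr0 // => k _; rewrite fword_low ?mulr0 // sz size_drop.
rewrite /bump /= add1n; case: w {sz} k => [[]//|j' w] k /=.
by rewrite subSS ltnS leq_subr.
Qed.

Lemma fcomp_stable c d w : (size w < d)%N -> fcomp c f w = fcomp_lt d c f w.
Proof.
move=> wd; rewrite /fcomp !fcomp_lt_at (sum_words_stable wd) // => al al_w.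
by rewrite fword_low ?mulr0.
Qed.

Lemma fmul_fcompr a c w :
  fmul a (fcomp c f) w = \sum_(al <- words n (size w).+1) c al * fmul a (fword f al) w.
Proof.
transitivity (fmul a (fcomp_lt (size w).+1 c f) w).
  apply: eq_bigr => k _; rewrite (@fcomp_stable _ (size w).+1) //.
  by rewrite ltnS size_drop leq_subr.
by rewrite fcomp_ltE fmul_sumr fct_sumE.
Qed.

Lemma fmul_fcompl a c w :
  fmul (fcomp c f) a w = \sum_(al <- words n (size w).+1) c al * fmul (fword f al) a w.
Proof.
transitivity (fmul (fcomp_lt (size w).+1 c f) a w).
  apply: eq_bigr => k _; rewrite (@fcomp_stable _ (size w).+1) //.
  by rewrite ltnS size_take_min geq_minr.
by rewrite fcomp_ltE fmul_suml fct_sumE.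
Qed.

(** In the basis [f_al], the left creations are the left multiplications by the
    [f j]. *)
Lemma fcomp_Lop j (c : H2) : fcomp (Lop R[i] j c) f = fmul (f j) (fcomp c f).
Proof.
apply/funext => w; rewrite fmul_fcompr (@fcomp_stable _ (size w).+2) //.
rewrite fcomp_lt_at sum_words_cons Lop_nil mul0r add0r (bigD1 j) //=.
rewrite [X in _ + X]big1 ?addr0 => [|i ij].
  by apply: eq_bigr => al _; rewrite Lop_cons eqxx.
by rewrite big1 // => al _; rewrite Lop_cons (negbTE ij) mul0r.
Qed.

Lemma fcomp_Rop j (c : H2) : fcomp (Rop R[i] j c) f = fmul (fcomp c f) (f j).
Proof.
apply/funext => w; rewrite fmul_fcompl (@fcomp_stable _ (size w).+2) //.
rewrite fcomp_lt_at sum_words_rcons Rop_nil mul0r add0r (bigD1 j) //=.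
rewrite [X in _ + X]big1 ?addr0 => [|i ij].
  by apply: eq_bigr => al _; rewrite Rop_rcons eqxx fword_rcons.
by rewrite big1 // => al _; rewrite Rop_rcons (negbTE ij) mul0r.
Qed.

Hypothesis detf : \det (\matrix_(i, j) f i [:: j]) != 0.

Lemma linear_part_inj (y : 'I_n -> R[i]) :
  (forall j, \sum_i f i [:: j] * y i = 0) -> forall i, y i = 0.
Proof.
move=> yF; pose F := (\matrix_(i, j) f i [:: j])%R.
have Fu : F \in unitmx by rewrite unitmxE unitfE.
pose v : 'rV_n := \row_i y i.
have v0 : v *m F = 0.
  apply/rowP => j; rewrite !mxE -[RHS](yF j); apply: eq_bigr => i _.
  by rewrite !mxE mulrC.
move=> i; have := congr1 (mulmx^~ (invmx F)) v0; rewrite mulmxK // mul0mx.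
by move=> /rowP/(_ i); rewrite !mxE.
Qed.

(** The terms of lowest degree of [c] composed with [f] are obtained by
    substituting the linear part of [f], which is invertible: it can be inverted
    one letter at a time. *)
Lemma fcomp_hom_inj m c : (forall al, size al != m -> c al = 0) ->
  (forall w, size w = m -> fcomp_lt m.+1 c f w = 0) -> forall al, c al = 0.
Proof.
elim: m c => [|m IH] c cm cf al.
  have [sz|sz] := eqVneq (size al) 0%N; last exact: cm.
  rewrite (size0nil sz); have := cf [::] erefl.
  rewrite fcomp_lt_at sum_words_cons big1 ?addr0 /= ?mulr1 //.
  by move=> i _; rewrite /words big_nil.
have [sz|sz] := eqVneq (size al) m.+1; last exact: cm.
case: al sz => [//|i al] /= [sz]; have cn : c [::] = 0 by apply: cm.
suff h : forall i' w, size w = m -> fcomp_lt m.+1 (fder i' c) f w = 0.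
  have cm' be : size be != m -> fder i c be = 0 by move=> szb; apply: cm.
  exact: (IH (fder i c) cm' (h i) al).
move=> i' w szw; apply: (linear_part_inj (y := fun i => fcomp_lt m.+1 (fder i c) f w)) => j.
rewrite -[RHS](cf (j :: w)) /= ?szw // fcomp_lt_at sum_words_cons cn mul0r add0r.
apply: eq_bigr => k _; rewrite fcomp_lt_at mulr_sumr; apply: eq_bigr => be _.
have [szb|szb] := eqVneq (size be) m.
  by rewrite fword_diag ?szb // mulrCA.
by rewrite /fder cm ?mul0r ?mulr0 //= eqSS.
Qed.

(** Its component of lowest degree would contradict [fcomp_hom_inj]. *)
Lemma fcomp_ker c : (forall w, fcomp c f w = 0) -> forall al, c al = 0.
Proof.
move=> c0 al; have [m] := ubnP (size al); elim: m al => [//|m IH] al.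
rewrite ltnS leq_eqVlt => /orP[/eqP sz|/IH//].
pose c' : fps R n := fun w => if size w == m then c w else 0.
have -> : c al = c' al by rewrite /c' sz eqxx.
apply: (@fcomp_hom_inj m) => [be|w szw]; first by rewrite /c' => /negbTE ->.
rewrite -[RHS](c0 w) /fcomp szw !fcomp_lt_at big_seq [RHS]big_seq.
apply: eq_bigr => be; rewrite mem_words ltnS leq_eqVlt /c' => /orP[->//|be_m].
by rewrite (IH be be_m) (ltn_eqF be_m).
Qed.

Lemma fcomp_inj (x y : H2) : fcomp x f = fcomp y f -> x = y.
Proof.
move=> xy; apply/eqP; rewrite -subr_eq0; apply/eqP; apply: l2_ext => w.
apply: (fcomp_ker (c := x - y)) => v.
rewrite /fcomp fcomp_lt_at.
under eq_bigr do rewrite l2subE mulrBl.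
rewrite sumrB -!fcomp_lt_at -/(fcomp x f v) -/(fcomp y f v) xy subrr //.
Qed.

End ModelS.

Section ModelA.
Variables (R : realType) (n : nat).
Notation word := (seq 'I_n).
Implicit Types (a c p q : fps R n) (f g h : 'I_n -> fps R n) (w v : word).

(** [q] is the composition of the polynomial [p] with [g]: a relation, because
    the degree bound [d] from which on [fcomp_lt d p g] is stationary is not
    part of [p]. *)
Definition fsubst g p q := exists2 d, deg_lt d p & fcomp_lt d p g = q.

Lemma fcomp_lt_stable d d' p g : deg_lt d p -> (d <= d')%N ->
  fcomp_lt d' p g = fcomp_lt d p g.
Proof.
move=> dp dd; rewrite !fcomp_ltE (sum_words_stable dd) // => w dw.
by rewrite dp // scale0r.
Qed.

Lemma fsubst_fun g p q q' : fsubst g p q -> fsubst g p q' -> q = q'.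
Proof.
move=> [d dp <-] [d' dp' <-].
rewrite -(fcomp_lt_stable g dp (leq_maxl d d')).
by rewrite -(fcomp_lt_stable g dp' (leq_maxr d d')).
Qed.

Lemma fsubst0 g : fsubst g 0 0.
Proof. by exists 0%N => //; rewrite fcomp_ltE /words big_nil. Qed.

Lemma fsubstD g p q p' q' : fsubst g p q -> fsubst g p' q' -> fsubst g (p + p') (q + q').
Proof.
move=> [d dp <-] [d' dp' <-]; exists (maxn d d').
  by move=> w; rewrite geq_max => /andP[/dp h /dp' h']; rewrite fctE h h' addr0.
rewrite -(fcomp_lt_stable g dp (leq_maxl d d')) -(fcomp_lt_stable g dp' (leq_maxr d d')).
by rewrite !fcomp_ltE -big_split; apply: eq_bigr => w _; exact: scalerDl.
Qed.

Lemma fsubstZ g x p q : fsubst g p q -> fsubst g (x *: p) (x *: q).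
Proof.
move=> [d dp <-]; exists d; first by move=> w /dp h; rewrite fctE h scaler0.
by rewrite !fcomp_ltE scaler_sumr; apply: eq_bigr => w _; rewrite scalerA.
Qed.

Lemma fsubst_sum g I (r : seq I) (F G : I -> fps R n) (c : I -> R[i]) :
  (forall i, fsubst g (F i) (G i)) ->
  fsubst g (\sum_(i <- r) c i *: F i) (\sum_(i <- r) c i *: G i).
Proof.
move=> FG; elim: r => [|i r IH]; first by rewrite !big_nil; apply: fsubst0.
by rewrite !big_cons; apply: fsubstD => //; apply: fsubstZ.
Qed.

Definition mono w : fps R n := fun v => (v == w)%:R.

Lemma fword_fZ w : fword (@fZ R n) w = mono w.
Proof.
elim: w => [//|i w /= ->]; apply/funext => -[|j v]; first by rewrite fmul_fZ_nil.
by rewrite fmul_fZ_cons /mono eqseq_cons; case: (j == i).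
Qed.

Lemma mono_cat v w : fmul (mono v) (mono w) = mono (v ++ w).
Proof. by rewrite -!fword_fZ fword_cat. Qed.

Lemma mono_sum d p : deg_lt d p -> p = \sum_(w <- words n d) p w *: mono w.
Proof.
move=> dp; apply/funext => v; rewrite fct_sumE (@sum_words_delta _ _ _ _ v).
  rewrite /mono fctE eqxx; case: ltnP => [_|/dp//].
  by rewrite -[RHS]/(p v * 1) mulr1.
by move=> w wv; rewrite fctE /mono eq_sym (negbTE wv) scaler0.
Qed.

Lemma fsubst_mono g w : fsubst g (mono w) (fword g w).
Proof.
exists (size w).+1; first by move=> v vw; rewrite /mono; case: eqP vw => // ->; rewrite ltnn.
rewrite fcomp_ltE (@sum_words_delta _ _ _ _ w) ?ltnSn /mono ?eqxx ?scale1r //.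
by move=> v /negbTE ->; rewrite scale0r.
Qed.

Lemma fsubst_mul g p q p' q' : fsubst g p q -> fsubst g p' q' ->
  fsubst g (fmul p p') (fmul q q').
Proof.
move=> [d dp <-] [d' dp' <-].
have -> : fmul p p' =
    \sum_(w <- words n d) p w *: \sum_(v <- words n d') p' v *: mono (w ++ v).
  rewrite {1}(mono_sum dp) fmul_suml; apply: eq_bigr => w _; congr (_ *: _).
  rewrite {1}(mono_sum dp') fmul_sumr; apply: eq_bigr => v _.
  by rewrite mono_cat.
rewrite !fcomp_ltE fmul_suml; apply: fsubst_sum => w.
rewrite fmul_sumr; apply: fsubst_sum => v.
by rewrite -fword_cat; apply: fsubst_mono.
Qed.

Lemma fsubst_word g f h w : (forall i, fsubst g (f i) (h i)) ->
  fsubst g (fword f w) (fword h w).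
Proof.
move=> fh; elim: w => [|i w IH]; first exact: (fsubst_mono g [::]).
exact: fsubst_mul.
Qed.

Lemma fsubst_retract g f d p : (forall i, fsubst g (f i) (fZ R i)) -> deg_lt d p ->
  fsubst g (fcomp_lt d p f) p.
Proof.
move=> fg dp; rewrite {2}(mono_sum dp) fcomp_ltE; apply: fsubst_sum => w.
by rewrite -fword_fZ; apply: fsubst_word.
Qed.

(** Composing with [g] recovers a polynomial from its composition with [f]. *)
Lemma fsubst_inj g f p p' q : (forall i, fsubst g (f i) (fZ R i)) ->
  fsubst f p q -> fsubst f p' q -> p = p'.
Proof.
move=> fg [d dp pq] [d' dp' pq'].
have h := fsubst_retract fg dp; have h' := fsubst_retract fg dp'.
by rewrite pq in h; rewrite pq' in h'; apply: fsubst_fun h h'.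
Qed.

End ModelA.

(** * The common content of the three model properties *)

Section Models.
Variables (R : realType) (n : nat).
Notation word := (seq 'I_n).
Notation H2 := (l2 word R[i]).
Notation S := (fun i : 'I_n => Lop R[i] i).
Notation Rr := (fun i : 'I_n => Rop R[i] i).
Implicit Types (f : 'I_n -> fps R n) (g : 'I_n -> H2) (M : 'I_n -> H2 -> H2).

(** All that matters of the model property: [f] evaluated at the universal model
    is the tuple of left creations, and the universal model commutes with the
    right creations. *)
Record universal f M : Prop := Universal {
  univ_bl : forall i, bounded_linear (M i);
  univ_eval : eval_spec f M S;
  univ_comm : forall i j x, M i (Rr j x) = Rr j (M i x)
}.

Let bS i : bounded_linear (S i) := bl_Lop R[i] i.

Lemma mono_basis (w : word) : mono R w = basis R w.
Proof. by apply/funext => v; rewrite /mono /=; case: eqP. Qed.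

(** Composition with [f] is injective on polynomials, so that [M i] is the left
    multiplication by the polynomial [g i]; the composition of [f] with [g] is
    the tuple of the [Z_i]. *)
Lemma model_A_universal f g M : model_A f g M -> universal f M.
Proof.
move=> [d [df dg fg gf HM]].
have sg i : fsubst (fun j => g j) (f i) (fZ R i) by exists d => //; exact: fg.
have sf i : fsubst f (g i) (fZ R i) by exists d => //; exact: gf.
have bM i : bounded_linear (M i) by case: (HM i).
have ME i x v : M i x v = fmul (g i) x v.
  apply: (@eq_on_single _ _ R[i] _ (fun x => M i x v) (fun x => fmul (g i) x v)) => [||w k].
  - exact: (bl_comp (bl_coord R[i] v) (bM i)).
  - exact: bl_fmul.
  rewrite (basisE w k) (blZ (bM i)) l2scaleE -/(basis R w).
  have -> : fmul (g i) (k *: basis R w) v = k * fmul (g i) (basis R w) v by exact: fmulZr.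
  congr (_ * _); have [_ /(_ w)[d' Md Mc]] := HM i.
  have E : l2fun (M i (basis R w)) = fmul (g i) (basis R w).
    apply: (fsubst_inj sg (q := fmul (fZ R i) (fword f w))); first by exists d'.
    by apply: fsubst_mul (sf i) _; rewrite -mono_basis; apply: fsubst_mono.
  by rewrite E.
have bSM i : eval_sot (f i) M (S i).
  split=> // x; apply: cvg_near_cst; exists d => // m /= dm; apply: l2_ext => v.
  rewrite psumE l2_sumE -fmul_fZ_Lop -fg -(fcomp_lt_stable _ (df i) dm) fcomp_ltE fmul_suml.
  rewrite fct_sumE; apply: eq_bigr => w _; rewrite l2scaleE.
  rewrite -[RHS]/(f i w * fmul (fword (fun j => g j) w) x v); congr (_ * _).
  elim: w v => [|j w IH] v; first by rewrite /= fmul1l.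
  rewrite -[LHS]/(M j (word_op M w x) v) ME -[fword _ _]/(fmul (g j) (fword _ w)).
  rewrite -fmulA; congr (fmul _ _ v); apply/funext => u; exact: IH.
split=> //; first by left.
move=> i j x; apply: l2_ext => v; rewrite ME; case/lastP: v => [|v k].
  by rewrite fmul_Rop_nil Rop_nil.
by rewrite fmul_Rop_rcons Rop_rcons ME.
Qed.

(** Composition with [f] is injective on formal series, and turns [L j] and the
    left creation [S j] into the same multiplication. *)
Lemma model_S_universal f g M : model_S f g M -> universal f M.
Proof.
move=> [f0 _ detf _ [HM [L HL fML]]].
have LS : L = S.
  apply/funext => j; apply/funext => x; apply: (fcomp_inj f0 detf).
  by rewrite (HL j).2 fcomp_Lop.
split; [by move=> i; case: (HM i)|by rewrite -LS|].
move=> i j x; apply: (fcomp_inj f0 detf).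
by rewrite (HM i).2 !fcomp_Rop // (HM i).2 fmulA.
Qed.

Section Functions.
Variable H : hilbertType R.
Implicit Types (X Z : 'I_n -> H -> H) (b c : fps R n).

Lemma eval_norm_uniq b Z V V' : (forall i, bounded_linear (Z i)) ->
  eval_norm b Z V -> eval_norm b Z V' -> V = V'.
Proof.
move=> bZ h h'; apply/funext => x.
exact: (hcvg_uniq (@eval_norm_pt _ _ _ _ _ _ bZ h x) (@eval_norm_pt _ _ _ _ _ _ bZ h' x)).
Qed.

Lemma eval_norm_family f X Z Z' : (forall i, bounded_linear (X i)) ->
  (forall i, eval_norm (f i) X (Z i)) -> (forall i, eval_norm (f i) X (Z' i)) -> Z = Z'.
Proof. by move=> bX h h'; apply/funext => i; apply: eval_norm_uniq bX (h i) (h' i). Qed.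

Lemma psum_Rop (c : H2) Z j m x : (forall i, bounded_linear (Z i)) ->
  psum (Rr j c) Z m.+1 x = psum c Z m (Z j x).
Proof.
move=> bZ; rewrite !psumE sum_words_rcons Rop_nil scale0r add0r (bigD1 j) //=.
rewrite [X in _ + X]big1 ?addr0 => [|i ij].
  by apply: eq_bigr => w _; rewrite Rop_rcons eqxx -cats1 word_op_cat.
by rewrite big1 // => w _; rewrite Rop_rcons (negbTE ij) scale0r.
Qed.

Lemma psum_Lop (c : H2) Z j m x : (forall i, bounded_linear (Z i)) ->
  psum (S j c) Z m.+1 x = Z j (psum c Z m x).
Proof.
move=> bZ; rewrite !psumE sum_words_cons Lop_nil scale0r add0r (bigD1 j) //=.
rewrite [X in _ + X]big1 ?addr0 => [|i ij].
  by rewrite (bl_sum (bZ j)); apply: eq_bigr => w _; rewrite Lop_cons eqxx (blZ (bZ j)).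
by rewrite big1 // => w _; rewrite Lop_cons (negbTE ij) scale0r.
Qed.

Lemma eval_norm_Rop (c : H2) Z j V : (forall i, bounded_linear (Z i)) ->
  eval_norm c Z V -> eval_norm (Rr j c) Z (V \o Z j).
Proof.
move=> bZ h; have bV := h.1; have [K K0 ZK] := bl_bound (bZ j).
apply/(norm_cvgP (bl_comp bV (bZ j)) (fun m => bl_psum _ m bZ)) => e e0.
move/(norm_cvgP bV (fun m => bl_psum c m bZ)) : h => /(_ _ (divr_gt0 e0 K0))[N _ h].
exists N.+1 => // -[//|m] /= Nm x; rewrite psum_Rop //.
apply: le_trans (h m Nm (Z j x)) _.
apply: le_trans (ler_wpM2l _ (ZK x)) _; first by rewrite divr_ge0 ?ltW.
by rewrite mulrA divfK ?gt_eqF.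
Qed.

Lemma eval_norm_Lop (c : H2) Z j V : (forall i, bounded_linear (Z i)) ->
  eval_norm c Z V -> eval_norm (S j c) Z (Z j \o V).
Proof.
move=> bZ h; have bV := h.1; have [K K0 ZK] := bl_bound (bZ j).
apply/(norm_cvgP (bl_comp (bZ j) bV) (fun m => bl_psum _ m bZ)) => e e0.
move/(norm_cvgP bV (fun m => bl_psum c m bZ)) : h => /(_ _ (divr_gt0 e0 K0))[N _ h].
exists N.+1 => // -[//|m] /= Nm x; rewrite psum_Lop // -(blB (bZ j)).
apply: le_trans (ZK _) _; apply: le_trans (ler_wpM2l (ltW K0) (h m Nm x)) _.
by rewrite mulrA (mulrC K) divfK ?gt_eqF.
Qed.

Lemma eval_norm_sub0 (b c : H2) Z V : (forall i, bounded_linear (Z i)) ->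
  eval_norm b Z V -> eval_norm c Z V -> eval_norm (b - c : H2) Z (cst 0).
Proof.
move=> bZ h h'; have bV := h.1.
apply/(norm_cvgP (@bl_cst0 R H H) (fun m => bl_psum _ m bZ)) => e e0.
have e2 : 0 < e / 2 by rewrite divr_gt0.
move/(norm_cvgP bV (fun m => bl_psum b m bZ)) : h => /(_ _ e2) h.
move/(norm_cvgP bV (fun m => bl_psum c m bZ)) : h' => /(_ _ e2) h'.
apply: filterS2 h h' => m h h' x; rewrite subr0.
have -> : psum (b - c : H2) Z m x = (psum b Z m x - V x) - (psum c Z m x - V x).
  rewrite opprB addrA subrK !psumE -sumrB; apply: eq_bigr => w _.
  by rewrite l2subE scalerBl.
apply: le_trans (ler_nrmD _ _) _; rewrite nrmN.
by have := h x; have := h' x; lra.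
Qed.

End Functions.

Lemma bernoulli_ge (e : R) k : 0 <= e -> 1 + k%:R * e <= (1 + e) ^+ k.
Proof.
move=> e0; elim: k => [|k IH]; first by rewrite mul0r addr0 expr0.
rewrite exprS; apply: le_trans (ler_wpM2l _ IH); last by rewrite addr_ge0.
have : 0 <= k%:R * e ^+ 2 by rewrite mulr_ge0 ?sqr_ge0.
by rewrite -natr1; set a := k%:R; lra.
Qed.

(** Square-summable coefficients define a function on the unit ball. For large
    [k] their square sum [B] is at most [1 + 2 k e], hence at most
    [(1 + e)^(2 k)]. *)
Lemma inv_radius_l2 (c : H2) : (inv_radius c <= 1)%E.
Proof.
apply/lee_addgt0Pr => e e0; rewrite -EFinD.
pose B := nrm c ^+ 2; have B0 : 0 <= B by rewrite sqr_ge0.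
pose N := (Num.truncn (B / e)).+1.
rewrite /inv_radius /limn_esup limf_esupE.
set u := (fun k : nat => _).
apply: (@le_trans _ _ (ereal_sup (u @` [set k | (N <= k)%N]))).
  by apply: ereal_inf_lbound; exists [set k | (N <= k)%N] => //; exists N.
apply: ge_ereal_sup => _ [k /= Nk <-]; rewrite lee_fin.
have k0 : (0 < k)%N by apply: leq_trans Nk.
have e1 : 0 <= 1 + e by rewrite addr_ge0 // ltW.
have sB : \sum_(al : k.-tuple 'I_n) nrm (c al) ^+ 2 <= (1 + e) ^+ (2 * k).
  apply: (@le_trans _ _ B).
    rewrite -[leLHS](big_map (fun al : k.-tuple 'I_n => tval al) xpredT (fun w => nrm (c w) ^+ 2)).
    apply: sum_uniq_le_nrm; rewrite map_inj_uniq; last exact: val_inj.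
    by rewrite /index_enum -enumT enum_uniq.
  apply: le_trans (bernoulli_ge _ (ltW e0)).
  have : B / e <= (2 * k)%:R.
    apply: ltW; apply: lt_le_trans (truncnS_gt _) _; rewrite ler_nat.
    by apply: leq_trans Nk _; rewrite leq_pmull.
  by rewrite ler_pdivrMr // => h; apply: le_trans h _; rewrite lerDr ler01.
have k20 : (2 * k)%:R != 0 :> R by rewrite pnatr_eq0 muln_eq0 /= -lt0n.
have <- : ((1 + e) ^+ (2 * k)) `^ ((2 * k)%:R^-1) = 1 + e.
  by rewrite -powR_mulrn // -powRrM mulfV // powRr1.
apply: ge0_ler_powR => //.
- by rewrite nnegrE; apply: sumr_ge0 => al _; apply: sqr_ge0.
- by rewrite nnegrE exprn_ge0.
Qed.

(** An element of [H^2(f)] is determined by its values on the ball, so that the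
    required identities can be checked on values, where the multiplications are
    products of operators. *)
Lemma model_F_universal f g M : model_F f g M -> universal f M.
Proof.
move=> [H [gam [_ [_ fball] finj _ [HM [L HL fML]]]]].
have sep (x y : H2) : (forall X : 'I_n -> H -> H, open_ball gam X ->
    exists2 V, comp_at x f X V & comp_at y f X V) -> x = y.
  move=> xy; apply/eqP; rewrite -subr_eq0; apply/eqP; apply: l2_ext => w.
  have : l2fun (x - y) = cst 0 :> (word -> R[i]).
    apply: finj; first exact: inv_radius_l2.
    move=> X bX; have [V [Z fZ xV] [Z' fZ' yV]] := xy X bX.
    have EZ := eval_norm_family bX.1 fZ fZ'; rewrite -EZ in yV.
    exists Z => //; apply: (eval_norm_sub0 _ xV yV) => i; exact: (fZ i).1.
  by move=> ->.
have bM i : bounded_linear (M i) by case: (HM i).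
have LS : L = S.
  apply/funext => j; apply/funext => c; apply: sep => X bX.
  have [P [V [fP [Z fZ cV] LV]]] := (HL j).2 c X bX.
  have bZ i : bounded_linear (Z i) := (fZ i).1.
  exists (P \o V) => //; exists Z => //.
  rewrite (eval_norm_uniq bX.1 fP (fZ j)).
  exact: eval_norm_Lop.
split; [exact: bM|by rewrite -LS|].
move=> i j c; apply: sep => X bX.
have [P [V [fP [Z fZ cV] [Z1 fZ1 MV]]]] := (HM i).2 c X bX.
have [P' [V' [fP' [Z2 fZ2 cV'] MV']]] := (HM i).2 (Rr j c) X bX.
have bZ k : bounded_linear (Z k) := (fZ k).1.
rewrite -(eval_norm_family bX.1 fZ fZ1) in MV.
rewrite -(eval_norm_family bX.1 fZ fZ2) in cV'.
exists (P' \o V') => //; exists Z => //.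
rewrite (eval_norm_uniq bX.1 fP' fP) (eval_norm_uniq bZ cV' (eval_norm_Rop j bZ cV)).
exact: (eval_norm_Rop j bZ MV).
Qed.

Lemma model_universal f g M : model f g M -> universal f M.
Proof.
by case=> [/model_A_universal|/model_S_universal|/model_F_universal].
Qed.

End Models.

(** * Defect spaces *)

Opaque sqrt_op Defs.proj tensor_op.

Section DefectSpaces.
Variables (R : realType) (n : nat) (H : hilbertType R).
Notation word := (seq 'I_n).
Notation G := (l2 'I_n H).
Variables (X : G -> H) (X' : H -> G) (Ds : G -> G) (Dl : H -> H).
Hypothesis col : colligation X X' Ds Dl.
Variable N : set (l2 word R[i]).
Hypothesis cN : closed_subspace N.
Hypothesis RN : forall i a, orth N a -> orth N (Rop R[i] i a).

Let bX := col_bX col.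
Let bX' := col_bX' col.
Let bDs := col_bDs col.
Let bDl := col_bDl col.
Notation D1 := (cspan (range Ds)).
Notation D2 := (cspan (range Dl)).
Notation Th := (Thop X X' Ds Dl).
Notation K := (Kop X X' Ds Dl).
Notation st := (state X' Ds).

Let c1 : closed_subspace D1 := @csub_cspan R G (range Ds).
Let c2 : closed_subspace D2 := @csub_cspan R H (range Dl).

Lemma D1_X u : D1 u -> D2 (X u).
Proof.
move=> Du; apply: (@map_cspan _ _ _ X _ _ bX c2 _ _ Du) => _ [v _ <-].
by rewrite (col_XDs col); apply: sub_cspan; exists (X v).
Qed.

Lemma D2_X' h : D2 h -> D1 (X' h).
Proof.
move=> Dh; apply: (@map_cspan _ _ _ X' _ _ bX' c1 _ _ Dh) => _ [v _ <-].
by rewrite (col_X'Dl col); apply: sub_cspan; exists (X' v).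
Qed.

Lemma D2_Dl h : D2 (Dl h).
Proof. by apply: sub_cspan; exists h. Qed.

Lemma pw_proj_fix (L : hilbertType R) (D : set L) (cD : closed_subspace D) (x : l2 word L) :
  (forall w, D (x w)) <-> pw (proj D) x = x.
Proof.
have bD := bl_proj cD; split=> [Dx|xx w].
  by apply: l2_ext => w; rewrite (pwE bD) (proj_id cD).
by rewrite -xx (pwE bD); apply: proj_in.
Qed.

Lemma adj_proj (L : hilbertType R) (D : set L) (cD : closed_subspace D) : adj (proj D) = proj D.
Proof. exact: adj_uniq (bl_proj cD) (inner_proj cD). Qed.

Lemma Th_space x : tensor_space N D1 x -> tensor_space N D2 (projN N _ (Th x)).
Proof.
move=> /(tensor_spaceP N c1)[_ Dx]; apply/(tensor_spaceP N c2).
split; first exact: projN_idem.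
apply/(pw_proj_fix c2); rewrite -(projN_pw cN (bl_proj c2)).
congr (projN N _ _); apply/(pw_proj_fix c2) => w.
rewrite /Thop (XiE col) /output; apply: (csubB c2); first exact: D2_Dl.
exact: (D1_X (Dx w)).
Qed.

(** [Th^* v] lies in [N (x) G] because [Thop] preserves the kernel of
    [P_N (x) I]. It lies in [D1] at each word: on an input [z] orthogonal to
    [D1] the operator [Ds] vanishes, so that all states vanish and the output is
    [- X z], whose inner product with [v] is [0] as [X'] maps [D2] into
    [D1]. *)
Lemma adj_Th_space v : tensor_space N D2 v -> tensor_space N D1 (adj Th v).
Proof.
move=> /(tensor_spaceP N c2)[Pv Dv]; apply/(tensor_spaceP N c1).
have bT := bl_Thop col.
split.
  apply: inner_inj => x; rewrite -inner_projN -2!(adjP bT) -Pv -2!inner_projN.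
  by rewrite [in RHS](projN_Thop col cN RN).
apply/(pw_proj_fix c1); apply: inner_inj => x.
have bP1 := bl_proj c1.
rewrite -[in LHS](adj_proj c1) -(inner_pw bP1).
apply/eqP; rewrite eq_sym -subr_eq0 -innerBl; apply/eqP.
set z := x - pw (proj D1) x.
have zw w : orth D1 (z w) by rewrite /z l2subE (pwE bP1); exact: proj_orth.
have Dsz w : Ds (z w) = 0.
  apply: inner_inj => u; rewrite inner0r -(col_adjDs col) -(adjP bDs).
  by apply: zw; apply: sub_cspan; exists u.
have stz w : st 0 z w = 0.
  elim/last_ind: w => [//|w i IH].
  by rewrite state_rcons IH Dsz (bl0 bX') addr0.
have -> : inner z (adj Th v) = - inner z (pw X' v).
  rewrite -(adjP bT) -[in RHS](col_adjX col) -(inner_pw bX) -innerNl; congr inner.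
  apply: l2_ext => w; rewrite /Thop (XiE col) /output stz (bl0 bDl) sub0r.
  by rewrite -[RHS]/(- (pw X z w)) (pwE bX).
have yD : pw (proj D1) (pw X' v) = pw X' v.
  by apply/(pw_proj_fix c1) => w; rewrite (pwE bX'); exact: (D2_X' (Dv w)).
rewrite -yD -{1}(adj_proj c1) -(inner_pw bP1).
have -> : pw (proj D1) z = 0.
  apply: l2_ext => w; rewrite (pwE bP1); apply: (proj_uniq c1); first exact: (csub0 c1).
  by rewrite subr0; apply: zw.
by rewrite inner0l oppr0.
Qed.

Lemma Kop_space h : (forall a k, orth N a -> inner (tens a k) (K h) = 0) ->
  tensor_space N D2 (K h).
Proof.
move=> Kh; apply/(tensor_spaceP N c2); split; first exact: projN_fix.
move=> w; rewrite /Kop (XiE col) /output -[l2fun 0 w]/(0 : G) (bl0 bX) subr0.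
exact: D2_Dl.
Qed.

Lemma KopE h w : K h w = Dl (st h (cst 0) w).
Proof. by rewrite /Kop (XiE col) /output -[l2fun 0 w]/(0 : G) (bl0 bX) subr0. Qed.

End DefectSpaces.

(** * Isometries with dense domain *)

Section Isometries.
Variable R : realType.
Implicit Types H K V : hilbertType R.

(** By polarization. *)
Lemma isometry_inner H K (E : set H) (tau : H -> K) : closed_subspace E -> bounded_linear tau ->
  (forall x, E x -> nrm (tau x) = nrm x) ->
  forall x y, E x -> E y -> inner (tau x) (tau y) = inner x y.
Proof.
move=> cE bt tE.
have re x y : E x -> E y -> complex.Re (inner (tau x) (tau y)) = complex.Re (inner x y).
  move=> Ex Ey; have := tE _ (csubD cE Ex Ey); rewrite (blD bt) => /(congr1 (fun r => r ^+ 2)).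
  by rewrite !nrmD_sqr !tE //; lra.
move=> x y Ex Ey; have h1 := re x y Ex Ey.
have h2 : complex.Im (inner (tau x) (tau y)) = complex.Im (inner x y).
  by rewrite !Im_inner -(blZ bt) re //; apply: (csubZ cE).
by move: h1 h2; case: (inner (tau x) (tau y)) (inner x y) => a b [c d] /= -> ->.
Qed.

(** [tau] is isometric on [D] only, so that its adjoint has to be followed by
    the projection onto [D]. *)
Lemma unitary_inverse H K (D : set H) (D' : set K) tau : closed_subspace D -> closed_subspace D' ->
  unitary_on D D' tau -> exists sg : K -> H, [/\ unitary_on D' D sg,
    forall d, D d -> sg (tau d) = d & forall d', D' d' -> tau (sg d') = d'].
Proof.
move=> cD cD' [bt tD im]; have iso := isometry_inner cD bt tD.
pose sg := proj D \o adj tau.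
have bs : bounded_linear sg := bl_comp (bl_proj cD) (bl_adj bt).
have sK d : D d -> sg (tau d) = d.
  move=> Dd; apply: (proj_uniq cD) => // e De.
  by rewrite innerBr -(adjP bt) iso // subrr.
have Ks d' : D' d' -> tau (sg d') = d' by rewrite -im => -[d Dd <-]; rewrite sK.
exists sg; split=> //; split => //.
  by move=> d'; rewrite -im => -[d Dd <-]; rewrite sK // tD.
apply/seteqP; split=> [_ [d' Dd' <-]|d Dd]; first exact: (proj_in cD).
exists (tau d); last exact: sK.
by rewrite -im; exists d.
Qed.

Lemma nrm_pw_isometry (W : choiceType) H K (D : set H) (tau : H -> K) : bounded_linear tau ->
  (forall x, D x -> nrm (tau x) = nrm x) ->
  forall x : l2 W H, (forall w, D (x w)) -> nrm (pw tau x) = nrm x.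
Proof.
move=> bt tD x Dx; apply/eqP; rewrite -(@eqrXn2 _ 2) ?nrm_ge0 // !nrm_l2_sup.
suff -> : sqsum (pw tau x) = sqsum x by [].
apply/funext => A; rewrite /sqsum; by apply: eq_bigr => w _; rewrite (pwE bt) tD.
Qed.

Section Extension.
Variables (V H K : hilbertType R) (E : set V) (a : V -> H) (b : V -> K).
Hypotheses (cE : closed_subspace E) (ba : bounded_linear a) (bb : bounded_linear b).
Hypothesis ab : forall v, E v -> nrm (a v) = nrm (b v).

(** The closure of the graph of [a v |-> b v] for [v] in [E]. Since [a] and
    [b] have equal norms on [E], it is the graph of an isometry. *)
Definition graph_closure (h : H) (k : K) := forall e : R, 0 < e ->
  exists v, [/\ E v, nrm (h - a v) < e & nrm (k - b v) < e].

Lemma graph_closure_exists : (forall (h : H) (e : R), 0 < e -> exists2 v, E v & nrm (h - a v) < e) ->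
  forall h, exists k, graph_closure h k.
Proof.
move=> da h; have [k|u uP] := @choice nat V (fun k v => E v /\ nrm (h - a v) < k.+1%:R^-1).
  by have [|v Ev hv] := da h k.+1%:R^-1; [rewrite invr_gt0|exists v].
have inv (e : R) : 0 < e -> exists M, forall k, (M <= k)%N -> k.+1%:R^-1 <= e.
  move=> e0; exists (Num.truncn e^-1) => k Mk.
  rewrite invf_ple ?posrE //; apply: ltW; apply: lt_le_trans (truncnS_gt _) _.
  by rewrite ler_nat ltnS.
have [e e0|k uk] := seq_complete (u := b \o u).
  have e2 : 0 < e / 2 by rewrite divr_gt0.
  have [M HM] := inv _ e2; exists M => i j /HM Mi /HM Mj.
  have [Ei hi] := uP i; have [Ej hj] := uP j.
  rewrite /= -(blB bb) -ab; last exact: (csubB cE).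
  rewrite (blB ba) -(subrKA h) (le_trans (ler_nrmD _ _)) // (nrm_distC (a (u i))).
  by move: hi hj Mi Mj; move: (i.+1%:R^-1) (j.+1%:R^-1) => p q; lra.
exists k => e e0; have e2 : 0 < e / 2 by rewrite divr_gt0.
have [M HM] := inv _ e0; move/cvg_nrmP : uk => /(_ _ e2)[M' _ uk].
have [Em hm] := uP (maxn M M'); exists (u (maxn M M')); split => //.
  by apply: lt_le_trans hm _; apply: HM; rewrite leq_maxl.
by apply: le_lt_trans (uk _ (leq_maxr M M')) _; lra.
Qed.

Lemma graph_closure_nrm h k : graph_closure h k -> nrm k = nrm h.
Proof.
move=> hk; apply/eqP; rewrite -subr_eq0 -normr_le0; apply/ler_addgt0Pr => e e0.
rewrite add0r; have e2 : 0 < e / 2 by rewrite divr_gt0.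
have [v [Ev hv kv]] := hk _ e2; have := ab Ev.
have := ler_nrmD (h - a v) (a v); have := ler_nrmD (a v - h) h.
have := ler_nrmD (k - b v) (b v); have := ler_nrmD (b v - k) k.
rewrite !subrK (nrm_distC (a v)) (nrm_distC (b v)) => h1 h2 h3 h4 h5.
rewrite ler_norml; apply/andP; split; lra.
Qed.

Lemma graph_closureD h k h' k' : graph_closure h k -> graph_closure h' k' ->
  graph_closure (h + h') (k + k').
Proof.
move=> hk hk' e e0; have e2 : 0 < e / 2 by rewrite divr_gt0.
have [v [Ev hv kv]] := hk _ e2; have [v' [Ev' hv' kv']] := hk' _ e2.
exists (v + v'); split; first exact: (csubD cE).
  by rewrite (blD ba) opprD addrACA (le_lt_trans (ler_nrmD _ _)) //; lra.
by rewrite (blD bb) opprD addrACA (le_lt_trans (ler_nrmD _ _)) //; lra.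
Qed.

Lemma graph_closureZ c h k : graph_closure h k -> graph_closure (c *: h) (c *: k).
Proof.
move=> hk e e0; have c1 : 0 < nrm c + 1 by rewrite ltr_wpDl ?nrm_ge0.
have [v [Ev hv kv]] := hk _ (divr_gt0 e0 c1).
have aux (q : R) : 0 <= q -> q < e / (nrm c + 1) -> nrm c * q < e.
  move=> q0; rewrite ltr_pdivlMr // => h1; apply: le_lt_trans h1.
  by rewrite mulrDr mulr1 mulrC lerDl.
exists (c *: v); split; first exact: (csubZ cE).
  by rewrite (blZ ba) -scalerBr nrmZ; apply: aux hv; apply: nrm_ge0.
by rewrite (blZ bb) -scalerBr nrmZ; apply: aux kv; apply: nrm_ge0.
Qed.

Lemma graph_closure_fun h k k' : graph_closure h k -> graph_closure h k' -> k = k'.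
Proof.
move=> hk /(graph_closureZ (-1)) hk'; have := graph_closure_nrm (graph_closureD hk hk').
rewrite !scaleN1r subrr nrm0 => /nrm_eq0/eqP; rewrite subr_eq0.
by move/eqP.
Qed.

Lemma graph_closure_base v : E v -> graph_closure (a v) (b v).
Proof. by move=> Ev e e0; exists v; rewrite !subrr !nrm0. Qed.

End Extension.

(** The isometry [a v |-> b v] extends by continuity, and the extension is
    onto since the roles of [a] and [b] can be exchanged. *)
Lemma unitary_extension V H K (E : set V) (a : V -> H) (b : V -> K) : closed_subspace E ->
  bounded_linear a -> bounded_linear b -> (forall v, E v -> nrm (a v) = nrm (b v)) ->
  (forall (h : H) (e : R), 0 < e -> exists2 v, E v & nrm (h - a v) < e) ->
  (forall (k : K) (e : R), 0 < e -> exists2 v, E v & nrm (k - b v) < e) ->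
  exists2 U : H -> K, unitary_on setT setT U & forall v, E v -> U (a v) = b v.
Proof.
move=> cE ba bb ab da db.
have [U UP] := choice (graph_closure_exists cE ba bb ab da).
have uniq h k k' : graph_closure E a b h k -> graph_closure E a b h k' -> k = k'.
  exact: graph_closure_fun.
exists U; last first.
  by move=> v Ev; apply: uniq (UP _) _; exact: graph_closure_base.
have iso h : nrm (U h) = nrm h by apply: graph_closure_nrm (UP h).
split.
- apply: (@bl_intro _ _ _ _ 1) => [x y|c x|x]; last by rewrite mul1r iso.
    by apply: uniq (UP _) _; exact: graph_closureD.
  by apply: uniq (UP _) _; exact: graph_closureZ.
- by move=> h _; exact: iso.
apply/seteqP; split=> // k _.
have ba' v : E v -> nrm (b v) = nrm (a v) by move=> /ab.
have [h hk] := graph_closure_exists cE bb ba ba' db k.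
exists h => //; apply: uniq (UP h) _ => e e0.
by have [v [Ev hv kv]] := hk e e0; exists v.
Qed.

Lemma dense_image V H (E : set V) (a : V -> H) : closed_subspace E -> bounded_linear a ->
  (forall h, (forall v, E v -> inner (a v) h = 0) -> h = 0) ->
  forall (h : H) (e : R), 0 < e -> exists2 v, E v & nrm (h - a v) < e.
Proof.
move=> cE ba a0 h e e0.
have : cspan (a @` E) h.
  by apply: orth_total => y Sy; apply: a0 => v Ev; apply: Sy; exists v.
move=> /closureP/(_ e e0)[y [m [c [s [Ss ->]]]] hy].
have [i|v vP] := @choice _ V (fun i v => E v /\ a v = s i).
  by have [v Ev vs] := Ss i; exists v.
exists (\sum_(i < m) c i *: v i).
  by apply: (csub_sum cE) => i; apply: (csubZ cE); case: (vP i).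
rewrite (bl_sum ba) (eq_bigr (fun i => c i *: s i)) // => i _.
by rewrite (blZ ba) (vP i).2.
Qed.

End Isometries.

(** * Tuples annihilated by the ideal *)

Section Ideal.
Variables (R : realType) (n : nat).
Notation word := (seq 'I_n).
Notation H2 := (l2 word R[i]).
Notation S := (fun i : 'I_n => Lop R[i] i).
Variables (f : 'I_n -> fps R n) (M : 'I_n -> H2 -> H2) (J : set (H2 -> H2)).
Hypothesis univ : universal f M.
Hypothesis hJ : wot_closed_ideal M J.

Lemma psum_comm (Y : 'I_n -> H2 -> H2) (L : H2 -> H2) a m x :
  bounded_linear L -> (forall i x, Y i (L x) = L (Y i x)) ->
  psum a Y m (L x) = L (psum a Y m x).
Proof.
move=> bL YL; rewrite !psumE (bl_sum bL); apply: eq_bigr => w _.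
rewrite (blZ bL); congr (_ *: _); elim: w => [//|i w IH].
by rewrite -[LHS]/(Y i (word_op Y w (L x))) IH YL.
Qed.

(** Polynomials in [M] commute with the right creations, and commutation passes
    to limits in the weak operator topology. *)
Lemma Hinfty_comm psi : Hinfty M psi ->
  forall j x, psi (Rop R[i] j x) = Rop R[i] j (psi x).
Proof.
move=> [bpsi cpsi] j x; have bR := bl_Rop R[i] j.
apply: inner_inj => z; rewrite ![inner z _]innerC; congr (_^*%C).
rewrite (adjP bR); apply/eqP; rewrite -subr_eq0; apply/eqP/nrm_eq0.
apply/le_anti; rewrite nrm_ge0 andbT; apply/ler_addgt0Pr => e e0; rewrite add0r.
have e2 : 0 < e / 2 by rewrite divr_gt0.
(* One polynomial approximates [psi] at both pairs that occur in the matrix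
   coefficients of [psi R_j] and [R_j psi]. *)
have [_ [a [m ->]] Be] := cpsi 2%N (fun k => if k == ord0 then Rop R[i] j x else x)
  (fun k => if k == ord0 then z else adj (Rop R[i] j) z) _ e2.
have h0 := Be ord0; have h1 := Be ord_max; move: h0 h1 => /=.
rewrite (psum_comm _ _ _ bR); last by move=> i y; exact: (univ_comm univ).
rewrite !innerBl (adjP bR).
set p := inner _ _; set q := inner _ _; set s := inner _ _ => h0 h1.
have -> : p - s = (p - q) - (s - q) by rewrite opprB addrA subrK.
apply: le_trans (ler_nrmD _ _) _; rewrite nrmN; lra.
Qed.

Lemma J_bl psi : J psi -> bounded_linear psi.
Proof. by case: hJ => sJ _ _ _ _ /sJ[]. Qed.

Lemma J_comm psi : J psi -> forall j x, psi (Rop R[i] j x) = Rop R[i] j (psi x).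
Proof. by case: hJ => sJ _ _ _ _ /sJ /Hinfty_comm. Qed.

Lemma J_eval psi : J psi -> eval_rad (psi (basis R [::])) S psi.
Proof. by move=> Jp; exact: (commuting_eval_rad (J_bl Jp) (J_comm Jp)). Qed.

Lemma near_inner T (F : set_system T) {FF : Filter F} (A : T -> H2 -> H2) (B : H2 -> H2)
    m (x y : 'I_m -> H2) (e : R) : 0 < e -> (forall z, A t z @[t --> F] --> B z) ->
  \forall t \near F, forall j, nrm (inner (B (x j) - A t (x j)) (y j)) < e.
Proof.
move=> e0 AB; apply: filter_forall => j.
have e2 : 0 < e / 2 by rewrite divr_gt0.
have /cvg_nrmP/(_ _ e2) := @inner_cvg R H2 T F FF (fun t => A t (x j)) _ (y j) (AB (x j)).
apply: filterS => t; rewrite innerBl => h; apply: le_lt_trans h _; lra.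
Qed.

(** [psi] is the strong limit of the operators [psi (r S)], which are norm
    limits of polynomials in the left creations. *)
Lemma J_Finfty psi : J psi -> @Finfty R n psi.
Proof.
move=> Jp; have bp := J_bl Jp; split=> // m x y e e0.
have [d [P [/andP[d0 d1] aP [_ PL]]]] := J_eval Jp.
have e2 : 0 < e / 2 by rewrite divr_gt0.
have bS i : bounded_linear (S i) := bl_Lop R[i] i.
have [r [rd hr]] : exists r, d < r < 1 /\
    forall j, nrm (inner (psi (x j) - P r (x j)) (y j)) < e / 2.
  have h : \forall r \near (1 : R)^'-, forall j,
      nrm (inner (psi (x j) - P r (x j)) (y j)) < e / 2 by exact: near_inner.
  by have [r [h1 h2]] := filter_ex (filterI (at_left1_gt d1) h); exists r.
have Pr := @eval_norm_pt _ _ _ _ _ _ (bl_scaled r%:C bS) (aP r rd).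
have hk' : \forall k \near \oo, forall j, nrm (inner (P r (x j) -
    psum (psi (basis R [::])) (fun i => r%:C *: S i) k (x j)) (y j)) < e / 2.
  exact: near_inner.
have [k hk] := filter_ex hk'.
exists (psum (psi (basis R [::])) (fun i => r%:C *: S i) k).
  exists (fun w => (r ^+ size w)%:C * psi (basis R [::]) w), k.
  apply/funext => z; rewrite !psumE; apply: eq_bigr => w _.
  rewrite (word_op_scaled _ _ _ bS) scalerA mulrC; congr (_ *: _).
  elim: w => [//|i w IH].
  by rewrite -[LHS]/(S i (word_op S w z)) IH -left_creationE.
move=> j; rewrite -(subrKA (P r (x j))) innerDl (le_lt_trans (ler_nrmD _ _)) //.
by have := hr j; have := hk j; lra.
Qed.

Notation N := (Nspace J).

Lemma csub_N : closed_subspace N.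
Proof. exact: csub_orth. Qed.

Lemma orth_N a : orth N a -> Mspace J a.
Proof. by move=> Na; apply: (orth_orth (@csub_cspan _ _ _)). Qed.

(** The right creations commute with [J], hence preserve the closure of
    [J H^2]. *)
Lemma Rop_orth_N i a : orth N a -> orth N (Rop R[i] i a).
Proof.
move=> /orth_N Ma x Nx.
have Mr : Mspace J (Rop R[i] i a).
  apply: (@map_cspan _ _ _ (Rop R[i] i) _ _ (bl_Rop R[i] i) (@csub_cspan _ _ _) _ _ Ma).
  move=> _ [A JA [x0 _ <-]]; apply: sub_cspan; exists A => //.
  by exists (Rop R[i] i x0) => //; rewrite (J_comm JA).
by rewrite innerC (Nx _ Mr) conjc0.
Qed.

Section Tuple.
Variables (H : hilbertType R) (g : 'I_n -> H2) (T : 'I_n -> H -> H).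
Hypothesis hT : variety_cnc f g M J T.
Notation A := (eval f T).

Lemma tuple_bl i : bounded_linear (T i).
Proof. by case: hT => -[]. Qed.

Lemma tuple_eval : eval_spec f T A.
Proof.
case: hT => -[bT [Z fZ] _ _] _ _; rewrite (evalE bT fZ) //.
Qed.

Lemma eval_bl i : bounded_linear (A i).
Proof. exact: (eval_spec_bl tuple_eval). Qed.

Lemma eval_row u : nrm (row A u) <= nrm u.
Proof.
case: hT => -[_ _ rA _] _ _; apply: le_trans (opnorm_bound (bl_row eval_bl) u) _.
by rewrite ler_piMl ?nrm_ge0.
Qed.

Lemma tuple_inverse : eval_spec (fun i => g i) A T.
Proof. by case: hT => -[]. Qed.

Notation X := (row A).
Notation X' := (adj (row A)).
Notation Ds := (defect_adj f T).
Notation Dl := (defect f T).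

Lemma tuple_col : colligation X X' Ds Dl.
Proof. exact: row_colligation eval_bl eval_row. Qed.

Let col := tuple_col.
Notation K := (Kop X X' Ds Dl).
Notation st h := (state X' Ds h (cst 0)).

Lemma st_rcons h w i : st h (rcons w i) = adj (A i) (st h w).
Proof.
by rewrite state_rcons (bl0 (col_bDs col)) addr0 (adj_rowE eval_bl).
Qed.

Lemma st_cons h w i : st h (i :: w) = st (adj (A i) h) w.
Proof.
elim/last_ind: w => [|w j IH]; first by rewrite -[[:: i]]/(rcons [::] i) st_rcons.
by rewrite -rcons_cons !st_rcons IH.
Qed.

(** With zero input, the state at [w] is [(A_w)^* h]. *)
Lemma inner_word_st w k h : inner (word_op A w k) h = inner k (st h w).
Proof.
elim: w k h => [//|i w IH] k h.
by rewrite -[word_op _ _ _]/(A i (word_op A w k)) (adjP (eval_bl i)) IH st_cons.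
Qed.

(** [K h = 0] means that all [Dl ((A_w)^* h)] vanish. By induction on [m]
    the powers of [Phi] then satisfy [inner (Phi^m(I) h) h = |h|^2], which
    forces [h = 0] for a completely non-coisometric tuple. *)
Lemma Kop_inj h : K h = 0 -> h = 0.
Proof.
move=> Kh; case: hT => _ cncT _; apply: cncT => m _.
have {Kh} Dh w : Dl (st h w) = 0 by rewrite -(KopE col) Kh.
elim: m h Dh => [|m IH] h Dh; first by rewrite /= inner_normr.
rewrite iterS /Phi fct_sumE inner_suml.
transitivity (\sum_i inner (adj (A i) h) (adj (A i) h)).
  apply: eq_bigr => i _; rewrite /= (adjP (eval_bl i)) IH ?inner_normr // => w.
  by rewrite -st_cons.
have := Dh [::]; rewrite /= -[st h [::]]/h => Dh0.
have e : X (X' h) = h.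
  have := col_sqrDl col h; rewrite Dh0 (bl0 (col_bDl col)) => /esym/eqP.
  by rewrite subr_eq0 => /eqP.
rewrite -inner_normr.
transitivity (inner (X' h) (X' h)).
  by rewrite inner_fin; apply: eq_bigr => i _; rewrite (adj_rowE eval_bl).
by rewrite (adjP' (bl_row eval_bl)) e.
Qed.

Hypothesis evalM : eval f M = S.

(** As [f] at the universal model is the tuple of left creations, [psi] is its
    own symbol in the noncommutative analytic Toeplitz algebra. *)
Lemma J_eval_tuple psi : J psi -> eval_rad (psi (basis R [::])) A (cst 0).
Proof.
move=> Jp; case: hT => _ _; apply; [exact: J_Finfty|exact: Jp|].
by rewrite evalM; exact: J_eval.
Qed.

(** Since [psi] commutes with the right creations, the coefficients of
    [psi e_w] are those of [psi] followed by [w]. So the inner product is the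
    limit as [r -> 1] of [r^|w| inner (psi (r A) A_w (Dl k)) h], and
    [psi (r A)] tends strongly to [0]. *)
Lemma J_kernel_basis psi w k h : J psi ->
  inner (tens (psi (basis R w)) k) (K h) = 0.
Proof.
move=> Jp; have [d [P [/andP[d0 d1] aP [_ PL]]]] := J_eval_tuple Jp.
have bA := eval_bl; set a := psi (basis R w).
have key r : d < r < 1 ->
    inner (tens (dil r a) k) (K h) = (r ^+ size w)%:C * inner (P r (word_op A w (Dl k))) h.
  move=> rd; have bY := bl_scaled r%:C bA.
  have r01 : 0 <= r <= 1 by have /andP[h1 /ltW->] := rd; rewrite andbT ltW // (lt_trans d0).
  have bP := (aP r rd).1.
  have ev : eval_norm a (fun i => r%:C *: A i) (P r \o word_op (fun i => r%:C *: A i) w).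
    rewrite /a; elim/last_ind: (w) => [|v j IH]; first exact: (aP r rd).
    have -> : basis R (rcons v j) = Rop R[i] j (basis R v).
      by rewrite /basis /Rop (reix_single (@unrconsK n j) (@unrcons_ocancel n j)).
    rewrite (J_comm Jp); have := eval_norm_Rop j bY IH; congr (eval_norm _ _ _).
    by apply/funext => x; rewrite -cats1 /= word_op_cat.
  have l1 : (fun m => inner (psum a (fun i => r%:C *: A i) m (Dl k)) h : R[i]) @ \oo -->
      (inner ((P r \o word_op (fun i => r%:C *: A i) w) (Dl k)) h : R[i]).
    exact: inner_cvg (@eval_norm_pt _ _ _ _ _ _ bY ev (Dl k)).
  have l2 : (fun m => inner (tens (trunc m (dil r a)) k) (K h) : R[i]) @ \oo -->
      (inner (tens (dil r a) k) (K h) : R[i]).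
    exact: inner_cvg (bl_cvg (tens_bl_l _ k) (@trunc_cvg _ _ _ (dil r a))).
  have E : (fun m => inner (tens (trunc m (dil r a)) k) (K h)) =
      (fun m => inner (psum a (fun i => r%:C *: A i) m (Dl k)) h).
    apply/funext => m; rewrite psumE inner_suml trunc_sum (bl_sum (tens_bl_l _ k)) inner_suml.
    apply: eq_bigr => v _.
    rewrite (basisE v) (blZ (tens_bl_l _ k)) -single_tens innerZl inner_single (KopE col).
    rewrite -[in LHS](col_adjDl col) -(adjP (col_bDl col)) -inner_word_st.
    rewrite (diagE (dil_itv r01)) (word_op_scaled _ _ _ bA) !innerZl mulrA; congr (_ * _).
    exact: mulrC.
  rewrite E in l2; have := hcvg_uniq l2 l1; rewrite /= => ->.
  by rewrite (word_op_scaled _ _ _ bA) (blZ bP) innerZl.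
have l1 : (fun r => inner (tens (dil r a) k) (K h) : R[i]) @ (1 : R)^'- -->
    (inner (tens a k) (K h) : R[i]).
  exact: inner_cvg (bl_cvg (tens_bl_l _ k) (@dil_cvg _ _ _ a)).
apply: nrm_eq0; apply/le_anti; rewrite nrm_ge0 andbT; apply/ler_addgt0Pr => e e0.
rewrite add0r; have e2 : 0 < e / 2 by rewrite divr_gt0.
have l2 : (fun r => inner (P r (word_op A w (Dl k))) h : R[i]) @ (1 : R)^'- -->
    (inner (0 : H) h : R[i]).
  exact: inner_cvg (PL (word_op A w (Dl k))).
have [r [rd r01 h1 h2]] : exists r, [/\ d < r < 1, 0 < r < 1,
    nrm (inner (tens a k) (K h) - inner (tens (dil r a) k) (K h)) <= e / 2 &
    nrm (inner (0 : H) h - inner (P r (word_op A w (Dl k))) h) <= e / 2].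
  move/cvg_nrmP : l1 => /(_ _ e2) l1; move/cvg_nrmP : l2 => /(_ _ e2) l2.
  have [r [[q1 q2] [q3 q4]]] := filter_ex (filterI (filterI (at_left1_gt d1) (at_left1_itv R))
    (filterI l1 l2)).
  by exists r.
rewrite -(subrK (inner (tens (dil r a) k) (K h)) (inner (tens a k) (K h))).
apply: le_trans (ler_nrmD _ _) _; rewrite [e]splitr lerD // key //.
rewrite -[_ * _]/((r ^+ size w)%:C *: inner (P r (word_op A w (Dl k))) h) nrm_real.
have /andP[r0 r1] := r01; move: h2; rewrite inner0l sub0r nrmN; apply: le_trans.
by rewrite ler_piMl ?nrm_ge0 // ger0_norm ?exprn_ge0 ?(ltW r0) // exprn_ile1 // ltW.
Qed.

Lemma J_kernel psi x k h : J psi -> inner (tens (psi x) k) (K h) = 0.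
Proof.
move=> Jp; have bp := J_bl Jp.
have bF : bounded_linear (fun x : H2 => inner (tens (psi x) k) (K h) : R[i]).
  exact: (bl_comp (bl_inner (K h)) (bl_comp (tens_bl_l _ k) bp)).
apply: (@eq_on_single _ _ R[i] _ _ (cst 0) bF (@bl_cst0 _ _ _)) => w c.
rewrite (basisE w c) (blZ bp) (blZ (tens_bl_l _ k)) innerZl.
by rewrite (J_kernel_basis _ _ _ Jp) mulr0.
Qed.

(** The Poisson kernel takes its values in [N (x) D]: this is what the
    annihilation of the tuple by [J] amounts to. *)
Lemma Kop_in h : tensor_space N (defect_space f T) (K h).
Proof.
apply: (Kop_space col csub_N) => a k /orth_N Ma.
apply: (@eq_on_cspan _ _ _ (fun a : H2 => inner (tens a k) (K h) : R[i]) (cst 0) _ _ _ _ _ Ma).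
- exact: (bl_comp (bl_inner (K h)) (tens_bl_l _ k)).
- exact: bl_cst0.
by move=> _ [psi Jp [x _ <-]]; exact: J_kernel.
Qed.

End Tuple.

End Ideal.

(** * Coincidence and unitary equivalence *)

Section TensorMaps.
Variables (R : realType) (n : nat).
Notation word := (seq 'I_n).
Variable N : set (l2 word R[i]).
Hypothesis cN : closed_subspace N.

Lemma pw_tensor_space (K L : hilbertType R) (D : set K) (D' : set L) (tau : K -> L) x :
  closed_subspace D -> closed_subspace D' -> bounded_linear tau -> (forall d, D d -> D' (tau d)) ->
  tensor_space N D x -> tensor_space N D' (pw tau x).
Proof.
move=> cD cD' bt tD /(tensor_spaceP N cD)[Px Dx]; apply/(tensor_spaceP N cD').
rewrite (projN_pw cN bt) Px; split=> // w; rewrite (pwE bt).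
by apply: tD; exact: Dx.
Qed.

Lemma unitary_on_sub (K L : hilbertType R) (D : set K) (D' : set L) tau :
  unitary_on D D' tau -> forall d, D d -> D' (tau d).
Proof. by move=> [_ _ <-] d Dd; exists d. Qed.

Lemma pw_cancel (K L : hilbertType R) (D : set K) (tau : K -> L) (sg : L -> K)
  (x : l2 word K) : bounded_linear tau -> bounded_linear sg ->
  (forall d, D d -> sg (tau d) = d) -> (forall w, D (x w)) -> pw sg (pw tau x) = x.
Proof.
by move=> bt bs st Dx; apply: l2_ext => w; rewrite (pwE bs) (pwE bt) st.
Qed.

Lemma inner_pw_isometry (K L : hilbertType R) (D : set K) (tau : K -> L) :
  closed_subspace D -> bounded_linear tau -> (forall d, D d -> nrm (tau d) = nrm d) ->
  forall x y : l2 word K, tensor_space N D x -> tensor_space N D y ->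
  inner (pw tau x) (pw tau y) = inner x y.
Proof.
move=> cD bt tD; apply: (isometry_inner (csub_tensor N D) (bl_pw word bt)) => x.
by move=> /(tensor_spaceP N cD)[_ Dx]; exact: nrm_pw_isometry tD _ Dx.
Qed.

End TensorMaps.

Section Main.
Variables (R : realType) (n : nat).
Notation word := (seq 'I_n).
Notation H2 := (l2 word R[i]).
Variables (f : 'I_n -> fps R n) (g : 'I_n -> H2) (M : 'I_n -> H2 -> H2).
Variable J : set (H2 -> H2).
Hypothesis univ : universal f M.
Hypothesis hJ : wot_closed_ideal M J.
Notation N := (Nspace J).
Notation variety := (variety_cnc f g M J).
Notation D1 T := (defect_adj_space f T).
Notation D2 T := (defect_space f T).
Notation X T := (row (eval f T)).
Notation Th T := (Thop (X T) (adj (X T)) (defect_adj f T) (defect f T)).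
Notation K T := (Kop (X T) (adj (X T)) (defect_adj f T) (defect f T)).

Let cN : closed_subspace N := csub_N J.
Let rN := Rop_orth_N univ hJ.

Let evalM : eval f M = (fun i : 'I_n => Lop R[i] i).
Proof. exact: evalE (univ_bl univ) (univ_eval univ). Qed.

Let cD1 (H : hilbertType R) (T : 'I_n -> H -> H) : closed_subspace (D1 T) := @csub_cspan _ _ _.
Let cD2 (H : hilbertType R) (T : 'I_n -> H -> H) : closed_subspace (D2 T) := @csub_cspan _ _ _.

Section Pair.
Variables (H H' : hilbertType R) (T : 'I_n -> H -> H) (T' : 'I_n -> H' -> H').
Hypotheses (hT : variety T) (hT' : variety T').

Let col := tuple_col hT.
Let col' := tuple_col hT'.

(** Coincidence, in terms of the compressions of the input-output maps. *)
Definition theta_match (tau1 : l2 'I_n H -> l2 'I_n H') (tau2 : H -> H') :=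
  forall x, tensor_space N (D1 T) x ->
    projN N _ (Th T' (pw tau1 x)) = pw tau2 (projN N _ (Th T x)).

(** For [x0 = Th^* v], coincidence gives [|x0|^2 = inner (tau1 x0) (Th'^*
    (tau2 v))]. The opposite inequality will follow by exchanging the two
    tuples. *)
Lemma adj_Thop_le tau1 tau2 : unitary_on (D1 T) (D1 T') tau1 ->
  unitary_on (D2 T) (D2 T') tau2 -> theta_match tau1 tau2 ->
  forall v, tensor_space N (D2 T) v -> nrm (adj (Th T) v) <= nrm (adj (Th T') (pw tau2 v)).
Proof.
move=> u1 u2 mt v Ev; have [bt1 iso1 _] := u1; have [bt2 iso2 _] := u2.
have bT := bl_Thop col; have bT' := bl_Thop col'.
set x0 := adj (Th T) v; have Ex0 : tensor_space N (D1 T) x0.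
  exact: (adj_Th_space col cN rN Ev).
have Ey : tensor_space N (D2 T) (projN N _ (Th T x0)) by exact: (Th_space col cN Ex0).
have Ev' : tensor_space N (D2 T') (pw tau2 v).
  exact: (pw_tensor_space cN (cD2 T) (cD2 T') bt2 (unitary_on_sub u2) Ev).
have [Pv _] := (tensor_spaceP N (cD2 T) v).1 Ev.
have [Pv' _] := (tensor_spaceP N (cD2 T') (pw tau2 v)).1 Ev'.
have E : inner x0 x0 = inner (pw tau1 x0) (adj (Th T') (pw tau2 v)).
  rewrite -(adjP bT') -Pv' -inner_projN mt //.
  rewrite (inner_pw_isometry (cD2 T) bt2 iso2 Ey Ev) inner_projN Pv.
  by rewrite (adjP bT).
have [x00|x0n] := eqVneq (nrm x0) 0; first by rewrite x00 nrm_ge0.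
have xp : 0 < nrm x0 by rewrite lt_neqAle eq_sym x0n nrm_ge0.
rewrite -(ler_pM2l xp) -expr2 -Re_inner E.
apply: le_trans (Re_cauchy_schwarz _ _) _.
have [_ Dx0] := (tensor_spaceP N (cD1 T) x0).1 Ex0.
by rewrite (nrm_pw_isometry bt1 iso1 Dx0).
Qed.

End Pair.

Lemma theta_match_sym (H H' : hilbertType R) (T : 'I_n -> H -> H) (T' : 'I_n -> H' -> H')
    (hT : variety T) tau1 tau2 sg1 sg2 :
  unitary_on (D2 T) (D2 T') tau2 ->
  unitary_on (D1 T) (D1 T') tau1 ->
  unitary_on (D1 T') (D1 T) sg1 -> unitary_on (D2 T') (D2 T) sg2 ->
  (forall d, D1 T' d -> tau1 (sg1 d) = d) -> (forall d, D2 T d -> sg2 (tau2 d) = d) ->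
  theta_match T T' tau1 tau2 -> theta_match T' T sg1 sg2.
Proof.
move=> u2 u1 v1 v2 K1 K2 mt x Ex; have [bt1 _ _] := u1; have [bs1 _ _] := v1.
have [bt2 _ _] := u2; have [bs2 _ _] := v2.
have Es : tensor_space N (D1 T) (pw sg1 x).
  exact: (pw_tensor_space cN (cD1 T') (cD1 T) bs1 (unitary_on_sub v1) Ex).
have [_ Dx] := (tensor_spaceP N (cD1 T') x).1 Ex.
have := mt _ Es; rewrite (pw_cancel bs1 bt1 K1 Dx) => ->.
have [_ Dy] := (tensor_spaceP N (cD2 T) _).1 (Th_space (tuple_col hT) cN Es).
by rewrite (pw_cancel bt2 bs2 K2 Dy).
Qed.

Lemma ThetaE_tuple (H : hilbertType R) (T : 'I_n -> H -> H) (hT : variety T) x :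
  tensor_space N (D1 T) x -> Theta f T N x = projN N _ (Th T x).
Proof.
move=> /(tensor_spaceP N (cD1 T))[Px _].
exact: (ThetaE (eval_bl hT) (eval_row hT) cN rN Px).
Qed.

(** By [Xi_adj_norm] the norms of [K^* v] and [K'^* (tau2 v)] are equal on
    [N (x) D], and both maps have dense range as [K] and [K'] are injective
    into [N (x) D] and [N (x) D']. So [K^* v |-> K'^* (tau2 v)] extends
    to a unitary, which turns out to intertwine the tuples. *)
Lemma coincide_unitary (H H' : hilbertType R) (T : 'I_n -> H -> H) (T' : 'I_n -> H' -> H') :
  variety T -> variety T' ->
  coincide N (D1 T) (D2 T) (D1 T') (D2 T') (Theta f T N) (Theta f T' N) ->
  unitarily_equivalent T T'.
Proof.
move=> hT hT' [tau1 [tau2 [u1 u2 ct]]].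
have col := tuple_col hT; have col' := tuple_col hT'.
have [bt1 iso1 _] := u1; have [bt2 iso2 _] := u2.
have [sg1 [v1 K1 K1']] := unitary_inverse (cD1 T) (cD1 T') u1.
have [sg2 [v2 K2 K2']] := unitary_inverse (cD2 T) (cD2 T') u2.
have [bs2 isos2 _] := v2.
have sub1 x : tensor_space N (D1 T) x -> tensor_space N (D1 T') (pw tau1 x).
  exact: (pw_tensor_space cN (cD1 T) (cD1 T') bt1 (unitary_on_sub u1)).
have sub2 x : tensor_space N (D2 T) x -> tensor_space N (D2 T') (pw tau2 x).
  exact: (pw_tensor_space cN (cD2 T) (cD2 T') bt2 (unitary_on_sub u2)).
have sub2' x : tensor_space N (D2 T') x -> tensor_space N (D2 T) (pw sg2 x).
  exact: (pw_tensor_space cN (cD2 T') (cD2 T) bs2 (unitary_on_sub v2)).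
have back2 y : tensor_space N (D2 T') y -> pw tau2 (pw sg2 y) = y.
  by move=> /(tensor_spaceP N (cD2 T'))[_ Dy]; exact: (pw_cancel bs2 bt2 K2' Dy).
have back2' y : tensor_space N (D2 T) y -> pw sg2 (pw tau2 y) = y.
  by move=> /(tensor_spaceP N (cD2 T))[_ Dy]; exact: (pw_cancel bt2 bs2 K2 Dy).
have mt : theta_match T T' tau1 tau2.
  move=> x Ex; have := ct x Ex; rewrite !tensor_op_id //.
  by rewrite (ThetaE_tuple hT Ex) (ThetaE_tuple hT' (sub1 _ Ex)).
have mt' := theta_match_sym hT u2 u1 v1 v2 K1' K2 mt.
have nT v : tensor_space N (D2 T) v -> nrm (adj (Th T) v) = nrm (adj (Th T') (pw tau2 v)).
  move=> Ev; apply/le_anti; rewrite (adj_Thop_le hT hT' u1 u2 mt Ev) /=.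
  have := adj_Thop_le hT' hT v1 v2 mt' (sub2 _ Ev).
  by rewrite (back2' _ Ev).
have bK := bl_Kop col; have bK' := bl_Kop col'.
pose a := adj (K T); pose b := adj (K T') \o pw tau2.
have ba : bounded_linear a := bl_adj bK.
have bb : bounded_linear b := bl_comp (bl_adj bK') (bl_pw word bt2).
have ab v : tensor_space N (D2 T) v -> nrm (a v) = nrm (b v).
  move=> Ev; apply/eqP; rewrite -(@eqrXn2 _ 2) ?nrm_ge0 //; apply/eqP.
  have h1 := Xi_adj_norm col v; have h2 := Xi_adj_norm col' (pw tau2 v).
  have [_ Dv] := (tensor_spaceP N (cD2 T) v).1 Ev.
  rewrite (nrm_pw_isometry bt2 iso2 Dv) -(nT v Ev) in h2.
  by apply: (addIr (nrm (adj (Th T) v) ^+ 2)); rewrite h1 -h2.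
have cE := csub_tensor N (D2 T).
have Kin h := Kop_in univ hJ hT evalM h; have Kin' h := Kop_in univ hJ hT' evalM h.
have da : forall (h : H) (e : R), 0 < e ->
    exists2 v, tensor_space N (D2 T) v & nrm (h - a v) < e.
  apply: dense_image => // h hv; apply: (Kop_inj hT).
  apply: inner_self_eq0; rewrite -(adjP' bK); exact: hv (Kin h).
have db : forall (h : H') (e : R), 0 < e ->
    exists2 v, tensor_space N (D2 T) v & nrm (h - b v) < e.
  apply: dense_image => // h hv; apply: (Kop_inj hT').
  apply: inner_self_eq0; rewrite -(adjP' bK').
  by have := hv _ (sub2' _ (Kin' h)); rewrite /b /= (back2 _ (Kin' h)).
have [U [bU isoU imU] UE] := unitary_extension cE ba bb ab da db.
have iU := isometry_inner (@csub_setT _ _) bU isoU.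
(* Dual form of [U (K^* v) = K'^* (tau2 v)]. *)
have KU h : K T' (U h) = pw tau2 (K T h).
  have Ed : tensor_space N (D2 T') (K T' (U h) - pw tau2 (K T h)).
    apply: (csubB (csub_tensor N (D2 T'))); [exact: Kin'|exact: sub2 (Kin h)].
  apply/eqP; rewrite -subr_eq0; apply/eqP/inner_self_eq0.
  rewrite -{2}(back2 _ Ed); set v := pw sg2 _.
  have Ev : tensor_space N (D2 T) v by exact: sub2' Ed.
  rewrite innerBl (adjP bK') -[adj _ _]/(b v) -UE // iU //.
  rewrite /a -(adjP bK) (inner_pw_isometry (cD2 T) bt2 iso2 (Kin h) Ev) subrr //.
have bA := eval_bl hT; have bA' := eval_bl hT'.
(* The first letter of a word of [K h] can be absorbed by [h]. *)
have Kcons (L : hilbertType R) (Q : 'I_n -> L -> L) (hQ : variety Q) h i w :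
    K Q (adj (eval f Q i) h) w = K Q h (i :: w).
  by rewrite !(KopE (tuple_col hQ)) (st_cons hQ).
have UA' i h : U (adj (eval f T i) h) = adj (eval f T' i) (U h).
  apply/eqP; rewrite -subr_eq0; apply/eqP; apply: (Kop_inj hT').
  rewrite (blB bK') KU; apply/eqP; rewrite subr_eq0; apply/eqP; apply: l2_ext => w.
  by rewrite (pwE bt2) (Kcons _ _ hT) (Kcons _ _ hT') KU (pwE bt2).
have uU : unitary_on setT setT U by [].
have [V [[bV _ _] UK VK]] := unitary_inverse (@csub_setT _ H) (@csub_setT _ H') uU.
have UA i h : U (eval f T i h) = eval f T' i (U h).
  apply: inner_inj => z; rewrite -(VK z I) iU // -(adjP' (bA i)) -(iU (adj _ _)) //.
  by rewrite UA' (adjP' (bA' i)).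
exists U => // i; apply/funext => h /=.
have canU : cancel U V by move=> x; exact: UK.
have canV : cancel V U by move=> x; exact: VK.
(* [U] intertwines [f(T)] and [f(T')], hence the values of [g] there, which are
   [T] and [T']. *)
have E1 := eval_spec_conj bU bV canU canV bA (tuple_inverse hT).
have E2 : (fun i => conj_by U V (eval f T i)) = eval f T'.
  by apply/funext => j; apply/funext => x; rewrite /conj_by /= UA canV.
rewrite E2 in E1.
have := eval_spec_uniq bA' E1 (tuple_inverse hT').
move=> /(congr1 (fun Z => Z i (U h))); rewrite /conj_by /= canU => <-.
by [].
Qed.

(** Evaluations, adjoints and positive square roots are unique, hence
    transported by [U]; so are the states and outputs computed from them. *)
Lemma unitary_coincide (H H' : hilbertType R) (T : 'I_n -> H -> H) (T' : 'I_n -> H' -> H') :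
  variety T -> variety T' -> unitarily_equivalent T T' ->
  coincide N (D1 T) (D2 T) (D1 T') (D2 T') (Theta f T N) (Theta f T' N).
Proof.
move=> hT hT' [U uU UT]; have [bU isoU _] := uU.
have [V [[bV _ _] UK VK]] := unitary_inverse (@csub_setT _ H) (@csub_setT _ H') uU.
have canU : cancel U V by move=> x; exact: UK.
have canV : cancel V U by move=> x; exact: VK.
have iU := isometry_inner (@csub_setT _ _) bU isoU.
have col := tuple_col hT; have col' := tuple_col hT'.
have bA := eval_bl hT; have bA' := eval_bl hT'.
have bX := col_bX col; have bX' := col_bX col'.
have ET : (fun i => conj_by U V (T i)) = T'.
  apply/funext => i; apply/funext => x.
  by have := congr1 (@^~ (V x)) (UT i); rewrite /conj_by /= canV.
have EA : eval f T' = (fun i => conj_by U V (eval f T i)).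
  apply: (evalE (tuple_bl hT')); rewrite -ET.
  exact: (eval_spec_conj bU bV canU canV (tuple_bl hT) (tuple_eval hT)).
have bpU := bl_pw 'I_n bU; have bpV := bl_pw 'I_n bV.
have UX u : U (X T u) = X T' (pw U u).
  rewrite /row (bl_sum bU); apply: eq_bigr => i _.
  by rewrite EA /conj_by /= (pwE bU) canU.
have VX h : pw U (adj (X T) h) = adj (X T') (U h).
  apply: inner_inj => z.
  have zE : z = pw U (pw V z) by apply: l2_ext => i; rewrite (pwE bU) (pwE bV) canV.
  rewrite -(adjP bX') zE -UX iU // (adjP bX).
  apply: (isometry_inner (@csub_setT _ _) bpU) => // y _.
  by apply: (nrm_pw_isometry bU isoU).
have [DsU DlU] : (forall u, pw U (defect_adj f T u) = defect_adj f T' (pw U u)) /\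
    (forall h, U (defect f T h) = defect f T' (U h)).
  rewrite (defectE bA) (defectE bA') !defect_adjE.
  exact: (defect_transport bX (eval_row hT) bX' (eval_row hT') bU bpU UX VX).
have stU (x : l2 word (l2 'I_n H)) w :
    state (adj (X T')) (defect_adj f T') 0 (pw (pw U) x) w =
    U (state (adj (X T)) (defect_adj f T) 0 x w).
  elim/last_ind: w => [|w i IH]; first by rewrite !state_nil (bl0 bU).
  by rewrite !state_rcons IH (pwE bpU) -VX -DsU -(blD bpU) (pwE bU).
have ThU x : Th T' (pw (pw U) x) = pw U (Th T x).
  apply: l2_ext => w; rewrite (pwE bU) /Thop (XiE col') (XiE col) /output stU.
  by rewrite (pwE bpU) -UX -DlU (blB bU).
have D1U d : D1 T d -> D1 T' (pw U d).
  move=> Dd; apply: (@map_cspan _ _ _ (pw U) _ _ bpU (cD1 T') _ _ Dd) => _ [u _ <-].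
  by rewrite DsU; apply: sub_cspan; exists (pw U u).
have D2U d : D2 T d -> D2 T' (U d).
  move=> Dd; apply: (@map_cspan _ _ _ U _ _ bU (cD2 T') _ _ Dd) => _ [u _ <-].
  by rewrite DlU; apply: sub_cspan; exists (U u).
have pUV u : pw U (pw V u) = u by apply: l2_ext => i; rewrite (pwE bU) (pwE bV) canV.
have pVU u : pw V (pw U u) = u by apply: l2_ext => i; rewrite (pwE bV) (pwE bU) canU.
have u1 : unitary_on (D1 T) (D1 T') (pw U).
  split=> //; first by move=> x _; apply: (nrm_pw_isometry bU isoU).
  apply/seteqP; split=> [_ [d Dd <-]|d Dd]; first exact: D1U.
  exists (pw V d); last exact: pUV.
  apply: (@map_cspan _ _ _ (pw V) _ _ bpV (cD1 T) _ _ Dd) => _ [u _ <-].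
  by rewrite -[u]pUV -DsU pVU; apply: sub_cspan; exists (pw V u).
have u2 : unitary_on (D2 T) (D2 T') U.
  split=> //; first by move=> x _; apply: isoU.
  apply/seteqP; split=> [_ [d Dd <-]|d Dd]; first exact: D2U.
  exists (V d); last exact: canV.
  apply: (@map_cspan _ _ _ V _ _ bV (cD2 T) _ _ Dd) => _ [u _ <-].
  by rewrite -[u]canV -DlU canU; apply: sub_cspan; exists (V u).
exists (pw U), U; split=> // x Ex; rewrite !tensor_op_id //.
have Ex' := pw_tensor_space cN (cD1 T) (cD1 T') bpU D1U Ex.
by rewrite (ThetaE_tuple hT Ex) (ThetaE_tuple hT' Ex') ThU (projN_pw cN bU).
Qed.

End Main.

Theorem theorem4p5 (R : realType) (n : nat) (hn : (0 < n)%N)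
    (f : 'I_n -> fps R n)
    (g : 'I_n -> l2 (seq 'I_n) R[i])
    (M : 'I_n -> l2 (seq 'I_n) R[i] -> l2 (seq 'I_n) R[i])
    (hf : model f g M)
    (J : set (l2 (seq 'I_n) R[i] -> l2 (seq 'I_n) R[i]))
    (hJ : wot_closed_ideal M J) (hJneq : J <> Hinfty M)
    (H H' : hilbertType R)
    (T : 'I_n -> H -> H) (hT : variety_cnc f g M J T)
    (T' : 'I_n -> H' -> H') (hT' : variety_cnc f g M J T') :
  unitarily_equivalent T T' <->
  coincide (Nspace J)
    (defect_adj_space f T) (defect_space f T)
    (defect_adj_space f T') (defect_space f T')
    (Theta f T (Nspace J)) (Theta f T' (Nspace J)).
Proof.
have univ := model_universal hf.
split; first exact: unitary_coincide univ hJ _ _ _ _ hT hT'.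
exact: coincide_unitary univ hJ _ _ _ _ hT hT'.
Qed.
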